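(* Let $n\ge1$, $1\le M\le n$, and let $\underline{s}\in\mathbb{R}^n$ with $s_i>\frac12$ for $i\neq M$ and $s_M>0$. The variance function of the Wishart exponential family $(\gamma^{(M)}_{\underline{s},y})_{y\in P_G}$ on $Q_G$ is, for $m\in Q_G$, $$V(m)=\Bigl(\frac1{s_1}+\frac1{s_n}-\frac1{s_M}\Bigr)\mathbb{P}(\hat m)+\sum_{i=1}^{M-1}\Bigl(\frac1{s_{i+1}}-\frac1{s_i}\Bigr)\mathbb{P}(\hat m-M_{\{1:i\}})+\sum_{i=M+1}^{n}\Bigl(\frac1{s_{i-1}}-\frac1{s_i}\Bigr)\mathbb{P}(\hat m-M_{\{i:n\}}).$$
   Context: $G=A_n$ is the path graph $1-2-\cdots-n$ on $V=\{1,\dots,n\}$; $E=\{(i,j): |i-j|\le 1\}$. $S_n$ is the space of real symmetric $n\times n$ matrices, $Z_G=\{y\in S_n:y_{ij}=0\text{ if }(i,j)\notin E\}$; $P_G$ is the set of positive definite $y\in Z_G$. $I_G$ is the dual space of $Z_G$, realised as the space of incomplete symmetric matrices $\eta=(\eta_{ij})_{(i,j)\in E}$, with $\langle y,\eta\rangle=\mathrm{tr}(y\eta)=\sum_{(i,j)\in E}y_{ij}\eta_{ij}$. $Q_G=\{\eta\in I_G:\langle y,\eta\rangle>0\ \forall y\in\overline{P_G}\setminus\{0\}\}$. $\pi:S_n\to I_G$ keeps the entries indexed by $E$. $d\eta$ is Lebesgue measure on $I_G$. For $I\subset V$, a subscript $I$ denotes the submatrix with rows and columns in $I$; $\{i:j\}=\{i,\dots,j\}$;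 $|\cdot|$ is the determinant. For a matrix $K$ indexed by $B\subset V$, $K^0$ is the $n\times n$ matrix with $(K^0)_{ij}=K_{ij}$ if $i,j\in B$ and $0$ otherwise. With $s_0=s_{n+1}=0$, for $\eta\in Q_G$, $$\delta^{(M)}_{\underline{s}}(\eta)=\frac{\prod_{i=1}^{M-1}|\eta_{\{i:i+1\}}|^{s_i}\prod_{i=M+1}^{n}|\eta_{\{i-1:i\}}|^{s_i}}{\prod_{i=2}^{M-1}\eta_{ii}^{s_{i-1}}\cdot\eta_{MM}^{s_{M-1}-s_M+s_{M+1}}\cdot\prod_{i=M+1}^{n-1}\eta_{ii}^{s_{i+1}}};$$ $\varphi_{A_1}(\eta)=\eta^{-1}$, and for $n\ge2$, $\varphi_{A_n}(\eta)=\prod_{i=1}^{n-1}|\eta_{\{i,i+1\}}|^{-3/2}\prod_{i=2}^{n-1}\eta_{ii}$. For $y\in P_G$, $\gamma^{(M)}_{\underline{s},y}$ is the probability measure on $Q_G$ with density proportional to $e^{-\mathrm{tr}(y\eta)}\delta^{(M)}_{\underline{s}}(\eta)\varphi_{A_n}(\eta)$ with respect to $d\eta$. Its mean function $m^{(M)}_{\underline{s}}(y)=\int\eta\,\gamma^{(M)}_{\underline{s},y}(d\eta)$ is a diffeomorphism $P_G\to Q_G$ with inverse $\psi^{(M)}_{\underline{s}}$. The covariance operator $v(y):Z_G\to I_G$ is defined by $\langle z',v(y)z\rangle=\mathrm{Cov}(\langle z,X\rangle,\langle z',X\rangle)$ for $X\sim\gamma^{(M)}_{\underline{s},y}$ (equivalently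 $v(y)$ is minus the differential of $m^{(M)}_{\underline{s}}$ at $y$), and the variance function is $V(m)=v(\psi^{(M)}_{\underline{s}}(m)):Z_G\to I_G$. For $m\in Q_G$, $\hat m$ is the unique positive definite matrix in $S_n$ with $\pi(\hat m)=m$ and $\hat m^{-1}\in P_G$. For $I\subset V$, $M_I=[((\hat m^{-1})_I)^{-1}]^0$. For $A\in S_n$, $\mathbb{P}(A):Z_G\to I_G$ is $\mathbb{P}(A)u=\pi(AuA)$. *)

(* Defs.v *)
From HB Require Import structures.
From mathcomp Require Import all_boot all_order all_algebra perm.
From mathcomp Require Import all_classical all_reals all_analysis.
From mathcomp Require Import measurable_realfun.
From mathcomp Require Import ring lra.

Set Implicit Arguments.
Unset Strict Implicit.
Unset Printing Implicit Defensive.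

Import Order.TTheory GRing.Theory Num.Theory.
Import numFieldNormedType.Exports.

Local Open Scope classical_set_scope.
Local Open Scope ring_scope.

(* Lebesgue measure on R^k, as the k-fold product of the one-dimensional
   Lebesgue measure. *)
Section lebesgue_tuple.
Variable R : realType.
Local Notation RT := (measurableTypeR R).

Definition cons_tuple k (x : RT * k.-tuple RT) : k.+1.-tuple RT :=
  [tuple of x.1 :: x.2].

Lemma measurable_cons_tuple k : measurable_fun setT (@cons_tuple k).
Proof. exact: measurable_cons. Qed.

Section step.
Variables (k : nat) (mu : {sigma_finite_measure set (k.-tuple RT) -> \bar R}).

Definition lebesgue_cons : set (k.+1.-tuple RT) -> \bar R :=
  pushforward (lebesgue_measure \x mu)%E (@cons_tuple k).

Let mpre A : measurable A -> measurable (@cons_tuple k @^-1` A).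
Proof.
by move=> mA; rewrite -[X in measurable X]setTI; exact: measurable_cons_tuple.
Qed.

Let lebesgue_cons0 : lebesgue_cons set0 = 0%E.
Proof. by rewrite /lebesgue_cons /pushforward preimage_set0 measure0. Qed.

Let lebesgue_cons_ge0 A : (0 <= lebesgue_cons A)%E.
Proof. by rewrite /lebesgue_cons /pushforward; exact: measure_ge0. Qed.

Let lebesgue_cons_sigma_additive : semi_sigma_additive lebesgue_cons.
Proof.
move=> F mF tF mUF; rewrite /lebesgue_cons /pushforward preimage_bigcup.
apply: measure_semi_sigma_additive.
- by move=> i; exact: mpre.
- apply/trivIsetP => /= i j _ _ ij; rewrite -preimage_setI.
  by move/trivIsetP : tF => /(_ _ _ _ _ ij) ->//; rewrite preimage_set0.
- by rewrite -preimage_bigcup; exact: mpre.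
Qed.

HB.instance Definition _ := isMeasure.Build _ _ _ lebesgue_cons
  lebesgue_cons0 lebesgue_cons_ge0 lebesgue_cons_sigma_additive.

Let lebesgue_cons_sigma_finite : sigma_finite setT lebesgue_cons.
Proof.
pose u (t : k.+1.-tuple RT) : RT * k.-tuple RT := (thead t, [tuple of behead t]).
have uK : cancel (@cons_tuple k) u.
  by move=> [a t]; rewrite /u /cons_tuple theadE; congr (_, _); exact/val_inj.
have mu_ : measurable_fun setT u.
  by apply/measurable_fun_pairP; split; [exact: measurable_tnth|exact: measurable_behead].
have /sigma_finiteP[F [FT ndF Foo]] := sigma_finiteT (@lebesgue_measure R).
have /sigma_finiteP[G [GT ndG Goo]] := sigma_finiteT mu.
exists (fun i => u @^-1` (F i `*` G i)).
  rewrite -preimage_bigcup (_ : \bigcup_i _ = setT) ?preimage_setT//.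
  rewrite -setXTT FT GT predeqE => -[x y]; split.
    by move=> [i _ []/= ? ?]; split; exists i.
  move=> [/= [i _ Fx] [j _ Gy]]; exists (maxn i j) => //; split.
    by move: x Fx; exact/subsetPset/ndF/leq_maxl.
  by move: y Gy; exact/subsetPset/ndG/leq_maxr.
move=> i; have [mF Fi] := Foo i; have [mG Gi] := Goo i; split.
  by rewrite -[X in measurable X]setTI; apply: mu_ => //; exact: measurableX.
rewrite /lebesgue_cons /pushforward -comp_preimage (_ : u \o _ = id); last first.
  by apply/funext => x /=; rewrite uK.
by rewrite preimage_id product_measure1E// lte_mul_pinfty// ge0_fin_numE.
Qed.

HB.instance Definition _ := Measure_isSigmaFinite.Build _ _ _ lebesgue_cons
  lebesgue_cons_sigma_finite.

End step.

Fixpoint lebesgue_tuple k : {sigma_finite_measure set (k.-tuple RT) -> \bar R} :=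
  if k is k'.+1 then lebesgue_cons (lebesgue_tuple k') else \d_[tuple].

End lebesgue_tuple.

Lemma tridiag_gram (R : realType) (n : nat) (g : nat -> nat -> R) :
  (forall k, (k < n)%N -> 0 < g k k) ->
  (forall k, (k.+1 < n)%N -> g k k.+1 ^+ 2 < g k k * g k.+1 k.+1) ->
  exists x : nat -> nat -> R,
    (forall k, (k < n)%N -> \sum_(r < n) x r k ^+ 2 = g k k) /\
    (forall k, (k.+1 < n)%N -> \sum_(r < n) x r k * x r k.+1 = g k k.+1).
Proof.
move=> gp go.
pose c k := if k is k'.+1 then g k k - g k' k ^+ 2 / g k' k' else g k k.
have [x xE] : exists x : nat -> nat -> R, forall r k, x r k =
    if r == k then Num.sqrt (c k) else
    if k is k'.+1 then g k' k / g k' k' * x r k' else 0.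
  exists (fix x r k := if r == k then Num.sqrt (c k) else
    if k is k'.+1 then g k' k / g k' k' * x r k' else 0) => r k.
  by case: k.
have x0 r k : (k < r)%N -> x r k = 0.
  elim: k => [|k IH] kr; rewrite xE gtn_eqF//.
  by rewrite IH ?mulr0// ltnW.
have c0 k : (k < n)%N -> 0 <= c k.
  case: k => [|k] kn; first by rewrite ltW// gp.
  by rewrite subr_ge0 ler_pdivrMr ?gp ?(ltnW kn)// mulrC ltW// go.
have xS r k : r != k.+1 -> x r k.+1 = g k k.+1 / g k k * x r k.
  by move=> rk; rewrite xE (negbTE rk).
have xd k : (k < n)%N -> \sum_(r < n) x r k ^+ 2 = g k k.
  elim: k => [|k IH] kn; rewrite (bigD1 (Ordinal kn))//= xE eqxx sqr_sqrtr ?c0//.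
    rewrite big1 ?addr0// => i i0; rewrite x0 ?expr0n//.
    by rewrite lt0n; apply: contra i0 => /eqP i0; apply/eqP/val_inj.
  have ne (i : 'I_n) : i != Ordinal kn -> i != k.+1 :> nat.
    by apply: contra => /eqP i0; apply/eqP/val_inj.
  rewrite (eq_bigr (fun i : 'I_n => (g k k.+1 / g k k) ^+ 2 * x i k ^+ 2)); last first.
    by move=> i /ne ik; rewrite (xS _ _ ik) exprMn.
  rewrite -mulr_sumr; have := IH (ltnW kn).
  rewrite (bigD1 (Ordinal kn))//= x0// expr0n add0r => ->.
  by rewrite expr_div_n; field; rewrite gt_eqF// gp// ltnW.
exists x; split=> // k kn.
rewrite (bigD1 (Ordinal kn))//= x0// mul0r add0r.
have ne (i : 'I_n) : i != Ordinal kn -> i != k.+1 :> nat.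
  by apply: contra => /eqP i0; apply/eqP/val_inj.
rewrite (eq_bigr (fun i : 'I_n => g k k.+1 / g k k * x i k ^+ 2)); last first.
  by move=> i /ne ik; rewrite (xS _ _ ik) mulrCA -expr2.
rewrite -mulr_sumr; have := xd _ (ltnW kn).
rewrite (bigD1 (Ordinal kn))//= x0// expr0n add0r => ->.
by rewrite divfK// gt_eqF// gp// ltnW.
Qed.

(* The path 1 - 2 - ... - n. The vertex k (counted from 1) is the ordinal of
   value k - 1; sums, products and index sets below use the numbering 1..n. *)
Section path_graph.
Variables (R : realType) (n : nat).
Implicit Types (y u A K : 'M[R]_n) (eta m : 'M[R]_n).

Definition edge (i j : 'I_n) := (i <= j.+1)%N && (j <= i.+1)%N.

Definition ZG : set 'M[R]_n :=
  [set y | y^T = y /\ forall i j, ~~ edge i j -> y i j = 0].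

Definition posdefmx : set 'M[R]_n :=
  [set A | A^T = A /\ forall x : 'rV[R]_n, x != 0 -> 0 < (x *m A *m x^T) 0 0].

Definition PG : set 'M[R]_n := ZG `&` posdefmx.

(* Incomplete symmetric matrices are stored with 0 in the entries that are not
   indexed by an edge, so that I_G and Z_G have the same underlying set. *)
Definition IG : set 'M[R]_n := ZG.

Definition piG A : 'M[R]_n := \matrix_(i, j) if edge i j then A i j else 0.

Definition pairing y eta : R := \tr (y *m eta).

Definition QG : set 'M[R]_n :=
  [set eta | IG eta /\ forall y, closure PG y -> y != 0 -> 0 < pairing y eta].

Lemma edgexx i : edge i i. Proof. by rewrite /edge !leqnSn. Qed.

Let qf y (x : 'rV[R]_n) := (x *m y *m x^T) 0 0.

Let qfE y x : qf y x = \sum_i \sum_j x 0 i * y i j * x 0 j.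
Proof.
rewrite /qf mxE exchange_big; apply: eq_bigr => j _ /=.
by rewrite !mxE big_distrl.
Qed.

Let tr_rank1 (x : 'rV[R]_n) eta : pairing (x^T *m x) eta = qf eta x.
Proof. by rewrite /pairing -mulmxA mxtrace_mulC /qf /mxtrace big_ord1. Qed.

Let qf_combE y i j (a b : R) : y^T = y -> i != j ->
  qf y (a *: delta_mx 0 i + b *: delta_mx 0 j) =
  a ^+ 2 * y i i + 2 * (a * b * y i j) + b ^+ 2 * y j j.
Proof.
move=> ys ij.
have E k l : (delta_mx 0 k *m y *m (delta_mx 0 l)^T) (0 : 'I_1) (0 : 'I_1) = y k l.
  by rewrite -rowE trmx_delta -colE !mxE.
have yji : y j i = y i j by rewrite -[in LHS]ys mxE.
rewrite /qf linearD/= !linearZ/= !mulmxDl !mulmxDr -!scalemxAl -!scalemxAr.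
have addE (P Q : 'M[R]_1) : (P + Q) 0 0 = P 0 0 + Q 0 0 by rewrite mxE.
have scaleE c (P : 'M[R]_1) : (c *: P) 0 0 = c * P 0 0 by rewrite mxE.
rewrite !addE !scaleE !E yji; ring.
Qed.

Let qf_delta y i : qf y (delta_mx 0 i) = y i i.
Proof. by rewrite /qf -rowE trmx_delta -colE !mxE. Qed.

Let sqn_gt0 (x : 'rV[R]_n) : x != 0 -> 0 < (x *m x^T) 0 0.
Proof.
move=> x0; rewrite lt_def; apply/andP; split; last first.
  by rewrite mxE sumr_ge0// => i _; rewrite mxE -expr2 sqr_ge0.
apply: contra x0; rewrite mxE psumr_eq0; last by move=> i _; rewrite mxE -expr2 sqr_ge0.
move=> /allP h; apply/eqP/rowP => i; rewrite mxE.
by have := h i (mem_index_enum _); rewrite mxE mulf_eq0 orbb => /eqP.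
Qed.

Let rank1_closure (x : 'rV[R]_n) : ZG (x^T *m x) -> closure PG (x^T *m x).
Proof.
move=> [xs xE] B /nbhs_ballP[e /= e0 eB].
exists (x^T *m x + (e / 2)%:M); split; last first.
  apply: eB; split => // i j; rewrite !mxE; rewrite /ball/= opprD addrA subrr sub0r normrN.
  have e2 : `|e / 2| < e by rewrite gtr0_norm ?divr_gt0// gtr_pMr// invf_lt1// ltr1n.
  by case: (i == j); rewrite ?mulr1n// mulr0n normr0.
split; split.
- by rewrite linearD/= xs tr_scalar_mx.
- move=> i j ij; rewrite mxE xE// mxE; have [ij'|] := eqVneq i j; last by rewrite mulr0n addr0.
  by rewrite ij' edgexx in ij.
- by rewrite linearD/= xs tr_scalar_mx.
- move=> v v0.
  have addE (P Q : 'M[R]_1) : (P + Q) 0 0 = P 0 0 + Q 0 0 by rewrite mxE.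
  have scaleE c (P : 'M[R]_1) : (c *: P) 0 0 = c * P 0 0 by rewrite mxE.
  have mulE (P Q : 'M[R]_1) : (P *m Q) 0 0 = P 0 0 * Q 0 0 by rewrite mxE big_ord1.
  have trE (P : 'M[R]_1) : P^T 0 0 = P 0 0 by rewrite mxE.
  rewrite mulmxDr mulmxDl mul_mx_scalar -scalemxAl mulmxA -(mulmxA (v *m x^T)).
  rewrite addE scaleE ltr_wpDl//; last by rewrite mulr_gt0 ?divr_gt0// sqn_gt0.
  by rewrite mulE -[x *m v^T]trmxK trmx_mul trmxK trE -expr2 sqr_ge0.
Qed.

Let closurePG y : closure PG y -> ZG y /\ forall x, 0 <= qf y x.
Proof.
pose C := [set y : 'M[R]_n | ZG y /\ forall x, 0 <= qf y x].
suff cC : closed C.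
  move=> /(closure_subset (B := C)); rewrite -(closure_id C).1//; apply.
  move=> z [zZ [_ zp]]; split => // x; have [->|/zp/ltW//] := eqVneq x 0.
  by rewrite /qf !mul0mx mxE.
have cc (i j : 'I_n) : continuous (fun M : 'M[R]_n => M i j) by exact: coord_continuous.
have -> : C = [set y : 'M[R]_n | forall ij : 'I_n * 'I_n, y ij.1 ij.2 - y ij.2 ij.1 = 0] `&`
   [set y : 'M[R]_n | forall ij : 'I_n * 'I_n, ~~ edge ij.1 ij.2 -> y ij.1 ij.2 = 0] `&`
   [set y : 'M[R]_n | forall x, 0 <= qf y x].
  apply/seteqP; split => z.
    move=> [[zs zE] zp]; split => //; split.
      move=> -[i j] /=; have := congr1 (fun A : 'M[R]_n => A j i) zs.
      by rewrite mxE => ->; rewrite subrr.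
    by move=> -[i j]; exact: zE.
  move=> [[/= zs zE] zp]; split => //; split; last by move=> i j; exact: (zE (i, j)).
  by apply/matrixP => i j; rewrite mxE; apply/eqP; rewrite -subr_eq0; apply/eqP/(zs (j, i)).
have cl0 (T : Type) (P : T -> Prop) (f : T -> 'M[R]_n -> R) (D : set R) : closed D ->
    (forall t, continuous (f t)) -> closed [set z | forall t, P t -> D (f t z)].
  move=> cD cf.
  rewrite (_ : mkset _ = \bigcap_(t in P) (f t @^-1` D)); last first.
    by apply/seteqP; split.
  by apply: closed_bigI => t _; apply: preimage_closed => // z _; exact: cf.
have csum (f : 'I_n -> 'M[R]_n -> R) : (forall i, continuous (f i)) ->
    continuous (fun z => \sum_i f i z).
  move=> cf; apply: continuous_big => //; exact: add_continuous.
apply: closedI; first apply: closedI.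
- rewrite (_ : mkset _ = [set z : 'M[R]_n |
      forall ij : 'I_n * 'I_n, True -> [set 0] (z ij.1 ij.2 - z ij.2 ij.1)]).
    apply: cl0; first exact: closed_eq.
    by move=> ij z; exact: (cvgB (cc ij.1 ij.2 z) (cc ij.2 ij.1 z)).
  by apply/seteqP; split => z /= h ij; [move=> _|]; exact: h.
- have := cl0 _ (fun ij : 'I_n * 'I_n => ~~ edge ij.1 ij.2)
    (fun ij (z : 'M[R]_n) => z ij.1 ij.2) [set 0].
  by apply; [exact: closed_eq|move=> ij; exact: cc].
- rewrite (_ : mkset _ = [set z : 'M[R]_n |
      forall x : 'rV[R]_n, True -> [set r | 0 <= r] (qf z x)]).
    apply: cl0; first exact: closed_ge.
    move=> x; rewrite (_ : qf^~ x = fun z : 'M[R]_n =>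
      \sum_i \sum_j x 0 i * z i j * x 0 j); last first.
      by apply/funext => z; rewrite qfE.
    apply: (csum) => i; apply: (csum) => j z.
    exact: (cvgM (cvgM (cvg_cst _) (cc i j z)) (cvg_cst _)).
  by apply/seteqP; split => z /= h x; [move=> _|]; exact: h.
Qed.

Lemma QGP eta : IG eta -> (QG eta <-> (forall i, 0 < eta i i) /\
  forall i j : 'I_n, j = i.+1 :> nat -> eta i j ^+ 2 < eta i i * eta j j).
Proof.
move=> etaI; split.
  move=> [_ eta0].
  have pos (x : 'rV[R]_n) : x != 0 -> ZG (x^T *m x) -> 0 < qf eta x.
    move=> x0 xZ; rewrite -tr_rank1; apply: eta0; first exact: rank1_closure.
    apply: contra x0 => /eqP xx; apply/eqP/rowP => i; rewrite mxE.
    have := congr1 (fun A : 'M[R]_n => A i i) xx.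
    by rewrite !mxE big_ord1 mxE => /eqP; rewrite mulf_eq0 orbb => /eqP.
  have ZGx (x : 'rV[R]_n) : (forall i j, ~~ edge i j -> x 0 i * x 0 j = 0) -> ZG (x^T *m x).
    move=> h; split; first by rewrite trmx_mul trmxK.
    by move=> i j /h; rewrite mxE big_ord1 mxE.
  have dpos i : 0 < eta i i.
    rewrite -qf_delta; apply: pos.
      by apply/eqP => /rowP /(_ i); rewrite !mxE !eqxx => /eqP; rewrite oner_eq0.
    apply: ZGx => k l; rewrite !mxE eqxx/=; case: eqVneq => [->|_ _]; last by rewrite mul0r.
    by case: eqVneq => [->|_ _]; [rewrite edgexx|rewrite mulr0].
  split=> // i j ji; have ij : i != j by apply/eqP => ij; move: ji; rewrite ij => /n_Sn.
  pose x : 'rV[R]_n := eta i j *: delta_mx 0 i + (- eta i i) *: delta_mx 0 j.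
  have xE k : x 0 k = eta i j * (k == i)%:R - eta i i * (k == j)%:R.
    by rewrite !mxE eqxx/= mulNr.
  have : 0 < qf eta x.
    apply: pos.
      apply/eqP => /rowP /(_ j); rewrite xE !mxE eqxx eq_sym (negbTE ij) mulr0 mulr1 sub0r.
      by move/eqP; rewrite oppr_eq0 gt_eqF.
    apply: ZGx => k l; rewrite !xE => kl.
    have [ki|ki] := eqVneq k i; have [kj|kj] := eqVneq k j; rewrite ?mulr0 ?subrr ?mul0r//.
    - by move: ij; rewrite -ki -kj eqxx.
    - have [li|_] := eqVneq l i; first by move: kl; rewrite ki li edgexx.
      have [lj|_] := eqVneq l j; last by rewrite !mulr0 subrr mulr0.
      by move: kl; rewrite /edge ki lj ji leqnn (leq_trans (leqnSn _) (leqnSn _)).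
    - have [li|_] := eqVneq l i; last first.
        have [lj|_] := eqVneq l j; last by rewrite !mulr0 subrr mulr0.
        by move: kl; rewrite kj lj edgexx.
      by move: kl; rewrite /edge kj li ji leqnn (leq_trans (leqnSn _) (leqnSn _)).
  rewrite qf_combE//; last by case: etaI.
  rewrite (_ : _ + _ = eta i i * (eta i i * eta j j - eta i j ^+ 2)); last by ring.
  by rewrite pmulr_rgt0// subr_gt0.
move=> [dpos opos]; split=> // y /closurePG[[ys yE] yp] y0.
have [e /= e0 [de oe]] : exists2 e : R, 0 < e & (forall i, 0 < eta i i - e) /\
    forall ij : 'I_n * 'I_n, ij.2 = ij.1.+1 :> nat ->
       eta ij.1 ij.2 ^+ 2 < (eta ij.1 ij.1 - e) * (eta ij.2 ij.2 - e).
  have N1 : \forall e \near 0^'+, forall i : 'I_n, 0 < eta i i - e.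
    by apply: filter_forall => i; near=> e; rewrite subr_gt0; near: e; exact: nbhs_right_lt.
  have N2 : \forall e \near 0^'+, forall ij : 'I_n * 'I_n, ij.2 = ij.1.+1 :> nat ->
       eta ij.1 ij.2 ^+ 2 < (eta ij.1 ij.1 - e) * (eta ij.2 ij.2 - e).
    apply: filter_forall => -[i j] /=; have [ji|ij] := eqVneq (j : nat) i.+1; last first.
      by near=> e => ji; move: ij; rewrite ji eqxx.
    near=> e => _; have e0 : 0 < e by near: e; exact: nbhs_right_gt.
    have : e < (eta i i * eta j j - eta i j ^+ 2) / (eta i i + eta j j).
      by near: e; apply: nbhs_right_lt; rewrite divr_gt0// ?subr_gt0 ?opos// addr_gt0.
    rewrite ltr_pdivlMr ?addr_gt0// => h; nra.
  near (0 : R)^'+ => e.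
  by exists e; [near: e; exact: nbhs_right_gt|split; near: e].
pose g k l := match insub k, insub l with
  Some i, Some j => eta i j - (i == j)%:R * e | _, _ => 0 end.
have gE (i j : 'I_n) : g i j = eta i j - (i == j)%:R * e by rewrite /g !valK.
have [x [xd xo]] : exists x : nat -> nat -> R,
    (forall k, (k < n)%N -> \sum_(r < n) x r k ^+ 2 = g k k) /\
    (forall k, (k.+1 < n)%N -> \sum_(r < n) x r k * x r k.+1 = g k k.+1).
  apply: tridiag_gram.
    by move=> k kn; rewrite (gE (Ordinal kn) (Ordinal kn)) eqxx mul1r.
  move=> k kn; have k'n := ltnW kn.
  rewrite (gE (Ordinal k'n) (Ordinal kn)) (gE (Ordinal k'n) (Ordinal k'n)) (gE (Ordinal kn) (Ordinal kn)).
  rewrite !eqxx !mul1r; have -> : (Ordinal k'n == Ordinal kn) = false.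
    by apply/negbTE/eqP => /(congr1 val) /= /n_Sn.
  by rewrite mul0r subr0; exact: (oe (Ordinal k'n, Ordinal kn)).
have tr0 : 0 < \tr y.
  have yd i : 0 <= y i i by rewrite -qf_delta; exact: yp.
  rewrite lt_def sumr_ge0 ?andbT//; apply: contra y0; rewrite psumr_eq0//.
  move=> /allP h; have {}h i : y i i = 0 by apply/eqP; exact: (h i (mem_index_enum _)).
  apply/eqP/matrixP => i j; rewrite mxE; have [<-//|ij] := eqVneq i j.
  have := yp (1 *: delta_mx 0 i + 1 *: delta_mx 0 j).
  have := yp (1 *: delta_mx 0 i + (-1) *: delta_mx 0 j).
  by rewrite !qf_combE// !h; lra.
have etas : eta^T = eta by case: etaI.
have -> : pairing y eta = \sum_(r < n) qf y (\row_i x r i) + e * \tr y.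
  under eq_bigr => r _ do rewrite qfE.
  rewrite exchange_big/= /mxtrace mulr_sumr -big_split/=.
  rewrite /pairing /mxtrace; apply: eq_bigr => i _; rewrite mxE.
  rewrite exchange_big/= [RHS]addrC (bigD1 i)//= [in RHS](bigD1 i)//=.
  under [in RHS]eq_bigr => r _ do rewrite !mxE mulrAC -expr2.
  rewrite -mulr_suml xd// gE eqxx mul1r addrA; congr (_ + _); first by ring.
  apply: eq_bigr => j ji.
  under eq_bigr => r _ do rewrite !mxE mulrAC.
  rewrite -mulr_suml; have [ij|] := boolP (edge i j); last by move=> /yE ->; rewrite mul0r mulr0.
  have -> : \sum_(r < n) x r i * x r j = eta i j.
    move: ij; rewrite /edge leq_eqVlt ltnS => /andP[/orP[/eqP ij _|ij]].
      under eq_bigr => r _ do rewrite mulrC ij.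
      rewrite xo -ij// gE (negbTE ji) mul0r subr0.
      by rewrite -[in RHS]etas mxE.
    rewrite leq_eqVlt ltnS => /orP[/eqP ji'|ji'].
      under eq_bigr => r _ do rewrite ji'.
      by rewrite xo -ji'// gE eq_sym (negbTE ji) mul0r subr0.
    by case/eqP: ji; apply/val_inj/eqP; rewrite /= eqn_leq ij ji'.
  by rewrite mulrC -[in LHS]etas mxE.
apply: ltr_wpDl; last exact: mulr_gt0.
by apply: sumr_ge0 => r _; exact: yp.
Unshelve. all: by end_near. Qed.

(* f_1, ..., f_n, extended by f_0 = f_(n+1) = 0 *)
Definition at1 (f : 'I_n -> R) (k : nat) : R :=
  if k is k'.+1 then oapp f 0 (insub k') else 0.

Definition seg (a b : nat) : {set 'I_n} := [set k : 'I_n | (a <= k.+1 <= b)%N].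

Definition psubmx (I : {set 'I_n}) A : 'M[R]_#|I| :=
  mxsub enum_val enum_val A.

(* K^0: enum_val turns the row a of K into the a-th vertex of I *)
Definition padmx (I : {set 'I_n}) (K : 'M[R]_#|I|) : 'M[R]_n :=
  \matrix_(i, j) \sum_(a | enum_val a == i) \sum_(b | enum_val b == j) K a b.

Definition pminor (I : {set 'I_n}) A : R := \det (psubmx I A).

Definition dg eta : nat -> R := at1 (fun i => eta i i).

Definition wishart_delta (s : 'I_n -> R) (M : nat) eta : R :=
  (\prod_(1 <= i < M) pminor (seg i i.+1) eta `^ at1 s i *
   \prod_(M.+1 <= i < n.+1) pminor (seg i.-1 i) eta `^ at1 s i) /
  (\prod_(2 <= i < M) dg eta i `^ at1 s i.-1 *
   dg eta M `^ (at1 s M.-1 - at1 s M + at1 s M.+1) *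
   \prod_(M.+1 <= i < n) dg eta i `^ at1 s i.+1).

Definition wishart_phi eta : R :=
  if n == 1%N then (dg eta 1)^-1
  else \prod_(1 <= i < n) pminor (seg i i.+1) eta `^ (- (3 / 2)) *
       \prod_(2 <= i < n) dg eta i.

(* Coordinates on I_G: eta_11, eta_12, eta_22, eta_23, ..., eta_nn, so that the
   entry (i, j) of an edge is the coordinate of rank i + j (i, j from 0). *)
Definition coordIG := n.*2.-1.-tuple (measurableTypeR R).

Definition chartIG (t : coordIG) : 'M[R]_n :=
  \matrix_(i, j) if edge i j then nth 0 t (i + j) else 0.

Definition wishart_density s M y (t : coordIG) : R :=
  let eta := chartIG t in
  \1_QG eta * (expR (- pairing y eta) * wishart_delta s M eta * wishart_phi eta).

Lemma chartIG_IG t : IG (chartIG t).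
Proof.
split; first by apply/matrixP => i j; rewrite !mxE addnC /edge andbC.
by move=> i j /negbTE ij; rewrite mxE ij.
Qed.

Lemma measurable_chartIG i j : measurable_fun setT (fun t => chartIG t i j).
Proof.
rewrite (_ : (fun t => _) = fun t : coordIG => if edge i j then nth 0 t (i + j) else 0); last first.
  by apply/funext => t; rewrite mxE.
case: (edge i j); last exact: measurable_cst.
have [ij|ij] := ltnP (i + j) n.*2.-1; last first.
  rewrite (_ : (fun t => _) = cst 0); first exact: measurable_cst.
  by apply/funext => t; rewrite nth_default// size_tuple.
rewrite (_ : (fun t => _) = fun t : coordIG => tnth t (Ordinal ij)); last first.
  by apply/funext => t; rewrite (tnth_nth 0).
exact: measurable_tnth.
Qed.

Lemma measurable_QG : measurable [set t | QG (chartIG t)].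
Proof.
have mpos (f : coordIG -> R) : measurable_fun setT f -> measurable [set t | 0 < f t].
  move=> mf; have := mf measurableT _ (measurable_itv `]0, +oo[).
  rewrite setTI; congr (measurable _).
  by apply/seteqP; split => t /=; rewrite in_itv/= andbT.
have -> : [set t | QG (chartIG t)] =
   \bigcap_(i in [set: 'I_n]) [set t | 0 < chartIG t i i] `&`
   \bigcap_(ij in [set ij : 'I_n * 'I_n | ij.2 = ij.1.+1 :> nat])
     [set t | 0 < chartIG t ij.1 ij.1 * chartIG t ij.2 ij.2 - chartIG t ij.1 ij.2 ^+ 2].
  apply/seteqP; split => t /=.
    move/(QGP (chartIG_IG t)) => [h1 h2]; split; first by move=> i _; exact: h1.
    by move=> [i j] /= ij; rewrite subr_gt0; exact: h2.
  move=> [h1 h2]; apply/(QGP (chartIG_IG t)); split; first by move=> i; exact: h1.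
  by move=> i j ij; rewrite -subr_gt0; exact: (h2 (i, j)).
apply: measurableI; apply: fin_bigcap_measurable; try exact: finite_finset.
- by move=> i _; apply: mpos; exact: measurable_chartIG.
- move=> ij _; apply: mpos; apply: measurable_funB.
    by apply: measurable_funM; exact: measurable_chartIG.
  by apply: measurable_funX; exact: measurable_chartIG.
Qed.

Let measurable_invr : measurable_fun setT (@GRing.inv R).
Proof.
rewrite (_ : GRing.inv = fun x : R => if 0 <= x then x `^ (-1) else - ((- x) `^ (-1))).
  apply: measurable_fun_ifT => //; first exact: measurable_fun_ler.
  apply: measurableT_comp => //.
  by apply: (measurableT_comp (measurable_powR _)).
apply/funext => x; case: ifPn => [x0|]; first by rewrite powR_inv1.
by rewrite -ltNge => x0; rewrite powR_inv1 ?oppr_ge0 ?ltW// invrN opprK.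
Qed.

Let measurable_pminor I : measurable_fun setT (fun t => pminor I (chartIG t)).
Proof.
rewrite /pminor /determinant; apply: measurable_sum => p.
apply: measurable_funM => //; apply: measurable_prod => i _.
rewrite (_ : (fun t => _) = fun t => chartIG t (enum_val i) (enum_val (p i))).
  exact: measurable_chartIG.
by apply/funext => t; rewrite mxE.
Qed.

Let measurable_dg k : measurable_fun setT (fun t => dg (chartIG t) k).
Proof.
case: k => [|k]; first exact: measurable_cst.
rewrite /dg /at1; case: insub => [i|] /=; [exact: measurable_chartIG|exact: measurable_cst].
Qed.

Lemma measurable_wishart_density s M y :
  measurable_fun setT (wishart_density s M y).
Proof.
have mpow (f : coordIG -> R) (a : R) : measurable_fun setT f -> measurable_fun setT (fun t => f t `^ a).
  by move=> mf; apply: (measurableT_comp (measurable_powR a)).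
apply: measurable_funM.
  rewrite (_ : (fun t => _) = \1_[set t | QG (chartIG t)]).
    by apply: measurable_indic; exact: measurable_QG.
  by apply/funext => t; rewrite /= !indicE; congr ((nat_of_bool _)%:R);
    apply/idP/idP => /set_mem h; exact/mem_set.
apply: measurable_funM; first apply: measurable_funM.
- apply: measurableT_comp => //; apply: measurable_funN.
  rewrite /pairing /mxtrace; apply: measurable_sum => i.
  rewrite (_ : (fun t => _) = fun t => \sum_j y i j * chartIG t j i).
    by apply: measurable_sum => j; apply: measurable_funM => //; exact: measurable_chartIG.
  by apply/funext => t; rewrite mxE.
- apply: measurable_funM; last first.
    apply: measurableT_comp => //.
    repeat apply: measurable_funM; try (apply: measurable_prod => i _); exact: mpow.
  by repeat apply: measurable_funM; apply: measurable_prod => i _; exact: mpow.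
- rewrite /wishart_phi; case: (n == 1%N).
    exact: measurableT_comp.
  by apply: measurable_funM; apply: measurable_prod => i _ //; exact: mpow.
Qed.
Lemma wishart_density_ge0 s M y t : 0 <= wishart_density s M y t.
Proof.
rewrite /wishart_density indicE; case: (boolP (_ \in _)) => [/set_mem etaQ|_]; last by rewrite mul0r.
have [dpos _] := (QGP (chartIG_IG t)).1 etaQ.
have dg0 k : 0 <= dg (chartIG t) k.
  by case: k => [|k] //; rewrite /dg /at1; case: insub => //= i; exact: ltW.
have pow0 (I : seq nat) (f g : nat -> R) : 0 <= \prod_(i <- I) f i `^ g i.
  by apply: prodr_ge0 => i _; exact: powR_ge0.
rewrite mul1r /wishart_delta /wishart_phi !mulr_ge0 ?invr_ge0 ?expR_ge0 ?mulr_ge0 ?powR_ge0//.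
by case: ifP => _; rewrite ?invr_ge0// mulr_ge0// prodr_ge0.
Qed.

Section wishart.
Variables (s : 'I_n -> R) (M : nat) (y : 'M[R]_n).

Definition wishart_weight (U : set coordIG) : \bar R :=
  (\int[lebesgue_tuple R n.*2.-1]_(t in U) (wishart_density s M y t)%:E)%E.

Let wishart_weight0 : wishart_weight set0 = 0%E.
Proof. by rewrite /wishart_weight integral_set0. Qed.

Let wishart_weight_ge0 U : (0 <= wishart_weight U)%E.
Proof.
by apply: integral_ge0 => /= t _; rewrite lee_fin wishart_density_ge0.
Qed.

Let wishart_weight_sigma_additive : semi_sigma_additive wishart_weight.
Proof.
move=> /= F mF tF mUF; rewrite /wishart_weight; apply: cvg_toP.
  apply: ereal_nondecreasing_is_cvgn => i j ij.
  apply: lee_sum_nneg_natr => // k _ _.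
  by apply: integral_ge0 => /= t _; rewrite lee_fin wishart_density_ge0.
rewrite ge0_integral_bigcup//=.
- apply: measurable_funTS; apply: measurableT_comp => //.
  exact: measurable_wishart_density.
- by move=> t _; rewrite lee_fin wishart_density_ge0.
Qed.

HB.instance Definition _ := isMeasure.Build _ _ _ wishart_weight
  wishart_weight0 wishart_weight_ge0 wishart_weight_sigma_additive.

(* The Dirac mass is the value that mnormalize takes by convention when the
   total mass is 0 or +oo. *)
Definition wishart : probability coordIG R :=
  mnormalize wishart_weight \d_([tuple of nseq n.*2.-1 0] : coordIG).

End wishart.

Definition wishart_mean s M y : 'M[R]_n :=
  \matrix_(i, j) fine ('E_(wishart s M y)[fun t => chartIG t i j])%E.

(* v(y) z is the (unique) element of I_G representing the linear form
   z' |-> Cov(<z, X>, <z', X>) on Z_G. *)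
Definition wishart_cov s M y z : 'M[R]_n :=
  xget 0 [set w | IG w /\ forall z', ZG z' ->
    (pairing z' w)%:E = covariance (wishart s M y)
      (fun t => pairing z (chartIG t)) (fun t => pairing z' (chartIG t))].

Definition wishart_psi s M : 'M[R]_n -> 'M[R]_n :=
  'pinv_(fun=> 0) PG (wishart_mean s M).

Definition variance_function s M m : 'M[R]_n -> 'M[R]_n :=
  wishart_cov s M (wishart_psi s M m).

Definition hat m : 'M[R]_n :=
  xget 0 [set X | [/\ posdefmx X, piG X = m & PG (invmx X)]].

Definition MI m (I : {set 'I_n}) : 'M[R]_n :=
  padmx (invmx (psubmx I (invmx (hat m)))).

Definition PP A u : 'M[R]_n := piG (A *m u *m A).

End path_graph.

(* Main.v *)
Require Import Defs.
From mathcomp Require Import all_boot all_order all_algebra.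
From mathcomp Require Import all_classical all_reals all_analysis.
From mathcomp Require Import measurable_realfun.
From mathcomp Require Import zify ring lra.

Set Implicit Arguments.
Unset Strict Implicit.
Unset Printing Implicit Defensive.

Import Order.TTheory GRing.Theory Num.Theory.
Import numFieldNormedType.Exports.

Local Open Scope classical_set_scope.
Local Open Scope ring_scope.

(** Why the theorem holds.

    Root the path at the vertex M, so that every other vertex c has a parent
    p, its neighbour towards M. Gaussian elimination of the vertices of y,
    from the two ends of the path towards M, gives pivots D_c > 0 and slopes
    l_c with
      tr(y eta) = D_M eta_MM
          + sum over c <> M of D_c (eta_cc - 2 l_c eta_cp + l_c^2 eta_pp)
    (pairing_pivot). The powers of delta and phi can be distributed over the
    same edges (wishart_exponents), and the density becomes a product over
    the edges of the kernels edge_kernel (wishart_densityE). Given eta_pp > 0,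
    the integral of a kernel over (eta_cc, eta_cp) is a Gamma integral times a
    Gaussian one. Its value is a constant times D_c^(-s_c) and does not depend
    on eta_pp (integral_edge_kernel). By Tonelli, the total mass of the weight
    of parameter y is therefore a constant times the product of the D_k^(-s_k)
    (wishart_total_mass).

    For X of parameter y, E exp(-t <z, X>) is the ratio of the total masses at
    y + t z and at y. Expanding the pivots of y + t z to second order in t
    along the recursion that defines them (jet_pivot) gives the mean and the
    variance of <z, X> (moments_of_mgf, wishart_moments). In terms of the
    inverse S of the unipotent factor of y, of w = S^T z S and of
    th_k = s_k / D_k, the mean is the projection of X0 = S diag(th) S^T, and
    the variance is a combination of the squares th_j th_k w_jk^2
    (tree_variance_sum).

    The inverse of X0 is again tridiagonal, so X0 is the hat matrix of the
    mean (hat_part_mx), and M_I is S diag(th) S^T with th restricted to I, for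
    I a segment from an end of the path that does not contain M
    (MI_part_mx). Hence both sides of the statement, paired with z = u, are
    combinations of the same squares. The sums of differences 1/s_(i+1) - 1/s_i
    telescope, and the coefficients agree when j and k are on the same side of
    M; otherwise w_jk = 0 because no edge joins the two sides (variance_coef).
    Polarization yields the covariance, and the surjectivity of the mean
    (wishart_mean_surj) that m is the mean of the parameter psi(m). *)

(** * Affine changes of variable and densities *)

Section affine_change.
Variable R : realType.
Local Notation mu := (@lebesgue_measure R).

(** The image of Lebesgue measure under x |-> c x + d, multiplied by c, agrees
    with Lebesgue measure on half-open intervals, hence everywhere. *)
Lemma integral_affine (c d : R) (f : R -> \bar R) : 0 < c ->
  measurable_fun setT f -> (forall x, 0 <= f x)%E ->
  (\int[mu]_x f x = c%:E * \int[mu]_x f (c * x + d)%R)%E.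
Proof.
move=> c0 mf f0.
pose g (x : measurableTypeR R) : measurableTypeR R := c * x + d.
have mg : measurable_fun setT g.
  by apply: measurable_funD => //; apply: measurable_funM.
pose pu : {measure set (measurableTypeR R) -> \bar R} :=
  measure_function_pushforward__canonical__measure_function_Measure mu mg.
pose nu : {measure set (measurableTypeR R) -> \bar R} := mscale (NngNum (ltW c0)) pu.
have nuE A : measurable A -> mu A = nu A.
  apply: lebesgue_measure_unique => // _ [[a b]] _ <-.
  rewrite /nu /= /mscale/= /pushforward.
  have -> : g @^-1` `]a, b] = `](a - d) / c, (b - d) / c]%classic.
    apply/seteqP; split => x /=; rewrite !in_itv/= ltr_pdivrMr// ler_pdivlMr// ltrBlDr lerBrDr /g.
      by rewrite (mulrC x).
    by rewrite (mulrC x).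
  rewrite !lebesgue_measure_itv/= !lte_fin ltr_pdivrMr// divfK ?gt_eqF// ltrD2r.
  case: ifP => _; last by rewrite mule0.
  by rewrite -!EFinB -EFinM; congr (_%:E); field; rewrite gt_eqF.
rewrite (eq_measure_integral nu); last by move=> A mA _; exact: nuE.
rewrite ge0_integral_mscale//; congr (_ * _)%E.
by rewrite ge0_integral_pushforward//= ?preimage_setT//.
Qed.

End affine_change.

Section density.
Local Open Scope ereal_scope.
Context d (T : measurableType d) (R : realType).
Variables (mu nu : {measure set T -> \bar R}) (g : T -> R).
Hypotheses (mg : measurable_fun setT g) (g0 : forall t, (0 <= g t)%R).
Let mgE : measurable_fun setT (EFin \o g). Proof. exact/measurable_EFinP. Qed.
Hypothesis nuE : forall A, measurable A -> nu A = \int[mu]_(t in A) (g t)%:E.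

Import HBNNSimple.

(** Both sides are limits of their values at simple functions, for which the
    identity is nuE. *)
Lemma ge0_integral_density (f : T -> \bar R) :
  measurable_fun setT f -> (forall t, 0 <= f t) ->
  \int[nu]_t f t = \int[mu]_t (f t * (g t)%:E).
Proof.
move=> mf f0; pose f_ := nnsfun_approx measurableT mf.
transitivity (limn (fun n => \int[nu]_t (f_ n t)%:E)).
  rewrite -monotone_convergence//.
  - by apply: eq_integral => y yD; apply/esym/cvg_lim => //; exact: cvg_nnsfun_approx.
  - by move=> n; exact/measurable_EFinP/measurable_funP.
  - by move=> n y _; rewrite lee_fin.
  - by move=> y _ m n mn; rewrite lee_fin; exact/lefP/nd_nnsfun_approx.
rewrite [X in limn X](_ : _ = (fun n => \int[mu]_t ((f_ n t)%:E * (g t)%:E))).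
  rewrite -monotone_convergence//.
  - apply: eq_integral => y yD; apply/cvg_lim => //.
    apply: cvgeZr => //; exact: cvg_nnsfun_approx.
  - by move=> n; apply: emeasurable_funM => //; exact/measurable_EFinP.
  - by move=> n y _; rewrite mule_ge0// lee_fin.
  - move=> y _ m n mn; apply: lee_wpmul2r; rewrite lee_fin//.
    exact/lefP/nd_nnsfun_approx.
apply/funext => n.
under eq_integral do rewrite fimfunE -fsumEFin//.
rewrite ge0_integral_fsum//; last 2 first.
- by move=> y; exact/measurable_EFinP/measurable_funM.
- by move=> y x _; rewrite nnfun_muleindic_ge0.
under [RHS]eq_integral => x _.
  rewrite fimfunE -fsumEFin// muleC ge0_mule_fsumr; last first.
    by move=> r; rewrite EFinM nnfun_muleindic_ge0.
  over.
rewrite [RHS]ge0_integral_fsum//; last 2 first.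
- move=> r; apply: emeasurable_funM => //; apply/measurable_EFinP; exact: measurable_funM.
- move=> r x _; apply: mule_ge0; first by rewrite lee_fin.
  by rewrite EFinM nnfun_muleindic_ge0.
apply: eq_fsbigr => r rf.
have r0 : (0 <= r)%R by move: rf; rewrite inE/= => -[x _ <-].
rewrite (integralZl_indic_nnsfun)// integral_indic// setIT nuE//.
under [RHS]eq_integral => x _ do rewrite EFinM muleCA.
rewrite ge0_integralZl//; last 2 first.
- by apply: emeasurable_funM => //; apply/measurable_EFinP.
- by move=> x _; rewrite mule_ge0// lee_fin.
congr (_ * _).
rewrite integral_mkcond; apply: eq_integral => x _.
by rewrite patchE indicE; case: ifPn => xf; rewrite ?mule1// mule0.
Qed.

End density.

(** * The Gamma integral *)

Section gamma_integral.
Variable R : realType.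
Local Notation mu := (@lebesgue_measure R).
Implicit Types p x : R.

(** The Gamma integrand, extended by 0 so that affine changes of variable on
    the whole line apply to it. *)
Definition gamma_fun p x : R :=
  if 0 < x then x `^ (p - 1) * expR (- x) else 0.

Lemma gamma_fun_ge0 p x : 0 <= gamma_fun p x.
Proof. by rewrite /gamma_fun; case: ifP => // _; rewrite mulr_ge0 ?powR_ge0 ?expR_ge0. Qed.

Lemma measurable_gamma_fun p : measurable_fun setT (gamma_fun p).
Proof.
apply: measurable_fun_ifT => //; first exact: measurable_fun_ltr.
apply: measurable_funM; last exact: measurableT_comp.
exact: (measurableT_comp (measurable_powR _)).
Qed.

(** For p < 1 the integrand is unbounded near 0, so the primitive x^p / p is
    used away from 0, on the segments from 1 / (n + 2) to 1. *)
Let integral_powR_near0 p : 0 < p ->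
  (\int[mu]_(x in `]0%R, 1%R]) (x `^ (p - 1))%:E <= p^-1%:E)%E.
Proof.
move=> p0.
pose F (n : nat) : set (measurableTypeR R) := `[n.+2%:R^-1, 1]%classic.
have Fx n : 0 < n.+2%:R^-1 :> R by rewrite invr_gt0.
have FU : \bigcup_n F n = `]0, 1]%classic.
  apply/seteqP; split => x.
    by move=> [n _]; rewrite /F /= !in_itv/= => /andP[h ->]; rewrite andbT (lt_le_trans (Fx n)).
  rewrite /= in_itv/= => /andP[x0 x1].
  have [n nx] : exists n, x^-1 < n%:R :> R.
    by exists (Num.Def.archi_bound x^-1); apply: archi_boundP; rewrite invr_ge0 ltW.
  exists n => //; rewrite /F/= in_itv/= x1 andbT.
  rewrite -[leRHS]invrK lef_pV2 ?posrE ?invr_gt0//.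
  by rewrite (le_trans (ltW nx))// ler_nat (leq_trans (leqnSn _)).
have ndF : nondecreasing_seq F.
  move=> n m nm; apply/subsetPset => x; rewrite /F/= !in_itv/= => /andP[h ->]; rewrite andbT.
  by rewrite (le_trans _ h)// lef_pV2 ?posrE// ler_nat !ltnS.
have mf : measurable_fun setT (fun x : R => (x `^ (p - 1))%:E).
  by apply/measurable_EFinP; exact: measurable_powR.
have cv : (\int[mu]_(x in F n) (x `^ (p - 1))%:E)%E @[n --> \oo] -->
    (\int[mu]_(x in `]0%R, 1%R]) (x `^ (p - 1))%:E)%E.
  rewrite -FU; apply: ge0_nondecreasing_set_cvg_integral => //.
  - by move=> n; exact: measurable_itv.
  - by move=> n; exact: measurable_funTS.
  - by move=> n x _; rewrite lee_fin powR_ge0.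
rewrite -(cvg_lim _ cv)//; apply: lime_le; first by apply/cvg_ex; eexists; exact: cv.
apply: nearW => n.
have F1 : n.+2%:R^-1 < 1 :> R by rewrite invf_lt1// ltr1n.
rewrite (@continuous_FTC2 _ _ (fun x => p^-1 * x `^ p))//.
- by rewrite -EFinB lee_fin powR1 mulr1 lerBlDr lerDl mulr_ge0 ?powR_ge0// invr_ge0 ltW.
- apply: derivable_within_continuous => x; rewrite in_itv/= => /andP[x0 _].
  by apply: derivable_powR; rewrite in_itv/= andbT (lt_le_trans (Fx n)).
- have dF x : 0 < x -> derivable (fun x => p^-1 * x `^ p) x 1.
    move=> x0; apply: derivableM => //.
    by apply: derivable_powR; rewrite in_itv/= andbT.
  have cF x : 0 < x -> {for x, continuous (fun x => p^-1 * x `^ p)}.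
    by move=> x0; apply: differentiable_continuous; apply/derivable1_diffP/dF.
  split.
  + by move=> x; rewrite in_itv/= => /andP[x0 _]; apply: dF; rewrite (lt_trans (Fx n)).
  + by apply: cvg_at_right_filter; exact: cF.
  + by apply: cvg_at_left_filter; exact: cF.
- move=> x; rewrite in_itv/= => /andP[x0 _].
  have {}x0 : 0 < x by rewrite (lt_trans (Fx n)).
  rewrite derive1E deriveM//; last by apply: derivable_powR; rewrite in_itv/= andbT.
  rewrite derive_cst scaler0 addr0 -derive1E powR_derive1 ?in_itv/= ?andbT//.
  by rewrite /GRing.scale/= mulrA mulVf ?mul1r// gt_eqF.
Qed.

(** For c large, ln x <= x / c + ln c bounds |p| ln x by x / 2 plus a
    constant. *)
Let powR_le_expR p : exists2 C : R, 0 <= C & forall x, 1 <= x -> x `^ p <= C * expR (x / 2).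
Proof.
(* the coefficient of x in |p| ln x is then |p| / c < 1 / 2 *)
pose c : R := 2 * (`|p| + 1).
have c0 : 0 < c by rewrite /c; have := normr_ge0 p; lra.
exists (expR (`|p| * `|ln c|)); first exact: expR_ge0.
move=> x x1; have x0 : 0 < x by lra.
rewrite /powR gt_eqF// -expRD ler_expR.
have lx : 0 <= ln x by exact: ln_ge0.
apply: (@le_trans _ _ (`|p| * ln x)); first by rewrite ler_wpM2r// ler_norm.
have xE : x = c * (x / c) by field; rewrite gt_eqF.
rewrite {1}xE.
rewrite lnM ?posrE ?divr_gt0// mulrDr lerD//.
  by rewrite ler_wpM2l ?normr_ge0// ler_norm.
have xc : ln (x / c) <= x / c by rewrite ltW// ln_sublinear// divr_gt0.
apply: (le_trans (ler_wpM2l (normr_ge0 p) xc)).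
rewrite mulrCA ler_pM2l// ler_pdivrMr// /c mulrA mulVf ?pnatr_eq0//.
by rewrite mul1r lerDl.
Qed.

(** The integrand is dominated by x^(p - 1) up to 1 and by a multiple of
    exp(- x / 2) beyond. *)
Lemma integral_gamma_fun_lty p : 0 < p ->
  (\int[mu]_x (gamma_fun p x)%:E < +oo)%E.
Proof.
move=> p0; have [C C0 CP] := powR_le_expR (p - 1).
pose h1 : R -> R := fun x => x `^ (p - 1) * \1_(`]0, 1]%classic) x.
pose h2 : R -> R := fun x => 2 * C * exponential_pdf (1 / 2) x.
have mh1 : measurable_fun setT h1.
  by apply: measurable_funM; [exact: measurable_powR|exact: measurable_indic].
have mh2 : measurable_fun setT h2.
  by apply: measurable_funM => //; exact: measurable_exponential_pdf.
have e0 x : 0 <= exponential_pdf (1 / 2 : R) x by apply: exponential_pdf_ge0; rewrite divr_ge0.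
have h10 x : 0 <= h1 x by rewrite /h1 mulr_ge0// powR_ge0.
have h20 x : 0 <= h2 x by rewrite /h2 !mulr_ge0.
apply: (@le_lt_trans _ _ (\int[mu]_x (h1 x + h2 x)%:E)%E).
  apply: ge0_le_integral => //.
  - by move=> x _; rewrite lee_fin gamma_fun_ge0.
  - by apply/measurable_EFinP; exact: measurable_gamma_fun.
  - by apply/measurable_EFinP; exact: measurable_funD.
  move=> x _; rewrite lee_fin /gamma_fun; case: ifPn => [x0|_]; last by rewrite addr_ge0.
  have [x1|x1] := leP x 1.
    rewrite (le_trans _ (_ : h1 x <= _)) ?lerDl//.
    rewrite /h1 indicE mem_set ?mulr1//=; last by rewrite in_itv/= x0.
    by rewrite ler_piMr ?powR_ge0// expR_le1 oppr_le0 ltW.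
  rewrite (le_trans _ (_ : h2 x <= _)) ?lerDr//.
  have -> : h2 x = C * expR (x / 2) * expR (- x).
    rewrite /h2 exponential_pdfE ?(ltW x0)// -[in RHS]mulrA -expRD.
    have -> : x / 2 + - x = - (1 / 2) * x by field.
    by field.
  by rewrite ler_wpM2r ?expR_ge0// CP// ltW.
under eq_integral do rewrite EFinD.
rewrite ge0_integralD//; [|by move=> x _; rewrite lee_fin|exact/measurable_EFinP
  |by move=> x _; rewrite lee_fin|exact/measurable_EFinP].
apply: lte_add_pinfty.
  have -> : (\int[mu]_x (h1 x)%:E = \int[mu]_(x in `]0%R, 1%R]) (x `^ (p - 1))%:E)%E.
    rewrite [RHS]integral_mkcond; apply: eq_integral => x _.
    by rewrite /h1 patchE indicE; case: ifP; rewrite ?mulr1 ?mulr0.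
  by rewrite (le_lt_trans (integral_powR_near0 p0))// ltry.
under eq_integral do rewrite EFinM.
rewrite ge0_integralZl//; [|by apply/measurable_EFinP; exact: measurable_exponential_pdf
  |by move=> x _; rewrite lee_fin|by rewrite lee_fin mulr_ge0].
by rewrite integral_exponential_pdf ?divr_gt0// mule1 ltry.
Qed.

(** The integrand has a positive lower bound on the segment from 1 to 2. *)
Lemma integral_gamma_fun_gt0 p : (0 < \int[mu]_x (gamma_fun p x)%:E)%E.
Proof.
pose k : R := expR (- (2 * `|p - 1| + 2)).
apply: (@lt_le_trans _ _ (\int[mu]_(x in `[1%R, 2%R]) k%:E)%E).
  rewrite integral_cst//= lebesgue_measure_itv/= lte_fin ltr1n -EFinB -EFinM.
  by rewrite lte_fin mulr_gt0 ?expR_gt0// subr_gt0 ltr1n.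
apply: (@le_trans _ _ (\int[mu]_(x in `[1%R, 2%R]) (gamma_fun p x)%:E)%E).
  apply: ge0_le_integral => //.
  - by move=> x _; rewrite lee_fin expR_ge0.
  - apply: measurable_funTS; apply/measurable_EFinP; exact: measurable_gamma_fun.
  move=> x /=; rewrite in_itv/= => /andP[x1 x2]; have x0 : 0 < x by lra.
  rewrite lee_fin /gamma_fun x0 /powR gt_eqF// -expRD ler_expR.
  have lx : 0 <= ln x by exact: ln_ge0.
  have lx2 : ln x <= 2 by rewrite (le_trans _ x2)// ltW// ln_sublinear.
  rewrite opprD lerD ?lerN2//.
  have : - `|p - 1| <= p - 1 by rewrite lerNl -normrN ler_norm.
  have := normr_ge0 (p - 1); nra.
apply: ge0_subset_integral => //; first by apply/measurable_EFinP; exact: measurable_gamma_fun.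
by move=> x _; rewrite lee_fin gamma_fun_ge0.
Qed.

Definition Gamma p : R := fine (\int[mu]_x (gamma_fun p x)%:E).

Lemma integral_gamma_fun p : 0 < p -> (\int[mu]_x (gamma_fun p x)%:E = (Gamma p)%:E)%E.
Proof.
move=> p0; rewrite /Gamma fineK// ge0_fin_numE ?integral_gamma_fun_lty//.
exact: ltW (integral_gamma_fun_gt0 p).
Qed.

Lemma Gamma_gt0 p : 0 < p -> 0 < Gamma p.
Proof. by move=> p0; rewrite -lte_fin -integral_gamma_fun// integral_gamma_fun_gt0. Qed.

End gamma_integral.

(** * The kernel of an edge *)

Section edge_kernel.
Variable R : realType.
Local Notation mu := (@lebesgue_measure R).
Implicit Types sg D c h e x : R.

(** The contribution of a vertex and of its parent to the density, where h is
    the diagonal entry at the parent, e the one at the vertex, x the entry of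
    the edge between them, and D, c the pivot and the slope at the vertex. The
    test on h and on the minor h * e - x ^+ 2 also forces e to be positive. *)
Definition edge_kernel sg D c h e x : R :=
  if (0 < h) && (0 < h * e - x ^+ 2) then
    (h * e - x ^+ 2) `^ (sg - 3 / 2) * h `^ (1 - sg) *
      expR (- (D * (e - 2 * c * x + c ^+ 2 * h)))
  else 0.

Definition root_kernel sg D h : R :=
  if 0 < h then h `^ (sg - 1) * expR (- (D * h)) else 0.

Lemma edge_kernel_ge0 sg D c h e x : 0 <= edge_kernel sg D c h e x.
Proof. by rewrite /edge_kernel; case: ifP => // _; rewrite !mulr_ge0 ?powR_ge0 ?expR_ge0. Qed.

Lemma root_kernel_ge0 sg D h : 0 <= root_kernel sg D h.
Proof. by rewrite /root_kernel; case: ifP => // _; rewrite !mulr_ge0 ?powR_ge0 ?expR_ge0. Qed.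

Lemma measurable_edge_kernel d (T : measurableType d) sg D c (h e x : T -> R) :
  measurable_fun setT h -> measurable_fun setT e -> measurable_fun setT x ->
  measurable_fun setT (fun t => edge_kernel sg D c (h t) (e t) (x t)).
Proof.
move=> mh me mx.
have mhex : measurable_fun setT (fun t => h t * e t - x t ^+ 2).
  by apply: measurable_funB; [exact: measurable_funM|exact: measurable_funX].
apply: measurable_fun_ifT => //.
  by apply: measurable_and; apply: measurable_fun_ltr.
apply: measurable_funM.
  by apply: measurable_funM; apply: (measurableT_comp (measurable_powR _)).
apply: measurableT_comp => //; apply: measurable_funN.
apply: measurable_funM => //; apply: measurable_funD.
  by apply: measurable_funB => //; exact: measurable_funM.
exact: measurable_funM.
Qed.

Lemma measurable_root_kernel d (T : measurableType d) sg D (h : T -> R) :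
  measurable_fun setT h -> measurable_fun setT (fun t => root_kernel sg D (h t)).
Proof.
move=> mh; apply: measurable_fun_ifT => //; first exact: measurable_fun_ltr.
apply: measurable_funM; first exact: (measurableT_comp (measurable_powR _)).
by apply: measurableT_comp => //; apply: measurable_funN; exact: measurable_funM.
Qed.

Lemma integral_root_kernel sg D : 0 < sg -> 0 < D ->
  (\int[mu]_h (root_kernel sg D h)%:E = (Gamma sg * D `^ (- sg))%:E)%E.
Proof.
move=> s0 D0.
rewrite (@integral_affine _ D^-1 0) ?invr_gt0//; last 2 first.
- by apply/measurable_EFinP; exact: measurable_root_kernel.
- by move=> x; rewrite lee_fin root_kernel_ge0.
rewrite (_ : (fun x => _) = fun x => ((D `^ (1 - sg))%:E * (gamma_fun sg x)%:E)%E).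
  rewrite ge0_integralZl//; [|by apply/measurable_EFinP; exact: measurable_gamma_fun
    |by move=> x _; rewrite lee_fin gamma_fun_ge0|by rewrite lee_fin powR_ge0].
  rewrite integral_gamma_fun// -!EFinM; congr (_%:E).
  have -> : D `^ (1 - sg) = D * D `^ (- sg).
    by rewrite -{2}(powRr1 (ltW D0)) -powRD// (gt_eqF D0) implybT.
  by field; rewrite gt_eqF.
apply/funext => x; rewrite -EFinM; congr (_%:E).
rewrite /root_kernel /gamma_fun addr0 pmulr_rgt0 ?invr_gt0//.
case: ifPn => x0; last by rewrite mulr0.
rewrite mulVKf ?gt_eqF// mulrA; congr (_ * _).
rewrite powRM ?invr_ge0 ?ltW//; congr (_ * _).
by rewrite -powR_inv1 ?ltW// -powRrM mulN1r opprB.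
Qed.

Lemma integral_gauss (a m : R) : 0 < a ->
  (\int[mu]_x (expR (- (a * (x - m) ^+ 2)))%:E = (Num.sqrt (pi / a))%:E)%E.
Proof.
move=> a0; pose s : R := Num.sqrt (1 / (2 * a)).
have s2 : s ^+ 2 = 1 / (2 * a) by rewrite sqr_sqrtr// divr_ge0// mulr_ge0// ltW.
have s0 : s != 0 by rewrite gt_eqF// sqrtr_gt0 divr_gt0// mulr_gt0.
rewrite (_ : (fun x => _) = fun x => ((Num.sqrt (pi / a))%:E * (normal_pdf m s x)%:E)%E).
  rewrite ge0_integralZl//.
  - by rewrite integral_normal_pdf mule1.
  - by apply/measurable_EFinP; exact: measurable_normal_pdf.
  - by move=> x _; rewrite lee_fin normal_pdf_ge0.
apply/funext => x; rewrite -EFinM; congr (_%:E).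
rewrite normal_pdfE// /normal_peak s2 /normal_fun s2.
have -> : 1 / (2 * a) * pi *+ 2 = pi / a by field; rewrite gt_eqF.
rewrite mulVKf; last by rewrite gt_eqF// sqrtr_gt0 divr_gt0// pi_gt0.
by congr expR; field; rewrite gt_eqF.
Qed.

Definition edge_mass sg : R := Gamma (sg - 1 / 2) * Num.sqrt pi.

Lemma edge_mass_gt0 sg : 1 / 2 < sg -> 0 < edge_mass sg.
Proof. by move=> s0; rewrite mulr_gt0 ?Gamma_gt0 ?subr_gt0// sqrtr_gt0 pi_gt0. Qed.

(** The change of variable e = u / D + x^2 / h turns the inner integral into a
    Gamma integral and leaves a Gaussian function of x. The powers of h cancel
    out: this is what makes the edges integrate one after the other. *)
Lemma integral_edge_kernel sg D c h : 1 / 2 < sg -> 0 < D -> 0 < h ->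
  (\int[mu]_x \int[mu]_e (edge_kernel sg D c h e x)%:E =
   (edge_mass sg * D `^ (- sg))%:E)%E.
Proof.
move=> s0 D0 h0.
pose K : R := Gamma (sg - 1 / 2) * (D `^ (1 / 2 - sg) * h `^ (- (1 / 2))).
have p0 : 0 < sg - 1 / 2 by rewrite subr_gt0.
have K0 : 0 <= K by rewrite !mulr_ge0 ?powR_ge0// ltW// Gamma_gt0.
have -> : (fun x => \int[mu]_e (edge_kernel sg D c h e x)%:E)%E =
    (fun x => K%:E * (expR (- (D / h * (x - c * h) ^+ 2)))%:E)%E.
  apply/funext => x.
  rewrite (@integral_affine _ D^-1 (x ^+ 2 / h)) ?invr_gt0//; last 2 first.
  - by apply/measurable_EFinP; exact: measurable_edge_kernel.
  - by move=> e; rewrite lee_fin edge_kernel_ge0.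
  pose L := (h / D) `^ (sg - 3 / 2) * h `^ (1 - sg) * expR (- (D / h * (x - c * h) ^+ 2)).
  rewrite (_ : (fun e => _) = fun e => (L%:E * (gamma_fun (sg - 1 / 2) e)%:E)%E).
    rewrite ge0_integralZl//; [|by apply/measurable_EFinP; exact: measurable_gamma_fun
      |by move=> e _; rewrite lee_fin gamma_fun_ge0
      |by rewrite lee_fin !mulr_ge0 ?powR_ge0 ?expR_ge0].
    rewrite integral_gamma_fun// -!EFinM; congr (_%:E).
    have hE (y a b : R) : 0 < y -> y `^ a * y `^ b = y `^ (a + b).
      by move=> y0; rewrite powRD// (gt_eqF y0) implybT.
    have DE : D^-1 `^ (sg - 3 / 2) * D^-1 = D `^ (1 / 2 - sg).
      rewrite -(powR_inv1 (ltW D0)) -powRrM hE//; by congr (_ `^ _); field.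
    have HE : h `^ (sg - 3 / 2) * h `^ (1 - sg) = h `^ (- (1 / 2)).
      by rewrite hE//; congr (_ `^ _); field.
    rewrite /L /K powRM ?invr_ge0 ?ltW// -DE -HE; ring.
  apply/funext => e; rewrite -EFinM; congr (_%:E).
  rewrite /edge_kernel /gamma_fun h0 /=.
  have -> : h * (D^-1 * e + x ^+ 2 / h) - x ^+ 2 = h / D * e.
    by field; rewrite !gt_eqF.
  rewrite pmulr_rgt0 ?divr_gt0//; case: ifPn => e0; last by rewrite mulr0.
  rewrite /L powRM ?ltW ?divr_gt0//.
  have -> : sg - 1 / 2 - 1 = sg - 3 / 2 by field.
  have -> : - (D * (D^-1 * e + x ^+ 2 / h - 2 * c * x + c ^+ 2 * h)) =
      - (D / h * (x - c * h) ^+ 2) + - e.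
    by field; rewrite !gt_eqF.
  rewrite expRD; ring.
rewrite ge0_integralZl//.
- rewrite integral_gauss ?divr_gt0// -EFinM; congr (_%:E).
  have pi0 : 0 < pi :> R := pi_gt0 R.
  have -> : pi / (D / h) = pi * (h / D) by field; rewrite !gt_eqF.
  rewrite /K /edge_mass sqrtrM ?ltW// -(powR12_sqrt (ltW (divr_gt0 h0 D0))).
  rewrite powRM ?invr_ge0 ?ltW// -(powR_inv1 (ltW D0)) -powRrM.
  have HE : h `^ (- (1 / 2)) * h `^ 2^-1 = 1.
    by rewrite -powRD ?(gt_eqF h0) ?implybT//; rewrite (_ : _ + _ = 0) ?powRr0//; field.
  have DE : D `^ (1 / 2 - sg) * D `^ (- 1 * 2^-1) = D `^ (- sg).
    by rewrite -powRD ?(gt_eqF D0) ?implybT//; congr (_ `^ _); field.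
  by rewrite -DE; ring: HE.
- apply/measurable_EFinP; apply: measurableT_comp => //; apply: measurable_funN.
  by apply: measurable_funM => //; apply: measurable_funX; exact: measurable_funB.
Qed.

End edge_kernel.

(** * Integration along a path *)

Section path_integral.
Variable R : realType.
Local Notation RT := (measurableTypeR R).
Local Notation mu := (@lebesgue_measure R).
Local Notation leb := (lebesgue_tuple R).

Lemma ge0_integral_lebesgue_tupleS k (f : k.+1.-tuple RT -> \bar R) :
  measurable_fun setT f -> (forall t, 0 <= f t)%E ->
  (\int[leb k.+1]_t f t = \int[mu]_x \int[leb k]_t f (Defs.cons_tuple (x, t)))%E.
Proof.
move=> mf f0.
rewrite [LHS](_ : _ = \int[pushforward (mu \x leb k)%E (@Defs.cons_tuple R k)]_t f t)%E//.
rewrite ge0_integral_pushforward//; last exact: measurable_cons_tuple.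
rewrite preimage_setT fubini_tonelli1//.
  by apply: measurableT_comp => //; exact: measurable_cons_tuple.
by move=> p; exact: f0.
Qed.

(** Tonelli, in the order in which a leaf at the head of the path is
    eliminated: its diagonal entry and its edge first, for fixed values of the
    other coordinates. *)
Lemma ge0_integral_lebesgue_tupleSS k (f : k.+2.-tuple RT -> \bar R) :
  measurable_fun setT f -> (forall t, 0 <= f t)%E ->
  (\int[leb k.+2]_t f t =
   \int[leb k]_t \int[mu]_x \int[mu]_e f (Defs.cons_tuple (e, Defs.cons_tuple (x, t))))%E.
Proof.
move=> mf f0.
have mc : measurable_fun setT (fun p : RT * k.+1.-tuple RT => f (Defs.cons_tuple p)).
  by apply: measurableT_comp => //; exact: measurable_cons_tuple.
rewrite ge0_integral_lebesgue_tupleS//.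
rewrite (@fubini_tonelli _ _ _ _ _ mu (leb k.+1) (fun p => f (Defs.cons_tuple p)))//.
rewrite ge0_integral_lebesgue_tupleS//; last first.
- by move=> t; apply: integral_ge0.
- exact: (@measurable_fun_fubini_tonelli_G _ _ _ _ _ mu _ mc).
have mG : measurable_fun setT (fun p : RT * k.-tuple RT =>
    \int[mu]_e f (Defs.cons_tuple (e, Defs.cons_tuple p)))%E.
  have mH := @measurable_fun_fubini_tonelli_G _ _ _ _ _ mu _ mc.
  exact: (measurableT_comp (mH _) (@measurable_cons_tuple R k)).
rewrite (@fubini_tonelli _ _ _ _ _ mu (leb k) (fun p => \int[mu]_e f (Defs.cons_tuple (e, Defs.cons_tuple p)))%E)//.
by move=> p; apply: integral_ge0.
Qed.

Implicit Types (sg D c : nat -> R) (s : seq R).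

(** The vertices on the left of the root: the parent of i is i + 1. Entry 2 i of
    the list of coordinates is the diagonal entry at i, and entry 2 i + 1 the
    entry of the edge from i to i + 1. *)
Definition left_kernel k sg D c s : R :=
  \prod_(i < k) edge_kernel (sg i) (D i) (c i) (nth 0 s i.+1.*2) (nth 0 s i.*2) (nth 0 s i.*2.+1).

(** The vertices on the right of the root, which is the head of the list: the
    parent of i + 1 is i. *)
Definition right_kernel q sg D c s : R :=
  \prod_(i < q) edge_kernel (sg i) (D i) (c i) (nth 0 s i.*2) (nth 0 s i.+1.*2) (nth 0 s i.*2.+1).

Lemma measurable_nth_tuple k (i : nat) :
  measurable_fun setT (fun t : k.-tuple RT => nth 0 t i : R).
Proof.
have [ik|ik] := ltnP i k; last first.
  rewrite (_ : (fun t => _) = cst 0); first exact: measurable_cst.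
  by apply/funext => t; rewrite nth_default// size_tuple.
rewrite (_ : (fun t => _) = fun t : k.-tuple RT => tnth t (Ordinal ik)); last first.
  by apply/funext => t; rewrite (tnth_nth 0).
exact: measurable_tnth.
Qed.

Lemma measurable_nth_cons k (x : R) (i : nat) :
  measurable_fun setT (fun t : k.-tuple RT => nth 0 (x :: t) i : R).
Proof. by case: i => [|i] //; exact: measurable_nth_tuple. Qed.

Lemma left_kernelS k sg D c e x s :
  left_kernel k.+1 sg D c [:: e, x & s] =
  edge_kernel (sg 0) (D 0) (c 0) (nth 0 s 0) e x *
  left_kernel k (sg \o S) (D \o S) (c \o S) s.
Proof. by rewrite /left_kernel big_ord_recl. Qed.

Lemma right_kernelS q sg D c h x e s :
  right_kernel q.+1 sg D c [:: h, x, e & s] =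
  edge_kernel (sg 0) (D 0) (c 0) h e x *
  right_kernel q (sg \o S) (D \o S) (c \o S) (e :: s).
Proof. by rewrite /right_kernel big_ord_recl. Qed.

Lemma left_kernel_ge0 k sg D c s : 0 <= left_kernel k sg D c s.
Proof. by apply: prodr_ge0 => i _; exact: edge_kernel_ge0. Qed.

Lemma right_kernel_ge0 k sg D c s : 0 <= right_kernel k sg D c s.
Proof. by apply: prodr_ge0 => i _; exact: edge_kernel_ge0. Qed.

Lemma measurable_left_kernel d (T : measurableType d) k sg D c (f : T -> seq R) :
  (forall i, measurable_fun setT (fun t => nth 0 (f t) i)) ->
  measurable_fun setT (fun t => left_kernel k sg D c (f t)).
Proof. by move=> mf; apply: measurable_prod => i _; exact: measurable_edge_kernel. Qed.

Lemma measurable_right_kernel d (T : measurableType d) k sg D c (f : T -> seq R) :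
  (forall i, measurable_fun setT (fun t => nth 0 (f t) i)) ->
  measurable_fun setT (fun t => right_kernel k sg D c (f t)).
Proof. by move=> mf; apply: measurable_prod => i _; exact: measurable_edge_kernel. Qed.

(** For h > 0 the minor h * e - x ^+ 2 is not positive. *)
Lemma edge_kernel_eq0 (a b g h e x : R) : e <= 0 -> edge_kernel a b g h e x = 0.
Proof.
move=> e0; rewrite /edge_kernel; case: ifP => // /andP[h0].
by have := sqr_ge0 x; nra.
Qed.

Definition admissible k sg D := forall i, (i < k)%N -> 1 / 2 < sg i /\ 0 < D i.

Lemma admissibleS k sg D : admissible k.+1 sg D -> admissible k (sg \o S) (D \o S).
Proof. by move=> h i ik; exact: h. Qed.

Lemma edge_mass_prod_ge0 k sg D : admissible k sg D ->
  0 <= \prod_(i < k) (edge_mass (sg i) * D i `^ (- sg i)).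
Proof.
move=> ad; apply: prodr_ge0 => i _; have [sg0 _] := ad i (ltn_ord i).
by rewrite mulr_ge0 ?powR_ge0// ltW// edge_mass_gt0.
Qed.

(** By induction, the integral over the vertices beyond the first child of the
    root is a constant when e > 0, and the kernel of the first edge vanishes
    otherwise. *)
Lemma integral_right_kernel q sg D c h : admissible q sg D -> 0 < h ->
  (\int[leb q.*2]_r (right_kernel q sg D c (h :: r))%:E =
   (\prod_(i < q) (edge_mass (sg i) * D i `^ (- sg i)))%:E)%E.
Proof.
elim: q sg D c h => [|q IH] sg D c h ad h0.
  rewrite big_ord0 (eq_integral (cst 1%E)); last first.
    by move=> t _; rewrite /right_kernel big_ord0.
  by rewrite integral_cst//= mul1e diracT.
have mrk (f : forall k, k.-tuple RT -> seq R) k :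
    (forall i, measurable_fun setT (fun t : k.-tuple RT => nth 0 (f _ t) i)) ->
    measurable_fun setT (fun t : k.-tuple RT => (right_kernel q.+1 sg D c (f _ t))%:E).
  by move=> mf; apply/measurable_EFinP; exact: measurable_right_kernel.
rewrite ge0_integral_lebesgue_tupleS/=; last 2 first.
- apply: (mrk (fun _ t => h :: t)); exact: measurable_nth_cons.
- by move=> t; rewrite lee_fin right_kernel_ge0.
pose C := \prod_(i < q) (edge_mass (sg i.+1) * D i.+1 `^ (- sg i.+1)).
have ad' := admissibleS ad; have [sg0 D0] := ad 0 (ltn0Sn _).
transitivity (\int[mu]_x \int[mu]_e (C%:E * (edge_kernel (sg 0) (D 0) (c 0) h e x)%:E))%E.
  apply: eq_integral => x _.
  rewrite ge0_integral_lebesgue_tupleS/=; last 2 first.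
  - apply: (mrk (fun _ t => [:: h, x & t])) => -[|i]; first exact: measurable_cst.
    exact: measurable_nth_cons.
  - by move=> t; rewrite lee_fin right_kernel_ge0.
  apply: eq_integral => e _.
  under eq_integral do rewrite right_kernelS EFinM.
  rewrite ge0_integralZl//; last 3 first.
  - apply/measurable_EFinP; apply: measurable_right_kernel; exact: measurable_nth_cons.
  - by move=> t _; rewrite lee_fin right_kernel_ge0.
  - by rewrite lee_fin edge_kernel_ge0.
  have [e0|e0] := ltP 0 e; last by rewrite edge_kernel_eq0// mul0e mule0.
  by rewrite IH// muleC.
have C0 : (0 <= C%:E)%E.
  by rewrite lee_fin; exact: edge_mass_prod_ge0 ad'.
have mek : measurable_fun setT (fun p : RT * RT => (edge_kernel (sg 0) (D 0) (c 0) h p.2 p.1)%:E).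
  by apply/measurable_EFinP; exact: measurable_edge_kernel.
transitivity (\int[mu]_x (C%:E * \int[mu]_e (edge_kernel (sg 0) (D 0) (c 0) h e x)%:E))%E.
  apply: eq_integral => x _; rewrite ge0_integralZl//.
  - by apply/measurable_EFinP; exact: measurable_edge_kernel.
  - by move=> e _; rewrite lee_fin edge_kernel_ge0.
rewrite ge0_integralZl//; last 2 first.
- apply: (@measurable_fun_fubini_tonelli_F _ _ _ _ _ mu _ mek) => p.
  by rewrite lee_fin edge_kernel_ge0.
- by move=> x _; apply: integral_ge0 => e _; rewrite lee_fin edge_kernel_ge0.
by rewrite integral_edge_kernel// -EFinM big_ord_recl mulrC.
Qed.

(** The leaf at the head is integrated first. The kernel of its edge has a
    constant integral if the diagonal entry of its parent is positive, and the
    remaining factors vanish if it is not. *)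
Lemma integral_left_kernel k N sg D c (G : seq R -> R) : admissible k sg D ->
  (forall d (T : measurableType d) (f : T -> seq R),
    (forall i, measurable_fun setT (fun t => nth 0 (f t) i)) ->
    measurable_fun setT (fun t => G (f t))) ->
  (forall s, 0 <= G s) -> (forall s, nth 0 s 0 <= 0 -> G s = 0) ->
  (\int[leb (k.*2 + N.+1)]_t (left_kernel k sg D c t * G (drop k.*2 t))%:E =
   (\prod_(i < k) (edge_mass (sg i) * D i `^ (- sg i)))%:E * \int[leb N.+1]_t (G t)%:E)%E.
Proof.
move=> + mG G0 Gle0.
have Lz k' sg' D' c' s : nth 0 s 0 <= 0 -> left_kernel k' sg' D' c' s * G (drop k'.*2 s) = 0.
  case: k' => [|k'] s0; first by rewrite Gle0 ?mulr0// drop0.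
  by rewrite /left_kernel big_ord_recl edge_kernel_eq0 ?mul0r.
elim: k sg D c => [|k IH] sg D c ad.
  rewrite big_ord0 mul1e; apply: eq_integral => t _.
  by rewrite /left_kernel big_ord0 mul1r drop0.
have [sg0 D0] := ad 0 (ltn0Sn _).
have mnth k' i j : measurable_fun setT (fun t : k'.-tuple RT => nth 0 (drop j t) i : R).
  under eq_fun do rewrite nth_drop; exact: measurable_nth_tuple.
have mF : measurable_fun setT (fun t : (k.*2 + N.+1).+2.-tuple RT =>
    (left_kernel k.+1 sg D c t * G (drop k.+1.*2 t))%:E).
  apply/measurable_EFinP/measurable_funM; last by apply: mG => i; exact: mnth.
  by apply: measurable_left_kernel; exact: measurable_nth_tuple.
rewrite (ge0_integral_lebesgue_tupleSS mF); last first.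
  by move=> t; rewrite lee_fin mulr_ge0 ?left_kernel_ge0.
pose m0 : R := edge_mass (sg 0) * D 0 `^ (- sg 0).
transitivity (\int[leb (k.*2 + N.+1)]_t (m0%:E *
    (left_kernel k (sg \o S) (D \o S) (c \o S) t * G (drop k.*2 t))%:E))%E; last first.
  rewrite ge0_integralZl//.
  - rewrite IH; last exact: admissibleS.
    by rewrite big_ord_recl EFinM muleA.
  - apply/measurable_EFinP/measurable_funM; last by apply: mG => i; exact: mnth.
    by apply: measurable_left_kernel; exact: measurable_nth_tuple.
  - by move=> t _; rewrite lee_fin mulr_ge0 ?left_kernel_ge0.
  - by rewrite lee_fin mulr_ge0 ?powR_ge0// ltW// edge_mass_gt0.
apply: eq_integral => t _.
set L := (X in _ = (_ * X%:E)%E).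
transitivity (\int[mu]_x \int[mu]_e (L%:E * (edge_kernel (sg 0) (D 0) (c 0) (nth 0 t 0) e x)%:E))%E.
  apply: eq_integral => x _; apply: eq_integral => e _.
  by rewrite [tval _]/= left_kernelS -EFinM /L; congr (_%:E); rewrite [RHS]mulrC mulrA.
have L0 : (0 <= L%:E)%E by rewrite lee_fin mulr_ge0 ?left_kernel_ge0.
have [h0|h0] := ltP 0 (nth 0 t 0 : R); last first.
  suff -> : L = 0 by rewrite mule0; under eq_integral do under eq_integral do rewrite mul0e;
    under eq_integral do rewrite integral0; rewrite integral0.
  by rewrite /L Lz.
have mek : measurable_fun setT (fun p : RT * RT =>
    (edge_kernel (sg 0) (D 0) (c 0) (nth 0 t 0) p.2 p.1)%:E).
  by apply/measurable_EFinP; exact: measurable_edge_kernel.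
transitivity (\int[mu]_x (L%:E * \int[mu]_e (edge_kernel (sg 0) (D 0) (c 0) (nth 0 t 0) e x)%:E))%E.
  apply: eq_integral => x _; rewrite ge0_integralZl//.
  - by apply/measurable_EFinP; exact: measurable_edge_kernel.
  - by move=> e _; rewrite lee_fin edge_kernel_ge0.
rewrite ge0_integralZl//; last 2 first.
- apply: (@measurable_fun_fubini_tonelli_F _ _ _ _ _ mu _ mek) => p.
  by rewrite lee_fin edge_kernel_ge0.
- by move=> x _; apply: integral_ge0 => e _; rewrite lee_fin edge_kernel_ge0.
by rewrite integral_edge_kernel// muleC.
Qed.

Lemma integral_path_kernel k q sg D c (sr Dr : R) sg' D' c' :
  admissible k sg D -> admissible q sg' D' -> 0 < sr -> 0 < Dr ->
  (\int[leb (k + q).*2.+1]_t (left_kernel k sg D c t *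
     (root_kernel sr Dr (nth 0 t k.*2) * right_kernel q sg' D' c' (drop k.*2 t)))%:E =
   (\prod_(i < k) (edge_mass (sg i) * D i `^ (- sg i)) *
     (Gamma sr * Dr `^ (- sr) * \prod_(i < q) (edge_mass (sg' i) * D' i `^ (- sg' i))))%:E)%E.
Proof.
move=> ad ad' sr0 Dr0.
pose G (s : seq R) := root_kernel sr Dr (nth 0 s 0) * right_kernel q sg' D' c' s.
rewrite (_ : (k + q).*2.+1 = k.*2 + q.*2.+1)%N; last by rewrite doubleD addnS.
transitivity (\int[leb (k.*2 + q.*2.+1)]_t (left_kernel k sg D c t * G (drop k.*2 t))%:E)%E.
  by apply: eq_integral => t _; rewrite /G nth_drop addn0.
have mG d (T : measurableType d) (f : T -> seq R) :
    (forall i, measurable_fun setT (fun t => nth 0 (f t) i)) ->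
    measurable_fun setT (fun t => G (f t)).
  by move=> mf; apply: measurable_funM; [exact: measurable_root_kernel|exact: measurable_right_kernel].
have G0 s : 0 <= G s by rewrite mulr_ge0 ?root_kernel_ge0 ?right_kernel_ge0.
rewrite integral_left_kernel//; last first.
  by move=> s s0; rewrite /G /root_kernel ltNge s0 mul0r.
rewrite [RHS]EFinM; congr (_ * _)%E.
rewrite ge0_integral_lebesgue_tupleS/=; last 2 first.
- apply/measurable_EFinP; apply: mG; exact: measurable_nth_tuple.
- by move=> t; rewrite lee_fin.
pose C := \prod_(i < q) (edge_mass (sg' i) * D' i `^ (- sg' i)).
transitivity (\int[mu]_h (C%:E * (root_kernel sr Dr h)%:E))%E.
  apply: eq_integral => h _; rewrite /G.
  under eq_integral do rewrite /= EFinM.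
  rewrite ge0_integralZl//; last 3 first.
  - apply/measurable_EFinP; apply: measurable_right_kernel; exact: measurable_nth_cons.
  - by move=> t _; rewrite lee_fin right_kernel_ge0.
  - by rewrite lee_fin root_kernel_ge0.
  have [h0|h0] := ltP 0 h; last by rewrite /root_kernel ltNge h0 mul0e mule0.
  by rewrite integral_right_kernel// muleC.
rewrite ge0_integralZl//.
- by rewrite integral_root_kernel// -EFinM mulrC.
- by apply/measurable_EFinP; exact: measurable_root_kernel.
- by move=> h _; rewrite lee_fin root_kernel_ge0.
- by rewrite lee_fin; exact: edge_mass_prod_ge0 ad'.
Qed.

End path_integral.

(** * Second-order Taylor expansions *)

Section jets.
Variable R : realType.
Implicit Types (f g r : R -> R) (a b c x t K : R).

Lemma MVT_le0 f (df : R -> R) K x :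
  (forall y : R, `|y| <= `|x| -> is_derive y 1 f (df y)) ->
  (forall y : R, `|y| <= `|x| -> `|df y| <= K) -> `|f x - f 0| <= K * `|x|.
Proof.
move=> fd dK.
have cf a b : (forall y, y \in `[a, b] -> `|y| <= `|x|) -> {within `[a, b], continuous f}.
  move=> h; apply: derivable_within_continuous => y /h yx.
  by have [] := fd y yx.
have [x0|x0] := leP 0 x.
  have h y : y \in `[0, x] -> `|y| <= `|x|.
    by rewrite in_itv/= => /andP[y0 yx]; rewrite !ger0_norm// (le_trans y0).
  have [y yI ->] := @MVT_segment R f df 0 x x0
    (fun y hy => fd y (h y (subset_itv_oo_cc hy))) (cf _ _ h).
  by rewrite subr0 normrM ler_wpM2r// dK// h.
have h y : y \in `[x, 0] -> `|y| <= `|x|.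
  by rewrite in_itv/= => /andP[yx y0]; rewrite !ler0_norm ?lerN2// ltW.
have [y yI] := @MVT_segment R f df x 0 (ltW x0)
  (fun y hy => fd y (h y (subset_itv_oo_cc hy))) (cf _ _ h).
by rewrite distrC => ->; rewrite sub0r normrM normrN ler_wpM2r// dK// h.
Qed.

(** Three mean value inequalities in a row. The bound holds on the whole line,
    so that it can be integrated against an unbounded random variable. *)
Lemma expR_taylor2 x : `|expR x - (1 + x + x ^+ 2 / 2)| <= `|x| ^+ 3 * expR `|x|.
Proof.
have e1 (z : R) : `|expR z - 1| <= expR `|z| * `|z|.
  rewrite -[X in _ - X]expR0; apply: (@MVT_le0 expR expR (expR `|z|) z) => y yz.
  by rewrite ger0_norm ?expR_ge0// ler_expR (le_trans (ler_norm _)).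
have e2 (z : R) : `|expR z - 1 - z| <= expR `|z| * `|z| ^+ 2.
  pose f (y : R) := expR y - y : R.
  have -> : expR z - 1 - z = f z - f 0 by rewrite /f expR0 subr0; ring.
  rewrite expr2 mulrA; apply: (@MVT_le0 f (fun y => expR y - 1)) => y yz.
  by rewrite (le_trans (e1 y))// ler_pM ?expR_ge0// ler_expR.
pose f (y : R) := expR y - y - 2^-1 * (y * y) : R.
have -> : expR x - (1 + x + x ^+ 2 / 2) = f x - f 0.
  by rewrite /f expR0 subr0 mulr0 mulr0 subr0; field.
rewrite mulrC exprSr mulrA; apply: (@MVT_le0 f (fun y => expR y - 1 - y)) => y yx.
  have : is_derive y 1 (expR - id - (fun=> 2^-1) * (id * id) : R -> R) (expR y - 1 - y).
    by apply: is_derive_eq; rewrite !scaler0 !addr0 /GRing.scale/= !mulr1; field.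
  by [].
by rewrite (le_trans (e2 y))// ler_pM ?expR_ge0 ?exprn_ge0// ?ler_expR// lerXn2r ?nnegrE.
Qed.

Lemma ln_taylor2 x : `|x| <= 1 / 2 -> `|ln (1 + x) - (x - x ^+ 2 / 2)| <= 2 * `|x| ^+ 3.
Proof.
move=> x2; pose f (y : R) := ln (1 + y) - y + 2^-1 * (y * y).
have -> : ln (1 + x) - (x - x ^+ 2 / 2) = f x - f 0.
  by rewrite /f addr0 ln1 !mulr0 subrr addr0 subr0; field.
have p1 (y : R) : `|y| <= `|x| -> 1 / 2 <= 1 + y.
  by move=> yx; have := le_trans yx x2; rewrite ler_norml; lra.
rewrite exprSr mulrA; apply: (@MVT_le0 f (fun y => (1 + y)^-1 - 1 + y)) => y yx.
  have y0 : 0 < 1 + y by have := p1 _ yx; lra.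
  have dl : is_derive y 1 ((@ln R) \o (fun z : R => 1 + z)) (1 + y)^-1.
    have d1 : is_derive y 1 (fun z : R => 1 + z) 1.
      have : is_derive y 1 ((fun=> 1) + id : R -> R) 1 by apply: is_derive_eq; rewrite add0r.
      by [].
    have := @is_derive1_comp R (@ln R) (fun z : R => 1 + z) y _ _ (is_derive1_ln y0) d1.
    by rewrite mulr1.
  have : is_derive y 1 (((@ln R) \o (fun z : R => 1 + z)) - id + (fun=> 2^-1) * (id * id) : R -> R)
     ((1 + y)^-1 - 1 + y).
    by apply: is_derive_eq; rewrite !scaler0 !addr0 /GRing.scale/= !mulr1; congr (_ + _); field.
  by [].
have h := p1 _ yx.
have -> : (1 + y)^-1 - 1 + y = y ^+ 2 / (1 + y) by field; rewrite gt_eqF//; lra.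
rewrite normrM normrX normfV [`|1 + y|]ger0_norm; last by lra.
rewrite ler_pdivrMr; last by lra.
apply: (@le_trans _ _ (`|x| ^+ 2)); first by rewrite lerXn2r ?nnegrE.
have -> : 2 * `|x| ^+ 2 * (1 + y) = `|x| ^+ 2 * (2 * (1 + y)) by ring.
by rewrite ler_peMr ?exprn_ge0//; lra.
Qed.

Let near0W (P : R -> Prop) : (forall t, P t) -> \forall t \near (0 : R), P t.
Proof. by move=> h; near=> t; exact: h. Unshelve. all: by end_near. Qed.

Lemma near0_norm_lt (e : R) : 0 < e -> \forall t \near (0 : R), `|t| < e.
Proof.
move=> e0; apply/nbhs_ballP; exists e => //= t.
by rewrite /ball/= sub0r normrN.
Qed.

Definition near0_bounded r := exists K, \forall t \near (0 : R), `|r t| <= K.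

Lemma near0_bounded_cst a : near0_bounded (fun=> a).
Proof. by exists `|a|; apply: near0W => t. Qed.

Lemma near0_bounded_id : near0_bounded id.
Proof.
exists 1; near=> t.
by apply/ltW; near: t; exact: near0_norm_lt.
Unshelve. all: by end_near. Qed.

Lemma near0_boundedD r1 r2 : near0_bounded r1 -> near0_bounded r2 ->
  near0_bounded (fun t => r1 t + r2 t).
Proof.
move=> [K1 h1] [K2 h2]; exists (K1 + K2).
by apply: filterS2 h1 h2 => t h1 h2; rewrite (le_trans (ler_normD _ _))// lerD.
Qed.

Lemma near0_boundedM r1 r2 : near0_bounded r1 -> near0_bounded r2 ->
  near0_bounded (fun t => r1 t * r2 t).
Proof.
move=> [K1 h1] [K2 h2]; exists (K1 * K2).
by apply: filterS2 h1 h2 => t h1 h2; rewrite normrM ler_pM.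
Qed.

(** The expansion f t = a + b t + c t^2 + O(t^3) at 0. The quotient of the
    remainder by t^3 is a function, so that stability under each operation is a
    polynomial identity between quotients. *)
Definition jet f a b c := exists2 r, near0_bounded r &
  \forall t \near (0 : R), f t = a + b * t + c * t ^+ 2 + r t * t ^+ 3.

Lemma jet_near f g a b c : (\forall t \near (0 : R), f t = g t) ->
  jet f a b c -> jet g a b c.
Proof.
move=> fg [r br fr]; exists r => //.
by apply: filterS2 fg fr => t <-.
Qed.

Lemma jet_poly a b c : jet (fun t => a + b * t + c * t ^+ 2) a b c.
Proof.
exists (fun=> 0); first exact: near0_bounded_cst.
by apply: near0W => t; rewrite mul0r addr0.
Qed.

Lemma jet_affine a b : jet (fun t => a + b * t) a b 0.
Proof.
by apply: jet_near (jet_poly a b 0); apply: near0W => t; rewrite mul0r addr0.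
Qed.

Lemma jet_cst a : jet (fun=> a) a 0 0.
Proof.
by apply: jet_near (jet_affine a 0); apply: near0W => t; rewrite mul0r addr0.
Qed.

Lemma jetD f g a b c a' b' c' : jet f a b c -> jet g a' b' c' ->
  jet (fun t => f t + g t) (a + a') (b + b') (c + c').
Proof.
move=> [r br fr] [r' br' gr']; exists (fun t => r t + r' t); first exact: near0_boundedD.
by apply: filterS2 fr gr' => t -> ->; ring.
Qed.

Lemma jetM f g a b c a' b' c' : jet f a b c -> jet g a' b' c' ->
  jet (fun t => f t * g t) (a * a') (a * b' + b * a') (a * c' + b * b' + c * a').
Proof.
move=> [r br fr] [r' br' gr'].
exists (fun t => (a * r' t + b * c' + c * b' + r t * a') +
   (b * r' t + c * c' + r t * b') * t + (c * r' t + r t * c') * (t * t)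
     + (r t * r' t) * (t * t * t)).
  by do ![apply: near0_boundedD|apply: near0_boundedM|apply: near0_bounded_cst
    |exact: near0_bounded_id|exact: br|exact: br'].
by apply: filterS2 fr gr' => t -> ->; ring.
Qed.

Lemma jetZ k f a b c : jet f a b c -> jet (fun t => k * f t) (k * a) (k * b) (k * c).
Proof.
move=> fj; have := jetM (jet_cst k) fj.
by rewrite !mul0r !addr0.
Qed.

Lemma jet_sum (I : Type) (l : seq I) (P : pred I) (f : I -> R -> R) (a b c : I -> R) :
  (forall i, P i -> jet (f i) (a i) (b i) (c i)) ->
  jet (fun t => \sum_(i <- l | P i) f i t) (\sum_(i <- l | P i) a i)
    (\sum_(i <- l | P i) b i) (\sum_(i <- l | P i) c i).
Proof.
move=> h; elim: l => [|i l IH].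
  by rewrite !big_nil; apply: jet_near (jet_cst 0); apply: near0W => t; rewrite big_nil.
rewrite !big_cons; case: ifPn => Pi; last first.
  by apply: jet_near IH; apply: near0W => t; rewrite big_cons (negbTE Pi).
by apply: jet_near (jetD (h _ Pi) IH); apply: near0W => t; rewrite big_cons Pi.
Qed.

Lemma jet_cvg f a b c : jet f a b c -> f t @[t --> (0 : R)] --> a.
Proof.
move=> [r br fr].
have [K hK] : near0_bounded (fun t => b + c * t + r t * (t * t)).
  by do ![apply: near0_boundedD|apply: near0_boundedM|apply: near0_bounded_cst
    |exact: near0_bounded_id|exact: br].
apply/cvgrPdist_lt => e e0; near=> t.
have -> : f t = a + b * t + c * t ^+ 2 + r t * t ^+ 3 by near: t.
have -> : a - (a + b * t + c * t ^+ 2 + r t * t ^+ 3) = - ((b + c * t + r t * (t * t)) * t) by ring.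
rewrite normrN normrM.
have hb : `|b + c * t + r t * (t * t)| <= `|K| + 1.
  by have h : `|b + c * t + r t * (t * t)| <= K by [near: t]; have := ler_norm K; lra.
apply: le_lt_trans (ler_wpM2r (normr_ge0 t) hb) _.
have K1 : 0 < `|K| + 1 by have := normr_ge0 K; lra.
rewrite mulrC -ltr_pdivlMr//.
by near: t; apply: near0_norm_lt; rewrite divr_gt0.
Unshelve. all: by end_near. Qed.

Lemma jet_gt0 f a b c : jet f a b c -> 0 < a -> \forall t \near (0 : R), 0 < f t.
Proof. by move=> /jet_cvg/cvgr_gt h a0; exact: h. Qed.

Lemma jet_comp f g b c (g0 g1 g2 : R) : jet f 0 b c -> jet g g0 g1 g2 ->
  jet (g \o f) g0 (g1 * b) (g1 * c + g2 * b ^+ 2).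
Proof.
move=> fj [s [K hK] gs]; have f0 := jet_cvg fj; move: (fj) => [r br fr].
have bs : near0_bounded (s \o f) by exists K; exact: (f0 _ hK).
pose u t := b + c * t + r t * (t * t).
have bu : near0_bounded u.
  by do ![apply: near0_boundedD|apply: near0_boundedM|apply: near0_bounded_cst
    |exact: near0_bounded_id|exact: br].
exists (fun t => g1 * r t + g2 * (2 * b * c + (c * c + 2 * b * r t) * t + 2 * c * r t * (t * t)
    + r t * r t * (t * t * t)) + s (f t) * (u t * u t * u t)).
  by do ![apply: near0_boundedD|apply: near0_boundedM|apply: near0_bounded_cst
    |exact: near0_bounded_id|exact: br|exact: bs|exact: bu].
apply: filterS2 fr (f0 _ gs) => t ft gt.
by rewrite /= gt; set w := s (f t); rewrite ft /u; ring.
Qed.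

Lemma jet_expR : jet expR 1 1 (1 / 2).
Proof.
exists (fun t => (expR t - (1 + 1 * t + 1 / 2 * t ^+ 2)) / t ^+ 3).
  exists (expR 1); near=> t; have [->|t0] := eqVneq t 0.
    by rewrite (expr0n _ 3) invr0 mulr0 normr0 expR_ge0.
  rewrite normrM normfV normrX.
  rewrite ler_pdivrMr ?exprn_gt0 ?normr_gt0//.
  have -> : 1 + 1 * t + 1 / 2 * t ^+ 2 = 1 + t + t ^+ 2 / 2 by field.
  rewrite (le_trans (expR_taylor2 t))// mulrC ler_wpM2r ?exprn_ge0// ler_expR.
  by apply/ltW; near: t; exact: near0_norm_lt.
apply: near0W => t; have [->|t0] := eqVneq t 0.
  by rewrite expR0 !expr0n/= !mulr0 !addr0.
by rewrite divfK ?expf_neq0//; ring.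
Unshelve. all: by end_near. Qed.

Lemma jet_ln1p : jet (fun t => ln (1 + t)) 0 1 (- (1 / 2)).
Proof.
exists (fun t => (ln (1 + t) - (0 + 1 * t + - (1 / 2) * t ^+ 2)) / t ^+ 3).
  exists 2; near=> t; have [->|t0] := eqVneq t 0.
    by rewrite (expr0n _ 3) invr0 mulr0 normr0.
  rewrite normrM normfV normrX.
  rewrite ler_pdivrMr ?exprn_gt0 ?normr_gt0//.
  have -> : 0 + 1 * t + - (1 / 2) * t ^+ 2 = t - t ^+ 2 / 2 by field.
  apply: ln_taylor2.
  by apply/ltW; near: t; apply: near0_norm_lt; rewrite divr_gt0.
apply: near0W => t; have [->|t0] := eqVneq t 0.
  by rewrite addr0 ln1 !expr0n/= !mulr0 !addr0.
by rewrite divfK ?expf_neq0//; ring.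
Unshelve. all: by end_near. Qed.

Lemma jet_inv1p : jet (fun t => (1 + t)^-1) 1 (- 1) 1.
Proof.
have p1 : \forall t \near (0 : R), 1 / 2 <= 1 + t.
  near=> t; have : `|t| < 1 / 2 by near: t; apply: near0_norm_lt; rewrite divr_gt0.
  by rewrite ltr_norml; lra.
exists (fun t => - (1 + t)^-1).
  exists 2; apply: filterS p1 => t p1; rewrite normrN normfV ger0_norm; last by lra.
  by rewrite -[leRHS]invrK lef_pV2 ?posrE ?invr_gt0//; lra.
by apply: filterS p1 => t p1; field; rewrite gt_eqF//; lra.
Unshelve. all: by end_near. Qed.

(** Reduction of an expansion with a nonzero constant term to one that
    vanishes at 0, which jet_comp requires. *)
Lemma jet_normalize f a b c : a != 0 -> jet f a b c -> jet (fun t => a^-1 * f t - 1) 0 (b / a) (c / a).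
Proof.
move=> a0 fj; have := jetD (jetZ a^-1 fj) (jet_cst (- 1)).
by rewrite mulVf// subrr !addr0 !(mulrC a^-1).
Qed.

Lemma jet_inv f a b c : a != 0 -> jet f a b c ->
  jet (fun t => (f t)^-1) a^-1 (- (b / a ^+ 2)) (b ^+ 2 / a ^+ 3 - c / a ^+ 2).
Proof.
move=> a0 fj.
have := jetZ a^-1 (jet_comp (jet_normalize a0 fj) jet_inv1p).
rewrite mulr1 (_ : a^-1 * (-1 * (b / a)) = - (b / a ^+ 2)); last by field.
rewrite (_ : a^-1 * _ = b ^+ 2 / a ^+ 3 - c / a ^+ 2); last by field.
apply: jet_near; apply: near0W => t /=.
by rewrite addrC subrK invfM invrK mulKf.
Qed.

Lemma jet_ln f a b c : 0 < a -> jet f a b c ->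
  jet (fun t => ln (f t)) (ln a) (b / a) (c / a - b ^+ 2 / (2 * a ^+ 2)).
Proof.
move=> a0 fj; have an0 : a != 0 by rewrite gt_eqF.
have := jetD (jet_cst (ln a)) (jet_comp (jet_normalize an0 fj) jet_ln1p).
rewrite addr0 add0r mul1r add0r (_ : 1 * (c / a) + _ = c / a - b ^+ 2 / (2 * a ^+ 2)); last by field.
apply: jet_near; apply: filterS (jet_gt0 fj a0) => t ft /=.
have -> : 1 + (a^-1 * f t - 1) = a^-1 * f t by ring.
by rewrite lnM ?posrE ?invr_gt0// lnV ?posrE//; ring.
Qed.

End jets.

(** * Moments from the Laplace transform *)

Section moments.
Variable R : realType.

(** Division by t shows that u is small with t, hence zero; division by t^2 then
    does the same for v. *)
Lemma quadratic_small_eq0 (u v K : R) :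
  (\forall t \near (0 : R), `|u * t + v * t ^+ 2| <= K * `|t| ^+ 3) -> u = 0 /\ v = 0.
Proof.
move=> /nbhs_ballP[e /= e0 h].
have {}h t : 0 < t -> t < e -> `|u * t + v * t ^+ 2| <= K * t ^+ 3.
  by move=> t0 te; have := h t; rewrite /ball/= sub0r normrN (ger0_norm (ltW t0)) => /(_ te).
have small (w L : R) : 0 <= L -> (forall t, 0 < t -> t < e -> t < 1 -> `|w| <= L * t) -> w = 0.
  move=> L0 hw; apply/eqP; rewrite -normr_le0; apply/ler_addgt0Pr => d d0; rewrite add0r.
  pose t := Num.min (Num.min (e / 2) (1 / 2)) (d / (L + 1)).
  have L1 : 0 < L + 1 by lra.
  have t0 : 0 < t by rewrite !lt_min !divr_gt0.
  have te : t <= e / 2 by rewrite !ge_min lexx.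
  have t1 : t <= 1 / 2 by rewrite !ge_min lexx orbT.
  have td : t <= d / (L + 1) by rewrite !ge_min lexx !orbT.
  apply: (@le_trans _ _ (L * t)); first by apply: hw => //; lra.
  rewrite ler_pdivlMr// in td; apply: le_trans td; rewrite mulrC ler_wpM2l ?ltW//; lra.
have u0 : u = 0.
  apply: (small u (`|v| + `|K|)); first by rewrite addr_ge0.
  move=> t t0 te t1; have := h t t0 te.
  have -> : u * t + v * t ^+ 2 = (u + v * t) * t by ring.
  have -> : K * t ^+ 3 = K * t ^+ 2 * t by ring.
  rewrite normrM (ger0_norm (ltW t0)) ler_pM2r// => h1.
  have h2 : `|u| <= `|u + v * t| + `|v * t|.
    by rewrite -{1}(addrK (v * t) u) ler_normB.
  rewrite normrM (ger0_norm (ltW t0)) in h2.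
  have h3 : K * t ^+ 2 <= `|K| * t.
    rewrite expr2 mulrA ler_pM2r//; have := ler_norm K; have := normr_ge0 K; nra.
  lra.
split=> //; apply: (small v `|K|) => // t t0 te t1; have := h t t0 te.
rewrite u0 mul0r add0r.
have -> : K * t ^+ 3 = K * t * t ^+ 2 by ring.
rewrite normrM (ger0_norm (exprn_ge0 2 (ltW t0))) ler_pM2r ?exprn_gt0// => h1.
by rewrite (le_trans h1)// ler_pM2r// ler_norm.
Qed.

Context d (T : measurableType d) (P : probability T R) (W : T -> R).
Variables (phi : R -> R) (p q : R).
Hypothesis mW : measurable_fun setT W.
Hypothesis mgf : \forall t \near (0 : R),
  (\int[P]_x (expR (- (t * W x)))%:E = (phi t)%:E)%E.
Hypothesis jphi : jet phi 1 p q.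

(** By expR_taylor2, the Laplace transform of W is
    1 - t E W + t^2 E W^2 / 2 + O(t^3), where powers of W are dominated by the
    exponentials whose integrals are finite. Comparing with jphi gives the two
    moments, without any differentiation under the integral sign. *)
Lemma moments_of_mgf : [/\ P.-integrable setT (EFin \o W),
  P.-integrable setT (EFin \o (fun x => W x ^+ 2)),
  (\int[P]_x W x = - p)%R & (\int[P]_x (W x ^+ 2) = 2 * q)%R].
Proof.
have /nbhs_ballP[e /= e0 he] := mgf.
have {}he t : `|t| < e -> (\int[P]_x (expR (- (t * W x)))%:E = (phi t)%:E)%E.
  by move=> te; apply: he; rewrite /ball/= sub0r normrN.
have mexp t : measurable_fun setT (fun x => expR (- (t * W x))).
  by apply: measurableT_comp => //; apply: measurable_funN; exact: measurable_funM.
have iexp t : `|t| < e -> P.-integrable setT (EFin \o (fun x => expR (- (t * W x)))).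
  move=> te; apply/integrableP; split; first exact/measurable_EFinP.
  under eq_integral => x _ do rewrite /= ger0_norm ?expR_ge0//.
  by rewrite he// ltry.
have iD (f g : T -> R) : P.-integrable setT (EFin \o f) -> P.-integrable setT (EFin \o g) ->
    P.-integrable setT (EFin \o (fun x => f x + g x)).
  move=> fi gi; have -> : EFin \o (fun x => f x + g x) = ((EFin \o f) \+ (EFin \o g))%E.
    by apply/funext => x; rewrite /= EFinD.
  exact: integrableD.
have iB (f g : T -> R) : P.-integrable setT (EFin \o f) -> P.-integrable setT (EFin \o g) ->
    P.-integrable setT (EFin \o (fun x => f x - g x)).
  move=> fi gi; have -> : EFin \o (fun x => f x - g x) = ((EFin \o f) \- (EFin \o g))%E.
    by apply/funext => x; rewrite /= EFinB.
  exact: integrableB.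
have iZ (k : R) (f : T -> R) : P.-integrable setT (EFin \o f) ->
    P.-integrable setT (EFin \o (fun x => k * f x)).
  move=> fi; have -> : EFin \o (fun x => k * f x) = (fun x => k%:E * (EFin \o f) x)%E.
    by apply/funext => x; rewrite /= EFinM.
  exact: integrableZl.
(* exp(t1 |W|) is at most H; half of the exponent absorbs the powers of W. *)
pose t1 := e / 2; pose t2 := e / 4.
have t10 : 0 < t1 by rewrite divr_gt0.
have t20 : 0 < t2 by rewrite divr_gt0.
have t1e : `|t1| < e by rewrite ger0_norm ?ltW// /t1; lra.
pose H x := expR (- (t1 * W x)) + expR (- (- t1 * W x)).
have H0 x : 0 <= H x by rewrite addr_ge0 ?expR_ge0.
have iH : P.-integrable setT (EFin \o H) by apply: iD; apply: iexp; rewrite ?normrN.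
have expH x : expR (t1 * `|W x|) <= H x.
  rewrite /H mulNr opprK; have [w0|w0] := leP 0 (W x).
    by rewrite ger0_norm// lerDr expR_ge0.
  by rewrite ltr0_norm// mulrN lerDl expR_ge0.
have powH k x : `|W x| ^+ k.+1 * expR (t2 * `|W x|) <= k.+1`!%:R / t2 ^+ k.+1 * H x.
  have z0 : 0 <= t2 * `|W x| by rewrite mulr_ge0// ltW.
  have h := expR_ge1Dxn k z0.
  have {}h : (t2 * `|W x|) ^+ k.+1 / k.+1`!%:R <= expR (t2 * `|W x|) by lra.
  rewrite ler_pdivrMr ?ltr0n ?fact_gt0// in h.
  rewrite [leRHS]mulrAC ler_pdivlMr ?exprn_gt0// [leLHS]mulrAC -exprMn [`|W x| * t2]mulrC.
  have -> : k.+1`!%:R * H x = H x * k.+1`!%:R by rewrite mulrC.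
  apply: (@le_trans _ _ (expR (t2 * `|W x|) * k.+1`!%:R * expR (t2 * `|W x|))).
    by rewrite ler_wpM2r ?expR_ge0.
  rewrite [leLHS]mulrAC ler_wpM2r ?ler0n// -expRD -mulrDl (le_trans _ (expH x))// ler_expR.
  by rewrite ler_wpM2r// /t1 /t2; lra.
have iWk k : P.-integrable setT (EFin \o (fun x => W x ^+ k.+1)).
  apply: (@le_integrable _ _ _ _ _ measurableT _ (EFin \o (fun x => k.+1`!%:R / t2 ^+ k.+1 * H x))).
  - by apply/measurable_EFinP; exact: measurable_funX.
  - move=> x _ /=; rewrite lee_fin normrX [leRHS]ger0_norm; last first.
      by rewrite mulr_ge0// divr_ge0 ?ler0n// exprn_ge0// ltW.
    apply: le_trans (powH k x); rewrite ler_peMr ?exprn_ge0//.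
    by rewrite -expR0 ler_expR mulr_ge0// ltW.
  - exact: iZ.
have iW : P.-integrable setT (EFin \o W) by have := iWk 0; under eq_fun do rewrite expr1.
have iW2 := iWk 1.
set m1 := (\int[P]_x W x)%R; set m2 := (\int[P]_x (W x ^+ 2))%R.
pose h := (\int[P]_x H x)%R.
pose C := 3`!%:R / t2 ^+ 3 : R.
have C0 : 0 <= C by rewrite divr_ge0 ?ler0n// exprn_ge0// ltW.
have tay t : `|t| < t2 -> `|phi t - (1 - t * m1 + t ^+ 2 / 2 * m2)| <= C * h * `|t| ^+ 3.
  move=> tt2; have te : `|t| < e by rewrite (lt_trans tt2)// /t2; lra.
  pose g x := expR (- (t * W x)) - (1 - t * W x + t ^+ 2 / 2 * W x ^+ 2).
  have i1 := iZ t _ iW.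
  have i2 := iZ (t ^+ 2 / 2) _ iW2.
  have ic : P.-integrable setT (EFin \o (fun=> 1 : R)) by exact: finite_measure_integrable_cst.
  have i3 := iB _ _ ic i1; have i4 := iD _ _ i3 i2.
  have ig : P.-integrable setT (EFin \o g) by apply: iB => //; exact: iexp.
  have -> : phi t - (1 - t * m1 + t ^+ 2 / 2 * m2) = (\int[P]_x g x)%R.
    rewrite RintegralB//; last exact: iexp.
    rewrite RintegralD// (RintegralB _ ic)// !RintegralZl//.
    rewrite Rintegral_cst// (_ : fine _ = 1); last by rewrite [X in fine X]probability_setT.
    rewrite mulr1.
    by rewrite {1}/Rintegral he.
  apply: le_trans (le_normr_Rintegral measurableT ig) _.
  rewrite mulrAC -RintegralZl//.
  apply: le_Rintegral => //.
  - rewrite (_ : _ \o _ = abse \o (EFin \o g))//; exact: integrable_abse.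
  - exact: iZ.
  move=> x _; rewrite /g.
  have -> : 1 - t * W x + t ^+ 2 / 2 * W x ^+ 2 = 1 + - (t * W x) + (- (t * W x)) ^+ 2 / 2.
    by field.
  rewrite (le_trans (expR_taylor2 _))// normrN normrM exprMn.
  have -> : C * `|t| ^+ 3 * H x = `|t| ^+ 3 * (C * H x) by ring.
  rewrite -mulrA ler_wpM2l ?exprn_ge0//.
  apply: le_trans (powH 2 x); rewrite ler_wpM2l ?exprn_ge0// ler_expR.
  by rewrite ler_wpM2r// ltW.
have [r [K hK] hr] := jphi.
have [u0 v0] : p + m1 = 0 /\ q - m2 / 2 = 0.
  apply: (@quadratic_small_eq0 _ _ (C * h + K)).
  near=> t.
  have -> : (p + m1) * t + (q - m2 / 2) * t ^+ 2 =
     (phi t - (1 - t * m1 + t ^+ 2 / 2 * m2)) - r t * t ^+ 3.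
    have -> : phi t = 1 + p * t + q * t ^+ 2 + r t * t ^+ 3 by near: t.
    by field.
  rewrite (le_trans (ler_normB _ _))// mulrDl lerD//.
    by apply: tay; near: t; exact: near0_norm_lt.
  rewrite normrM normrX ler_wpM2r ?exprn_ge0//.
  by near: t.
by split => //; lra.
Unshelve. all: by end_near. Qed.

End moments.

(** * Elimination on a rooted tree *)

(** A rooted tree on the indices, given by its parent function par; dep is any
    function that decreases from a vertex to its parent. The path rooted at an
    inner vertex is such a tree, and this form treats its two sides together. *)
Section rooted_tree.
Variables (R : realType) (n : nat) (r : 'I_n) (par : 'I_n -> 'I_n) (dep : 'I_n -> nat).
Hypothesis dep_par : forall k, k != r -> (dep (par k) < dep k)%N.
Hypothesis par_root : par r = r.
Implicit Types (c i j k l : 'I_n) (z : 'M[R]_n).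

Definition child k c := (c != r) && (par c == k).

Definition subtree k j := fconnect par j k.

Definition tadj i j := [|| i == j, child j i | child i j].

Lemma root_ind (P : 'I_n -> Prop) :
  (forall k, (k != r -> P (par k)) -> P k) -> forall k, P k.
Proof.
move=> h k; elim: {k}(dep k).+1 {-2}k (ltnSn (dep k)) => // m IH k km.
apply: h => kr; apply: IH; exact: leq_trans (dep_par kr) km.
Qed.

Let depmax := (\max_k dep k)%N.

Let dep_le k : (dep k <= depmax)%N. Proof. exact: leq_bigmax. Qed.

Lemma leaf_ind (P : 'I_n -> Prop) :
  (forall k, (forall c, child k c -> P c) -> P k) -> forall k, P k.
Proof.
move=> h k; elim: {k}(depmax - dep k).+1 {-2}k (ltnSn (depmax - dep k)) => // m IH k km.
apply: h => c /andP[cr /eqP pc]; apply: IH.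
have := dep_par cr; rewrite pc => kc; rewrite ltnS in km.
by apply: leq_trans km; rewrite ltn_sub2l// (leq_trans kc).
Qed.

(** The solution of f k = F k f when F k f depends on f through the children of k
    only: at k, the iteration is stationary after depmax - dep k + 1 steps. *)
Definition tree_fix (F : 'I_n -> ('I_n -> R) -> R) : 'I_n -> R :=
  iter depmax.+1 (fun f k => F k f) (fun=> 0).

Lemma tree_fixE (F : 'I_n -> ('I_n -> R) -> R) k :
  (forall i (f g : 'I_n -> R), (forall c, child i c -> f c = g c) -> F i f = F i g) ->
  tree_fix F k = F k (tree_fix F).
Proof.
move=> Floc; pose it m := iter m (fun f k => F k f) (fun=> 0 : R).
have stable m1 m2 i : (depmax - dep i < m1 -> depmax - dep i < m2 -> it m1 i = it m2 i)%N.
  move: m1 m2; elim/leaf_ind : i => i IH [//|m1] [//|m2]; rewrite !ltnS => im1 im2.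
  apply: Floc => c ic; move/andP: (ic) => [cr /eqP pc].
  have kc : (depmax - dep c < depmax - dep i)%N.
    by have := dep_par cr; rewrite pc => ?; rewrite ltn_sub2l// (leq_trans _ (dep_le c)).
  by apply: IH => //; [exact: leq_trans im1|exact: leq_trans im2].
rewrite /tree_fix -/(it _) (stable _ depmax.+2)//.
  by rewrite ltnS leq_subr.
by rewrite ltnS (leq_trans (leq_subr _ _)).
Qed.

Lemma sum_children (F : 'I_n -> 'I_n -> R) :
  \sum_k \sum_(c | child k c) F c k = \sum_(c | c != r) F c (par c).
Proof.
rewrite (exchange_big_dep (fun c => c != r))/=; last by move=> k c _ /andP[].
apply: eq_bigr => c cr; rewrite (big_pred1 (par c))// => k.
by rewrite /child cr eq_sym.
Qed.

Lemma subtree_refl k : subtree k k. Proof. exact: connect0. Qed.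

Lemma subtree_par k j : j != k -> subtree k (par j) = subtree k j.
Proof.
move=> jk; apply/idP/idP => [h|].
  exact: connect_trans (fconnect1 _ _) h.
move=> /iter_findex; case: (findex _ _ _) => [/= jk'|m]; first by rewrite jk' eqxx in jk.
by rewrite iterSr => <-; exact: fconnect_iter.
Qed.

Lemma subtree_root k : subtree r k.
Proof.
elim/root_ind : k => k IH; have [->|kr] := eqVneq k r; first exact: subtree_refl.
by rewrite -subtree_par//; exact: IH.
Qed.

Lemma subtree_dep k j : subtree k j -> (dep k <= dep j)%N.
Proof.
move=> /iter_findex <-; elim: (findex _ _ _) => //= m IH.
apply: leq_trans IH; have [->|h] := eqVneq (iter m par j) r; first by rewrite par_root.
exact: ltnW (dep_par h).
Qed.

Lemma subtree_parN c : c != r -> subtree c (par c) = false.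
Proof. by move=> cr; apply/negP => /subtree_dep; rewrite leqNgt dep_par. Qed.

Lemma par_neq c : c != r -> par c != c.
Proof. by move=> /dep_par h; apply/eqP => e; rewrite e ltnn in h. Qed.

Lemma child_irr k : child k k = false.
Proof. by rewrite /child; case: eqVneq => //= /par_neq/negbTE. Qed.

(** This is where the absence of cycles enters. *)
Lemma tadj_cut c j l : subtree c j -> ~~ subtree c l -> tadj j l -> j = c /\ l = par c.
Proof.
move=> cj cl; have jl : j != l by apply: contraNneq cl => <-.
rewrite /tadj (negbTE jl)/= => /orP[|] /andP[h /eqP e].
  have jc : j = c by apply: contraNeq cl => jc; rewrite -e subtree_par.
  by rewrite -jc e.
have lc : l != c by apply: contraNneq cl => ->; exact: subtree_refl.
by move: cl; rewrite -(subtree_par lc) e cj.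
Qed.

Definition tree_sym z := z^T = z /\ forall i j, ~~ tadj i j -> z i j = 0.

Lemma tree_sum (F : 'I_n -> 'I_n -> R) : (forall i j, ~~ tadj i j -> F i j = 0) ->
  \sum_i \sum_j F i j = \sum_k F k k + \sum_(c | c != r) (F c (par c) + F (par c) c).
Proof.
move=> F0.
have Fd i j : F i j = (if i == j then F i i else 0) + (if child j i then F i j else 0)
    + (if child i j then F i j else 0).
  have [<-|ij] := eqVneq i j.
    by rewrite child_irr !addr0.
  rewrite add0r; case: ifPn => ji; case: ifPn => ij'; rewrite ?addr0 ?add0r//.
    move/andP: ji => [ir /eqP pi]; move/andP: ij' => [jr /eqP pj].
    have := dep_par ir; have := dep_par jr; rewrite pi pj => h1 h2.
    by have := ltn_trans h1 h2; rewrite ltnn.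
  by rewrite F0// /tadj (negbTE ij) (negbTE ji).
under eq_bigr do under eq_bigr do rewrite Fd.
under eq_bigr do rewrite !big_split/=.
rewrite !big_split/= addrA; congr (_ + _ + _).
- apply: eq_bigr => i _; by rewrite -big_mkcond/= (big_pred1 i).
- rewrite exchange_big/=; under eq_bigr do rewrite -big_mkcond/=.
  exact: (sum_children (fun c k => F c k)).
- under eq_bigr do rewrite -big_mkcond/=.
  exact: (sum_children (fun c k => F k c)).
Qed.

Variable cc : 'I_n -> R.

(** The substitution that removes cc c times the coordinate of the parent of c
    from the coordinate of c. *)
Definition elim_mx : 'M[R]_n :=
  \matrix_(i, j) ((i == j)%:R - (if child j i then cc i else 0)).

Lemma elim_mx_mulE p (A : 'M[R]_(n, p)) j q :
  (elim_mx *m A) j q = A j q - (if j != r then cc j * A (par j) q else 0).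
Proof.
rewrite mxE; under eq_bigr do rewrite mxE mulrBl.
rewrite sumrB (bigD1 j)//= eqxx mul1r big1 ?addr0; last first.
  by move=> i ij; rewrite eq_sym (negbTE ij) mul0r.
congr (_ - _); case: ifPn => jr.
  rewrite (bigD1 (par j))//= /child jr eqxx/= big1 ?addr0// => i ij.
  by rewrite eq_sym (negbTE ij) mul0r.
by rewrite big1// => i _; rewrite /child (negbTE jr) mul0r.
Qed.

Lemma mul_elim_mxE p (A : 'M[R]_(p, n)) q k :
  (A *m elim_mx) q k = A q k - \sum_(c | child k c) A q c * cc c.
Proof.
rewrite mxE; under eq_bigr do rewrite mxE mulrBr.
rewrite sumrB (bigD1 k)//= eqxx mulr1 big1 ?addr0; last first.
  by move=> i ij; rewrite (negbTE ij) mulr0.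
by congr (_ - _); rewrite [RHS]big_mkcond/=; apply: eq_bigr => i _; case: ifP; rewrite ?mulr0.
Qed.

Lemma elim_mx_unit : elim_mx \in unitmx.
Proof.
rewrite -unitmx_tr -row_free_unit -kermx_eq0; apply/rowV0P => v /sub_kermxP h.
have {}h : elim_mx *m v^T = 0 by rewrite -[LHS]trmxK trmx_mul trmxK h trmx0.
apply/rowP => k; rewrite mxE -[v]trmxK mxE.
elim/root_ind : k => k IH; have := congr1 (fun A : 'cV[R]_n => A k 0) h.
rewrite elim_mx_mulE [RHS]mxE; case: ifPn => kr; last by rewrite subr0.
by rewrite (IH kr) mulr0 subr0.
Qed.

Definition back_mx := invmx elim_mx.
Local Notation S := back_mx.

(** Climbing from j to its parent, this expresses the entry (j, k) as the product
    of the slopes on the way up from j to k. *)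
Lemma back_mx_row j k : S j k = (j == k)%:R + (if j != r then cc j * S (par j) k else 0).
Proof.
have := elim_mx_mulE S j k; rewrite mulmxV ?elim_mx_unit// mxE => ->.
by rewrite subrK.
Qed.

(** The way up from j to the root does not meet k. *)
Lemma back_mx_off k j : ~~ subtree k j -> S j k = 0.
Proof.
elim/root_ind : j => j IH kj.
have jk : j != k by apply: contraNneq kj => ->; exact: subtree_refl.
rewrite back_mx_row (negbTE jk) add0r; case: ifPn => // jr.
by rewrite IH ?mulr0// subtree_par.
Qed.

Lemma back_mx_diag k : S k k = 1.
Proof.
rewrite back_mx_row eqxx; case: ifPn => kr; last by rewrite addr0.
by rewrite back_mx_off ?mulr0 ?addr0// subtree_parN.
Qed.

Lemma back_mx_child c k : child k c -> S c k = cc c.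
Proof.
move=> /andP[cr /eqP <-]; rewrite back_mx_row cr eq_sym (negbTE (par_neq cr)) add0r.
by rewrite back_mx_diag mulr1.
Qed.

(** The way up from j to k passes through c and then through its parent. *)
Lemma back_mx_cut c j k : subtree c j -> ~~ subtree c k ->
  S j k = S j c * (cc c * S (par c) k).
Proof.
elim/root_ind : j => j IH cj ck.
have jk : j != k by apply: contraNneq ck => <-.
have [jc|jc] := eqVneq j c.
  rewrite jc back_mx_diag mul1r back_mx_row -jc (negbTE jk) add0r.
  case: ifPn => // /negPn/eqP jr.
  by move: ck; rewrite -jc jr subtree_root.
rewrite back_mx_row (negbTE jk) add0r [in RHS]back_mx_row (negbTE jc) add0r.
case: ifPn => jr; last by rewrite mul0r.
by rewrite IH ?subtree_par// !mulrA.
Qed.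

Section congruence.
Variables (z : 'M[R]_n) (zs : tree_sym z).

(** The symmetric matrix z in the basis that diagonalizes the matrix with slopes
    cc. *)
Definition cong_mx := S^T *m z *m S.
Local Notation w := cong_mx.

Lemma cong_mx_sym j k : w j k = w k j.
Proof.
have : w^T = w by rewrite /w !trmx_mul zs.1 trmxK mulmxA.
by move=> /matrixP/(_ k j); rewrite mxE.
Qed.

Let wE i k : w i k = \sum_j \sum_l S j i * z j l * S l k.
Proof.
rewrite mxE exchange_big; apply: eq_bigr => l _ /=.
by rewrite mxE big_distrl; apply: eq_bigr => j _; rewrite mxE.
Qed.

(** Outside of the subtree of c, only the edge from c to its parent contributes,
    by tadj_cut; inside it, column k of back_mx is a multiple of column c, by
    back_mx_cut. *)
Lemma cong_mx_cut c k : c != r -> ~~ subtree c k ->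
  w c k = (z c (par c) + cc c * w c c) * S (par c) k.
Proof.
move=> cr ck; have cp := subtree_parN cr.
have step j l : S j c * z j l * S l k = S j c * z j l * S l c * (cc c * S (par c) k)
    + (if (j == c) && (l == par c) then z c (par c) * S (par c) k else 0).
  have [cj|cj] := boolP (subtree c j); last first.
    rewrite (back_mx_off cj) !mul0r add0r ifF//.
    by apply: contraNF cj => /andP[/eqP -> _]; exact: subtree_refl.
  have [cl|cl] := boolP (subtree c l).
    rewrite ifF ?addr0; last by apply: contraTF cl => /andP[_ /eqP ->]; rewrite cp.
    by rewrite (back_mx_cut cl ck) !mulrA.
  rewrite (back_mx_off cl) mulr0 mul0r add0r.
  have [jl|jl] := boolP (tadj j l).
    by have [-> ->] := tadj_cut cj cl jl; rewrite !eqxx back_mx_diag mul1r.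
  rewrite zs.2// mulr0 mul0r ifF//.
  apply: contraNF jl => /andP[/eqP -> /eqP ->].
  by rewrite /tadj /child cr eqxx orbT.
rewrite wE; under eq_bigr do under eq_bigr do rewrite step.
under eq_bigr do rewrite big_split/= -mulr_suml.
rewrite big_split/= -mulr_suml -wE mulrDl addrC; congr (_ + _); last by ring.
rewrite (bigD1 c)//= eqxx/= [X in _ + X]big1 ?addr0; last first.
  by move=> j jc; rewrite big1// => l _; rewrite (negbTE jc).
rewrite (bigD1 (par c))//= eqxx/= big1 ?addr0// => l lp.
by rewrite (negbTE lp).
Qed.

(** Column k of back_mx is the k-th unit vector plus the columns of the children
    of k multiplied by their slopes, and cong_mx_cut evaluates the cross terms.
    For z = y this is the recursion of the pivots; for z a perturbation of y it
    is the recursion of their derivatives. *)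
Lemma cong_mx_diag k :
  w k k = z k k + \sum_(c | child k c) (2 * cc c * z c k + cc c ^+ 2 * w c c).
Proof.
have vE : (S^T *m z) k k = z k k + \sum_(c | child k c) cc c * z c k.
  rewrite mxE (bigD1 k)//= mxE back_mx_diag mul1r; congr (_ + _).
  rewrite big_mkcond [RHS]big_mkcond/=; apply: eq_bigr => j _; rewrite mxE.
  have [->|jk] := eqVneq j k.
    by rewrite child_irr.
  case: ifPn => jc; first by rewrite back_mx_child.
  have [kj|kj] := boolP (child j k); last first.
    by rewrite [z _ _]zs.2 ?mulr0// /tadj (negbTE jk) (negbTE jc) (negbTE kj).
  move/andP: kj => [kr /eqP <-]; rewrite back_mx_off ?mul0r//.
  by rewrite subtree_parN.
have := mul_elim_mxE w k k; rewrite /w mulmxKV ?elim_mx_unit// vE => /eqP.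
rewrite -/w eq_sym subr_eq => /eqP ->; rewrite -addrA -big_split/=; congr (_ + _).
apply: eq_bigr => c kc; have /andP[cr /eqP pc] := kc.
rewrite cong_mx_sym cong_mx_cut//; last by rewrite -pc subtree_parN.
by rewrite pc back_mx_diag; ring.
Qed.

End congruence.

Section covariance_mx.
Variable th : 'I_n -> R.

(** With th k = s k / pivot y k, the case J = predT is the hat matrix of the mean
    (hat_part_mx), and a set J closed under descendants gives the matrix M_J
    (MI_part_mx). *)
Definition part_mx (J : pred 'I_n) : 'M[R]_n :=
  \matrix_(a, b) \sum_(k | J k) th k * S a k * S b k.

Lemma part_mx_sym J : (part_mx J)^T = part_mx J.
Proof. by apply/matrixP => a b; rewrite !mxE; apply: eq_bigr => k _; rewrite mulrAC. Qed.

Local Notation X := (part_mx predT).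

Lemma part_mx_edge c : c != r -> X c (par c) = cc c * X (par c) (par c).
Proof.
move=> cr; rewrite !mxE mulr_sumr; apply: eq_bigr => k _.
rewrite (back_mx_row c) cr; have [<-|ck] := eqVneq c k.
  by rewrite [S (par c) c]back_mx_off ?subtree_parN//; ring.
by rewrite add0r; ring.
Qed.

Lemma part_mx_diag k :
  X k k = th k + (if k != r then cc k ^+ 2 * X (par k) (par k) else 0).
Proof.
case: ifPn => kr; last first.
  rewrite mxE (bigD1 k)//= back_mx_diag !mulr1 addr0 big1 ?addr0// => j jk.
  by rewrite back_mx_row (negbTE kr) eq_sym (negbTE jk) addr0 mulr0.
rewrite !mxE mulr_sumr [in LHS](bigD1 k)//= [in RHS](bigD1 k)//= addrA; congr (_ + _).
  by rewrite back_mx_diag [S (par k) k]back_mx_off ?subtree_parN//; ring.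
apply: eq_bigr => j jk.
by rewrite (back_mx_row k) kr eq_sym (negbTE jk) add0r; ring.
Qed.

(** Summation by parts along the tree: the recursion part_mx_diag, from the root
    to the leaves, is the transpose of the one on the right-hand side. *)
Lemma adjoint_sum (f : 'I_n -> R) : \sum_k th k * f k =
  \sum_k X k k * (f k - \sum_(c | child k c) cc c ^+ 2 * f c).
Proof.
under [RHS]eq_bigr do rewrite mulrBr mulr_sumr.
rewrite sumrB (sum_children (fun c k => X k k * (cc c ^+ 2 * f c))).
rewrite [X in _ = _ - X]big_mkcond -sumrB; apply: eq_bigr => k _.
by rewrite (part_mx_diag k); case: ifPn => kr; rewrite ?subr0 ?addr0//; ring.
Qed.

Variables (z : 'M[R]_n) (zs : tree_sym z).
Local Notation w := (cong_mx z).

Lemma pairing_part_mx J : pairing z (part_mx J) = \sum_(k | J k) th k * w k k.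
Proof.
have wE k : w k k = \sum_i \sum_j S j k * z j i * S i k.
  by rewrite mxE; apply: eq_bigr => i _; rewrite mxE big_distrl/=; apply: eq_bigr => j _; rewrite !mxE.
under [RHS]eq_bigr do rewrite wE mulr_sumr.
rewrite /pairing /mxtrace [RHS]exchange_big/=.
under eq_bigr do rewrite mxE; rewrite exchange_big/=; apply: eq_bigr => i _.
under [RHS]eq_bigr do rewrite mulr_sumr.
rewrite [RHS]exchange_big/=; apply: eq_bigr => j _.
rewrite mxE mulr_sumr; apply: eq_bigr => k _; ring.
Qed.

Lemma pairing_quad_part_mx J :
  \tr (z *m (part_mx J *m z *m part_mx J)) =
  \sum_(j | J j) \sum_(k | J k) th j * th k * w j k ^+ 2.
Proof.
pose V := \matrix_(a, b) (if J a then (th a *: (a == b)%:R) else 0) : 'M[R]_n.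
have AE : part_mx J = S *m V *m S^T.
  apply/matrixP => a b; rewrite !mxE big_mkcond; apply: eq_bigr => k _.
  rewrite !mxE (bigD1 k)//= !mxE eqxx big1 ?addr0; last first.
    by move=> i ik; rewrite !mxE (negbTE ik) scaler0 if_same mulr0.
  by case: ifP => _; rewrite /GRing.scale/= ?mulr1 ?mulr0 ?mul0r//; ring.
have -> : \tr (z *m (part_mx J *m z *m part_mx J)) = \tr (w *m V *m (w *m V)).
  have -> : z *m (part_mx J *m z *m part_mx J) =
      z *m S *m V *m S^T *m z *m S *m V *m S^T by rewrite AE !mulmxA.
  by rewrite mxtrace_mulC !mulmxA.
have wV i k : (w *m V) i k = if J k then w i k * th k else 0.
  rewrite mxE (bigD1 k)//= [V k k]mxE eqxx big1 ?addr0; last first.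
    by move=> j jk; rewrite [V j k]mxE (negbTE jk) scaler0 if_same mulr0.
  by case: ifP => _; rewrite /GRing.scale/= ?mulr1 ?mulr0.
rewrite /mxtrace; under eq_bigr do rewrite mxE.
rewrite [RHS]big_mkcond; apply: eq_bigr => j _; case: ifPn => Jj; last first.
  by rewrite big1// => k _; rewrite !wV (negbTE Jj) mulr0.
rewrite [RHS]big_mkcond; apply: eq_bigr => k _; rewrite !wV Jj; case: ifP => _; last by rewrite mul0r.
by rewrite (cong_mx_sym zs k j); ring.
Qed.

(** Expanding the diagonal entry of part_mx at the parent of c, the terms inside
    the subtree of c vanish, and cong_mx_cut identifies the others. *)
Lemma cut_square c : c != r ->
  (z c (par c) + cc c * w c c) ^+ 2 * X (par c) (par c) =
  \sum_(k | ~~ subtree c k) th k * w c k ^+ 2.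
Proof.
move=> cr; rewrite [X _ _]mxE mulr_sumr (bigID (subtree c))/= big1 ?add0r; last first.
  move=> k ck; rewrite [S (par c) k]back_mx_off ?mulr0//.
  apply: contraT => /negPn kp.
  by have := connect_trans kp ck; rewrite -[fconnect _ _ _]/(subtree _ _) subtree_parN.
by apply: eq_bigr => k ck; rewrite [in RHS]cong_mx_cut//; ring.
Qed.

End covariance_mx.

End rooted_tree.

(** * Pivots *)

Section pivots.
Variables (R : realType) (n : nat) (r : 'I_n) (par : 'I_n -> 'I_n) (dep : 'I_n -> nat).
Hypothesis dep_par : forall k, k != r -> (dep (par k) < dep k)%N.
Hypothesis par_root : par r = r.
Implicit Types (c i j k l : 'I_n) (y z eta : 'M[R]_n) (cc D th : 'I_n -> R).
Local Notation child := (child r par).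
Local Notation subtree := (subtree par).
Local Notation tree_sym := (@tree_sym R n r par).
Local Notation elim_mx := (@elim_mx R n r par).
Local Notation back_mx := (@back_mx R n r par).
Local Notation part_mx := (@part_mx R n r par).
Local Notation cong_mx := (@cong_mx R n r par).

Let tree_fixE := @tree_fixE R n r par dep dep_par.
Let sum_children := @sum_children R n r par.
Let leaf_ind := @leaf_ind n r par dep dep_par.

Lemma posdef_cong (P : 'M[R]_n) th : P \in unitmx -> (forall k, 0 < th k) ->
  posdefmx (P *m diag_mx (\row_k th k) *m P^T).
Proof.
move=> Pu th0; split; first by rewrite !trmx_mul trmxK tr_diag_mx mulmxA.
move=> x x0; have -> : x *m (P *m diag_mx (\row_k th k) *m P^T) *m x^T =
    (x *m P) *m diag_mx (\row_k th k) *m (x *m P)^T by rewrite trmx_mul !mulmxA.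
have : x *m P != 0.
  by apply: contra x0 => /eqP xP; rewrite -(mulmxK Pu x) xP mul0mx.
move: (x *m P) => v v0; rewrite mxE.
have term k : (v *m diag_mx (\row_k th k)) 0 k * v^T k 0 = th k * v 0 k ^+ 2.
  by rewrite mul_mx_diag !mxE; ring.
under eq_bigr do rewrite term.
have tge k : 0 <= th k * v 0 k ^+ 2 by rewrite mulr_ge0 ?sqr_ge0// ltW.
rewrite lt_def sumr_ge0 ?andbT//; apply: contra v0; rewrite psumr_eq0// => /allP h.
apply/eqP/rowP => k; rewrite mxE; have := h k (mem_index_enum _).
by rewrite /= mulf_eq0 gt_eqF//= sqrf_eq0 => /eqP.
Qed.

Definition factor_mx cc D : 'M[R]_n :=
  (elim_mx cc)^T *m diag_mx (\row_k D k) *m elim_mx cc.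

Lemma part_mxE cc th (J : pred 'I_n) : part_mx cc th J =
  back_mx cc *m diag_mx (\row_k (if J k then th k else 0)) *m (back_mx cc)^T.
Proof.
apply/matrixP => a b; rewrite mul_mx_diag !mxE big_mkcond; apply: eq_bigr => k _.
by rewrite !mxE; case: ifP => _; ring.
Qed.

Lemma factor_mxK cc D : (forall k, D k != 0) ->
  factor_mx cc D *m part_mx cc (fun k => (D k)^-1) predT = 1%:M.
Proof.
move=> D0; have Uu := elim_mx_unit dep_par cc.
rewrite part_mxE /factor_mx /back_mx !mulmxA mulmxK//.
rewrite -[X in X *m _]mulmxA mulmx_diag (_ : diag_mx _ = 1%:M).
  by rewrite mulmx1 -trmx_mul mulVmx// trmx1.
rewrite -diag_const_mx; congr diag_mx; apply/rowP => k.
by rewrite !mxE mulfV.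
Qed.

Lemma posdef_factor_mx cc D : (forall k, 0 < D k) -> posdefmx (factor_mx cc D).
Proof.
move=> D0; have := @posdef_cong (elim_mx cc)^T D; rewrite trmxK; apply => //.
by rewrite unitmx_tr (elim_mx_unit dep_par).
Qed.

Lemma posdef_part_mx cc th : (forall k, 0 < th k) -> posdefmx (part_mx cc th predT).
Proof.
move=> th0; rewrite part_mxE; apply: posdef_cong => //.
by rewrite unitmx_inv (elim_mx_unit dep_par).
Qed.

Let factor_mx_sum cc D i j : factor_mx cc D i j =
  \sum_k D k * ((k == i)%:R - (if child i k then cc k else 0))
             * ((k == j)%:R - (if child j k then cc k else 0)).
Proof.
rewrite /factor_mx mxE; apply: eq_bigr => k _.
by rewrite mul_mx_diag !mxE; ring.
Qed.

Lemma factor_mx_diag cc D k :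
  factor_mx cc D k k = D k + \sum_(c | child k c) D c * cc c ^+ 2.
Proof.
rewrite factor_mx_sum (bigD1 k)//= eqxx (child_irr dep_par) subr0 !mulr1; congr (_ + _).
rewrite [RHS]big_mkcond [LHS]big_mkcond/=; apply: eq_bigr => c _.
have [->|ck] := eqVneq c k; first by rewrite (child_irr dep_par).
by rewrite sub0r; case: ifP => _; ring.
Qed.

(** At most one of the two terms is nonzero, as i and j cannot be each the parent
    of the other. *)
Lemma factor_mx_off cc D i j : i != j -> factor_mx cc D i j =
  - (if child j i then D i * cc i else 0) - (if child i j then D j * cc j else 0).
Proof.
move=> ij; rewrite factor_mx_sum (bigD1 i)//= (bigD1 j)/=; last by rewrite eq_sym.
rewrite !eqxx !(child_irr dep_par) [j == i]eq_sym (negbTE ij) !subr0 !sub0r !mulr1.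
rewrite big1 ?addr0.
  by case: ifP => _; case: ifP => _; ring.
move=> k /andP[ki kj]; rewrite (negbTE ki) (negbTE kj) !sub0r.
case: ifP => [/andP[_ /eqP e1]|_]; last by ring.
case: ifP => [/andP[_ /eqP e2]|_]; last by ring.
by rewrite -e1 -e2 eqxx in ij.
Qed.

Lemma factor_mx_sym cc D : tree_sym (factor_mx cc D).
Proof.
split; first by rewrite /factor_mx !trmx_mul trmxK tr_diag_mx mulmxA.
move=> i j; rewrite /tadj !negb_or => /and3P[ij ji' ij'].
by rewrite factor_mx_off// (negbTE ij') (negbTE ji') oppr0 addr0.
Qed.

(** The pivots of Gaussian elimination from the leaves to the root: on a tree,
    the elimination of c only changes the diagonal entry of its parent. *)
Definition pivot y : 'I_n -> R :=
  tree_fix dep (fun k f => y k k - \sum_(c | child k c) y c k ^+ 2 / f c).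

Lemma pivotE y k : pivot y k = y k k - \sum_(c | child k c) y c k ^+ 2 / pivot y c.
Proof.
rewrite {1}/pivot tree_fixE// => i f g fg; congr (_ - _).
by apply: eq_bigr => c ic; rewrite fg.
Qed.

Definition slope y c : R := - (y c (par c) / pivot y c).

Lemma pivot_factor_mx cc D : (forall k, D k != 0) -> pivot (factor_mx cc D) =1 D.
Proof.
move=> D0; elim/leaf_ind => k IH; rewrite pivotE factor_mx_diag.
suff -> : \sum_(c | child k c) factor_mx cc D c k ^+ 2 / pivot (factor_mx cc D) c =
   \sum_(c | child k c) D c * cc c ^+ 2 by rewrite addrK.
apply: eq_bigr => c kc; rewrite IH// factor_mx_off; last first.
  by apply: contraTneq kc => ->; rewrite (child_irr dep_par).
rewrite kc ifF; first by field.
apply: contraTF kc => /andP[kr /eqP pk]; apply/negP => /andP[cr /eqP pc].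
have := dep_par kr; have := dep_par cr; rewrite pk pc => h1 h2.
by have := ltn_trans h1 h2; rewrite ltnn.
Qed.

Lemma slope_factor_mx cc D c : (forall k, D k != 0) -> c != r ->
  slope (factor_mx cc D) c = cc c.
Proof.
move=> D0 cr; rewrite /slope pivot_factor_mx// factor_mx_off; last first.
  by rewrite eq_sym (par_neq dep_par).
have h : child (par c) c by apply/andP; rewrite cr eqxx.
rewrite h ifF; first by field.
apply/negP => /andP[kr /eqP pk].
have := dep_par kr; have := dep_par cr; rewrite pk => h1 h2.
by have := ltn_trans h1 h2; rewrite ltnn.
Qed.

Lemma factor_pivot y : tree_sym y -> (forall k, pivot y k != 0) ->
  y = factor_mx (slope y) (pivot y).
Proof.
move=> ys p0; have yE i j : y i j = y j i by rewrite -[in LHS]ys.1 mxE.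
apply/matrixP => i j; have [<-|ij] := eqVneq i j.
  rewrite factor_mx_diag pivotE -addrA -[LHS]addr0; congr (_ + _).
  rewrite addrC -sumrB big1// => c ic.
  have /andP[_ /eqP pc] := ic; rewrite /slope pc; field; exact: p0.
have anti a b : child a b -> child b a -> False.
  move=> /andP[br /eqP pb] /andP[ar /eqP pa].
  have := dep_par br; have := dep_par ar; rewrite pb pa => h1 h2.
  by have := ltn_trans h1 h2; rewrite ltnn.
rewrite factor_mx_off//; case: ifPn => [ji|ji]; case: ifPn => [ij'|ij'].
- by have := anti _ _ ji ij'.
- have /andP[_ /eqP pi] := ji; rewrite /slope pi subr0; field; exact: p0.
- have /andP[_ /eqP pj] := ij'; rewrite yE /slope pj oppr0 add0r; field; exact: p0.
- by rewrite oppr0 addr0 ys.2// /tadj (negbTE ij) (negbTE ji) (negbTE ij').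
Qed.

(** From the leaves to the root, cong_mx_diag identifies the pivot at k with the
    value of the quadratic form of y at column k of back_mx. *)
Lemma pivot_gt0 y : tree_sym y -> posdefmx y -> forall k, 0 < pivot y k.
Proof.
move=> ys [_ ypos] k.
suff: pivot y k = cong_mx (slope y) y k k /\ 0 < pivot y k by case.
elim/leaf_ind : k => k IH.
have wk : pivot y k = cong_mx (slope y) y k k.
  rewrite (cong_mx_diag dep_par par_root _ ys) pivotE -sumrN; congr (_ + _).
  apply: eq_bigr => c kc; have [<- pc] := IH c kc.
  have /andP[_ /eqP e] := kc; rewrite /slope e; field.
  by rewrite gt_eqF.
split=> //; rewrite wk.
pose x : 'rV[R]_n := row k (back_mx (slope y))^T.
have -> : cong_mx (slope y) y k k = (x *m y *m x^T) 0 0.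
  rewrite /cong_mx /x -row_mul [LHS]mxE [RHS]mxE; apply: eq_bigr => i _.
  by rewrite !mxE.
apply: ypos; apply/eqP => /rowP/(_ k); rewrite !mxE (back_mx_diag dep_par par_root) => /eqP.
by rewrite oner_eq0.
Qed.

(** Completion of the squares, vertex by vertex. The terms are the exponents of
    root_kernel and edge_kernel. *)
Lemma pairing_pivot y eta : tree_sym y -> tree_sym eta -> (forall k, pivot y k != 0) ->
  pairing y eta = pivot y r * eta r r + \sum_(c | c != r) pivot y c *
    (eta c c - 2 * slope y c * eta c (par c) + slope y c ^+ 2 * eta (par c) (par c)).
Proof.
move=> ys es p0; have yE i j : y i j = y j i by rewrite -[in LHS]ys.1 mxE.
have eE i j : eta i j = eta j i by rewrite -[in LHS]es.1 mxE.
rewrite /pairing /mxtrace; under eq_bigr do rewrite mxE.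
rewrite (tree_sum dep_par (F := fun i j => y i j * eta j i)); last first.
  by move=> i j ij; rewrite ys.2 ?mul0r.
have -> : \sum_k y k k * eta k k = \sum_k pivot y k * eta k k +
    \sum_(c | c != r) y c (par c) ^+ 2 / pivot y c * eta (par c) (par c).
  rewrite -(sum_children (fun c k => y c k ^+ 2 / pivot y c * eta k k)) -big_split/=.
  by apply: eq_bigr => k _; rewrite -mulr_suml [in RHS]pivotE; ring.
rewrite (bigD1 r)//= -!addrA; congr (_ + _); rewrite -!big_split/=.
apply: eq_bigr => c _; rewrite (eE (par c) c) (yE (par c) c) /slope; field; exact: p0.
Qed.

End pivots.

(** * Expansion of the Laplace transform *)

Section pivot_jets.
Variables (R : realType) (n : nat) (r : 'I_n) (par : 'I_n -> 'I_n) (dep : 'I_n -> nat).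
Hypothesis dep_par : forall k, k != r -> (dep (par k) < dep k)%N.
Hypothesis par_root : par r = r.
Local Notation child := (child r par).
Local Notation subtree := (subtree par).
Local Notation tree_sym := (@tree_sym R n r par).
Local Notation pivot := (@pivot R n r par dep).
Local Notation slope := (@slope R n r par dep).

Variables (y z : 'M[R]_n) (s : 'I_n -> R).
Hypotheses (ys : tree_sym y) (zs : tree_sym z).
Hypotheses (p0 : forall k, 0 < pivot y k) (s0 : forall k, 0 < s k).

Local Notation w := (cong_mx r par (slope y) z).
Let th k := s k / pivot y k.
Local Notation X := (part_mx r par (slope y) th predT).

Let pn0 k : pivot y k != 0. Proof. by rewrite gt_eqF. Qed.

(** The coefficient of t^2 in the pivots of y + t z: the recursion is the
    second-order part of pivotE. *)
Definition pivot_curv : 'I_n -> R := tree_fix dep (fun k f =>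
  \sum_(c | child k c) (slope y c ^+ 2 * f c
    - (z c (par c) + slope y c * w c c) ^+ 2 / pivot y c)).

Let pivot_curvE k : pivot_curv k = \sum_(c | child k c) (slope y c ^+ 2 * pivot_curv c
    - (z c (par c) + slope y c * w c c) ^+ 2 / pivot y c).
Proof.
rewrite {1}/pivot_curv (tree_fixE (par := par) dep_par)// => i f g fg.
by apply: eq_bigr => c ic; rewrite fg.
Qed.

Lemma jet_pivot k : jet (fun t => pivot (y + t *: z) k) (pivot y k) (w k k) (pivot_curv k).
Proof.
elim/(leaf_ind dep_par) : k => k IH.
have aff i j : jet (fun t => (y + t *: z) i j) (y i j) (z i j) 0.
  by apply: jet_near (jet_affine (y i j) (z i j)); near=> t; rewrite !mxE mulrC.
have := jetD (aff k k) (jetZ (-1) (jet_sum (index_enum _) (fun c kc =>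
   jetM (jetM (aff c k) (aff c k)) (jet_inv (pn0 c) (IH c kc))))).
rewrite {1}[pivot y k]pivotE// (cong_mx_diag dep_par par_root _ zs) [pivot_curv k]pivot_curvE.
set e0 := (X in jet _ X); set e1 := (X in jet _ _ X); set e2 := (X in jet _ _ _ X).
have -> : e0 = y k k - \sum_(c | child k c) y c k ^+ 2 / pivot y c.
  by rewrite /e0 mulN1r; congr (_ - _).
have -> : e1 = z k k + \sum_(c | child k c) (2 * slope y c * z c k + slope y c ^+ 2 * w c c).
  rewrite /e1 mulN1r -sumrN; congr (_ + _); apply: eq_bigr => c /andP[_ /eqP pc].
  by rewrite /slope pc; field; exact: pn0.
have -> : e2 = \sum_(c | child k c) (slope y c ^+ 2 * pivot_curv c
    - (z c (par c) + slope y c * w c c) ^+ 2 / pivot y c).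
  rewrite /e2 mulN1r add0r -sumrN; apply: eq_bigr => c /andP[_ /eqP pc].
  by rewrite /slope pc; field; exact: pn0.
apply: jet_near; near=> t; rewrite pivotE// mulN1r; congr (_ - _).
Unshelve. all: by end_near. Qed.

Lemma pivot_near_gt0 : \forall t \near (0 : R), forall k, 0 < pivot (y + t *: z) k.
Proof.
apply: (@filter_forall _ 'I_n (fun k t => 0 < pivot (y + t *: z) k) _ (nbhs_filter 0)) => k.
exact: (jet_gt0 (jet_pivot k) (p0 k)).
Qed.

(** The product of the powers - s k of the pivots at y + t z, divided by the same
    product at y. *)
Definition laplace_ratio t : R :=
  expR (\sum_k - s k * (ln (pivot (y + t *: z) k) - ln (pivot y k))).

(** Twice the coefficient of t^2 in the logarithm of laplace_ratio. *)
Definition tree_variance : R :=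
  \sum_k th k ^+ 2 * w k k ^+ 2 / s k +
  2 * \sum_(c | c != r) th c / s c * \sum_(k | ~~ subtree c k) th k * w c k ^+ 2.

(** adjoint_sum transposes the recursion of pivot_curv, and cut_square turns its
    source terms into sums of squares. *)
Let sum_curv : \sum_k th k * pivot_curv k =
  - \sum_(c | c != r) th c / s c * \sum_(k | ~~ subtree c k) th k * w c k ^+ 2.
Proof.
rewrite (adjoint_sum dep_par par_root (slope y) th).
have -> : \sum_k X k k * (pivot_curv k - \sum_(c | child k c) slope y c ^+ 2 * pivot_curv c) =
   \sum_k \sum_(c | child k c)
      - (X k k * ((z c (par c) + slope y c * w c c) ^+ 2 / pivot y c)).
  apply: eq_bigr => k _; rewrite {1}pivot_curvE -sumrB mulr_sumr.
  by apply: eq_bigr => c _; ring.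
rewrite (sum_children r par (fun c k => - (X k k * ((z c (par c) + slope y c * w c c) ^+ 2 / pivot y c)))).
rewrite sumrN; congr (- _); apply: eq_bigr => c cr.
rewrite -(cut_square dep_par par_root _ _ zs cr).
set Xp := part_mx _ _ _ _ _ _ _; rewrite /th.
by field; rewrite pn0 gt_eqF.
Qed.

Lemma jet_laplace_ratio : let mu := pairing z X in
  jet laplace_ratio 1 (- mu) ((tree_variance + mu ^+ 2) / 2).
Proof.
move=> mu.
have muE : mu = \sum_k th k * w k k by rewrite /mu pairing_part_mx.
have jl : jet (fun t => \sum_k - s k * (ln (pivot (y + t *: z) k) - ln (pivot y k)))
    0 (- mu) (tree_variance / 2).
  have := jet_sum (index_enum _) (fun k (_ : true) => jetZ (- s k)
    (jetD (jet_ln (p0 k) (jet_pivot k)) (jet_cst (- ln (pivot y k))))).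
  rewrite (_ : \sum_k - s k * (ln (pivot y k) + _) = 0); last first.
    by rewrite big1// => k _; rewrite subrr mulr0.
  rewrite (_ : \sum_k - s k * (w k k / pivot y k + 0) = - mu); last first.
    rewrite muE -sumrN; apply: eq_bigr => k _; rewrite /th; field; exact: pn0.
  rewrite (_ : \sum_k _ = tree_variance / 2)//.
  rewrite /tree_variance mulrDl [2 * _]mulrC mulfK// -[X in _ = _ + X]opprK -sum_curv.
  rewrite mulr_suml -sumrB; apply: eq_bigr => k _; rewrite /th.
  by field; rewrite pn0 gt_eqF.
have := jet_comp jl (jet_expR R).
rewrite mul1r (_ : 1 * _ + _ = (tree_variance + mu ^+ 2) / 2)//; by field.
Qed.

End pivot_jets.

(** * The path as a rooted tree *)

Section path_tree.
Variables (n : nat) (r : 'I_n).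
Implicit Types (c i j k : 'I_n).

Definition path_par k : 'I_n :=
  insubd r (if (k < r)%N then k.+1 else if (r < k)%N then k.-1 else r).

(** The distance to the root: one of the two truncated differences is zero. *)
Definition path_dep k : nat := (k - r) + (r - k).

Lemma val_path_par k : path_par k =
  (if (k < r)%N then k.+1 else if (r < k)%N then k.-1 else r) :> nat.
Proof.
rewrite /path_par val_insubd ifT//; case: ifPn => [kr|_].
  exact: leq_ltn_trans kr (ltn_ord r).
by case: ifPn => // _; rewrite (leq_ltn_trans (leq_pred _)).
Qed.

Lemma path_dep_par k : k != r -> (path_dep (path_par k) < path_dep k)%N.
Proof.
rewrite -(inj_eq val_inj)/= /path_dep val_path_par => kr.
case: ifPn => h1; first lia.
case: ifPn => h2; lia.
Qed.

Lemma path_par_root : path_par r = r.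
Proof. by apply/val_inj; rewrite /= val_path_par ltnn. Qed.

Lemma edge_tadj i j : edge i j = tadj r path_par i j.
Proof.
rewrite /tadj /child -!(inj_eq val_inj)/= !val_path_par /edge.
case: (ltnP i r) => ir; case: (ltnP j r) => jr; try (case: (ltnP r i) => ?); try (case: (ltnP r j) => ?); lia.
Qed.

Lemma ZG_tree_sym (R : realType) (z : 'M[R]_n) : ZG z <-> tree_sym r path_par z.
Proof.
by split=> -[zs z0]; split=> // i j ij; apply: z0; move: ij; rewrite edge_tadj.
Qed.

Lemma path_par_lt i : (i < r)%N -> path_par i = i.+1 :> nat.
Proof. by move=> ir; rewrite val_path_par ir. Qed.

Lemma path_par_gt i : (r < i)%N -> path_par i = i.-1 :> nat.
Proof. by move=> ri; rewrite val_path_par ri ltnNge (ltnW ri). Qed.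

End path_tree.

Section log_exponents.
Variable R : realType.

Lemma sum_root_split (n : nat) (r : 'I_n) (F : nat -> R) :
  \sum_(c < n | c != r) F c = \sum_(0 <= i < r) F i + \sum_(r.+1 <= i < n) F i.
Proof.
rewrite (eq_bigl (fun c : 'I_n => (c : nat) != r)); last by move=> c; rewrite -(inj_eq val_inj).
rewrite -(big_mkord (fun i => i != r :> nat)).
rewrite (@big_cat_nat _ _ _ r)//=; last exact: ltnW.
congr (_ + _).
  by rewrite big_nat_cond [RHS]big_nat_cond; apply: eq_bigl => i; lia.
rewrite big_ltn_cond// eqxx/= big_nat_cond [RHS]big_nat_cond; apply: eq_bigl => i; lia.
Qed.

(** Here l and L are the logarithms of the 2 x 2 minors and of the diagonal
    entries. On the right-hand side, every vertex other than M carries the minor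
    of the edge to its parent and a power of the diagonal entry at its parent,
    and the root keeps the power sg M - 1. The values sg 0 = sg n.+1 = 0 cover a
    root at an end of the path. *)
Lemma wishart_exponents (sg l L : nat -> R) (M n : nat) : (1 <= M <= n)%N ->
  sg 0 = 0 -> sg n.+1 = 0 ->
  \sum_(1 <= i < M) sg i * l i + \sum_(M.+1 <= i < n.+1) sg i * l i.-1
  - (\sum_(2 <= i < M) sg i.-1 * L i + (sg M.-1 - sg M + sg M.+1) * L M
     + \sum_(M.+1 <= i < n) sg i.+1 * L i)
  + (if n == 1%N then - L 1%N else
     \sum_(1 <= i < n) (- (3 / 2)) * l i + \sum_(2 <= i < n) L i)
  = \sum_(1 <= i < M) ((sg i - 3 / 2) * l i + (1 - sg i) * L i.+1)
    + ((sg M - 1) * L M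
    + \sum_(M.+1 <= i < n.+1) ((sg i - 3 / 2) * l i.-1 + (1 - sg i) * L i.-1)).
Proof.
move=> /andP[M1 Mn] sg0 sgn.
rewrite [in RHS]big_split [X in _ = _ + (_ + X)]big_split/=.
have E1 : \sum_(1 <= i < M) (sg i - 3 / 2) * l i =
   \sum_(1 <= i < M) sg i * l i - 3 / 2 * \sum_(1 <= i < M) l i.
  by rewrite mulr_sumr -sumrB; apply: eq_bigr => i _; ring.
have E2 : \sum_(M.+1 <= i < n.+1) (sg i - 3 / 2) * l i.-1 =
   \sum_(M.+1 <= i < n.+1) sg i * l i.-1 - 3 / 2 * \sum_(M <= i < n) l i.
  by rewrite !(big_add1 _ _ M n.+1)/= mulr_sumr -sumrB; apply: eq_bigr => i _; ring.
have E3 : \sum_(1 <= i < M) (1 - sg i) * L i.+1 =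
    \sum_(2 <= i < M) L i - \sum_(2 <= i < M) sg i.-1 * L i
    + (if (1 < M)%N then (1 - sg M.-1) * L M else 0).
  case: ifPn => h; last by rewrite !big_geq ?subr0 ?addr0//; lia.
  case: M h {M1 Mn E1 E2} => // M; rewrite ltnS => M1.
  rewrite big_nat_recr//= !(big_add1 _ _ 1 M.+1)/= -sumrB; congr (_ + _).
  by apply: eq_bigr => i _; ring.
have E4 : \sum_(M.+1 <= i < n.+1) (1 - sg i) * L i.-1 =
    \sum_(M.+1 <= i < n) L i - \sum_(M.+1 <= i < n) sg i.+1 * L i
    + (if (M < n)%N then (1 - sg M.+1) * L M else 0).
  rewrite big_add1/=; case: ifPn => h.
    rewrite big_ltn//= -sumrB addrC; congr (_ + _); apply: eq_bigr => i _; ring.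
  by rewrite !big_geq ?subr0 ?addr0//; lia.
rewrite E1 E2 E3 E4.
have E5 : \sum_(1 <= i < n) (- (3 / 2)) * l i =
   - (3 / 2 * \sum_(1 <= i < M) l i) - 3 / 2 * \sum_(M <= i < n) l i.
  by rewrite -mulr_sumr (@big_cat_nat _ _ _ M)//= mulrDr !mulNr.
have sgM1 : ~~ (1 < M)%N -> sg M.-1 = 0 by move=> h; rewrite (_ : M = 1%N) ?sg0//; lia.
have sgMn : ~~ (M < n)%N -> sg M.+1 = 0 by move=> h; rewrite (_ : M = n) ?sgn//; lia.
have [n1|n1] := eqVneq n 1%N.
  have M1' : M = 1%N by lia.
  have -> : (1 < M)%N = false by lia.
  have -> : (M < n)%N = false by lia.
  rewrite !big_geq; try lia.
  by rewrite sgM1 ?sgMn; [rewrite M1'; lra|lia|lia].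
have E6 : \sum_(2 <= i < n) L i = \sum_(2 <= i < M) L i + \sum_(M.+1 <= i < n) L i
    + (if (1 < M)%N && (M < n)%N then L M else 0).
  case: ifPn => [/andP[h1 h2]|h].
    by rewrite (@big_cat_nat _ _ _ M)//= (@big_ltn _ _ _ M)//=; ring.
  have [h1|h1] := ltnP 1 M.
    have -> : M = n by lia.
    by rewrite addr0 [X in _ = _ + X]big_geq ?addr0.
  have -> : M = 1%N by lia.
  by rewrite addr0 [X in _ = X + _]big_geq ?add0r.
rewrite E5 E6.
case: (ltnP 1 M) => h1; case: (ltnP M n) => h2 /=.
- ring.
- by rewrite sgMn ?(leq_gtF h2)//; ring.
- by rewrite sgM1 ?(leq_gtF h1)//; ring.
- by move/eqP: n1; lia.
Qed.

End log_exponents.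

(** * Factorization of the Wishart density *)

Section chart.
Variables (R : realType) (n : nat).
Implicit Types (i j : 'I_n) (t : coordIG R n).

(** enum_val may list i and j in either order; the determinant is the same. *)
Lemma pminor2 (A : 'M[R]_n) (I : {set 'I_n}) i j : i != j -> I = [set i; j]%SET ->
  pminor I A = A i i * A j j - A i j * A j i.
Proof.
move=> ij IE.
have gen m (f : 'I_m -> 'I_n) : m = 2 -> injective f -> (forall a, f a = i \/ f a = j) ->
    \det (mxsub f f A) = A i i * A j j - A i j * A j i.
  move=> m2; subst m => finj fij.
  rewrite (expand_det_row _ 0) !big_ord_recl big_ord0 /cofactor !det_mx11 !mxE/= addr0.
  rewrite (_ : lift 0 0 = 1); last exact/val_inj.
  rewrite (_ : lift 1 0 = 0); last exact/val_inj.
  have := fij 0; have := fij 1.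
  have f01 : f 0 <> f 1 by move/finj.
  by move=> [] e1 [] e0; rewrite e0 e1 in f01 *; (try by []); ring.
apply: gen; first by rewrite IE cards2 ij.
- exact: enum_val_inj.
- move=> a; have : enum_val a \in [set i; j]%SET by rewrite -IE; exact: enum_valP.
  by rewrite !inE => /orP[]/eqP; [left|right].
Qed.

Lemma chartIG_diag t i : chartIG t i i = nth 0 t i.*2.
Proof. by rewrite mxE edgexx addnn. Qed.

Lemma chartIG_next t i j : j = i.+1 :> nat -> chartIG t i j = nth 0 t i.*2.+1.
Proof. by move=> ji; rewrite mxE ji /edge ji leqnn !leqW//= addnS addnn. Qed.

Lemma chartIG_prev t i j : j = i.+1 :> nat -> chartIG t j i = nth 0 t i.*2.+1.
Proof.
by move=> ji; rewrite -(chartIG_next _ ji) -[in RHS](chartIG_IG t).1 [RHS]mxE.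
Qed.

Lemma at1E (f : 'I_n -> R) i : at1 f i.+1 = f i.
Proof. by rewrite /at1 valK. Qed.

Lemma at1_over (f : 'I_n -> R) : at1 f n.+1 = 0.
Proof. by rewrite /at1 insubN// ltnn. Qed.

Lemma dg_chart t k : (k < n)%N -> dg (chartIG t) k.+1 = nth 0 t k.*2.
Proof. by move=> kn; rewrite /dg (at1E _ (Ordinal kn)) chartIG_diag. Qed.

Lemma pminor_chart t k : (k.+1 < n)%N -> pminor (seg n k.+1 k.+2) (chartIG t) =
  nth 0 t k.+1.*2 * nth 0 t k.*2 - nth 0 t k.*2.+1 ^+ 2.
Proof.
move=> kn; have kn' := ltnW kn.
rewrite (@pminor2 _ _ (Ordinal kn') (Ordinal kn)); last 2 first.
- by rewrite -(inj_eq val_inj)/= neq_ltn ltnSn.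
- by apply/setP => i; rewrite !inE -!(inj_eq val_inj)/=; lia.
by rewrite !chartIG_diag (@chartIG_next _ (Ordinal kn'))// (@chartIG_prev _ (Ordinal kn'))//=; ring.
Qed.

Lemma QG_chart t : QG (chartIG t) <->
  (forall k, (k < n)%N -> 0 < nth 0 t k.*2) /\
  (forall k, (k.+1 < n)%N -> 0 < nth 0 t k.+1.*2 * nth 0 t k.*2 - nth 0 t k.*2.+1 ^+ 2).
Proof.
split.
  move/(QGP (chartIG_IG t)) => [h1 h2]; split=> k kn.
    by have := h1 (Ordinal kn); rewrite chartIG_diag.
  have kn' := ltnW kn; have := h2 (Ordinal kn') (Ordinal kn) erefl.
  by rewrite !chartIG_diag (@chartIG_next _ (Ordinal kn'))// mulrC subr_gt0.
move=> [h1 h2]; apply/(QGP (chartIG_IG t)); split=> [i|i j ji].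
  by rewrite chartIG_diag; exact: h1.
have := h2 i; rewrite -ji => /(_ (ltn_ord j)).
by rewrite subr_gt0 !chartIG_diag (chartIG_next _ ji) mulrC.
Qed.

End chart.

Section density_factorization.
Variables (R : realType) (n : nat) (r : 'I_n) (s : 'I_n -> R) (y : 'M[R]_n).
Local Notation par := (path_par r).
Local Notation pivot := (pivot r par (path_dep r) y).
Local Notation slope := (slope r par (path_dep r) y).
Hypotheses (ys : ZG y) (p0 : forall k, pivot k != 0).

Definition nat_ext (f : 'I_n -> R) (k : nat) : R := at1 f k.+1.

(** The density in coordinates, factored over the edges of the path rooted at
    r. *)
Definition kernel_product (t : seq R) : R :=
  left_kernel r (nat_ext s) (nat_ext pivot) (nat_ext slope) t *
  (root_kernel (s r) (pivot r) (nth 0 t r.*2) *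
   right_kernel (n.-1 - r) (fun i => nat_ext s (r.+1 + i)) (fun i => nat_ext pivot (r.+1 + i))
     (fun i => nat_ext slope (r.+1 + i)) (drop r.*2 t)).

Lemma nat_extE (f : 'I_n -> R) (k : 'I_n) : nat_ext f k = f k.
Proof. exact: at1E. Qed.

Let right_kernelE (t : seq R) :
  right_kernel (n.-1 - r) (fun i => nat_ext s (r.+1 + i)) (fun i => nat_ext pivot (r.+1 + i))
     (fun i => nat_ext slope (r.+1 + i)) (drop r.*2 t) =
  \prod_(r.+1 <= i < n) edge_kernel (nat_ext s i) (nat_ext pivot i) (nat_ext slope i)
     (nth 0 t i.-1.*2) (nth 0 t i.*2) (nth 0 t i.-1.*2.+1).
Proof.
rewrite /right_kernel -{4}[r.+1]add0n big_addn subnS -subn1 subnAC subn1 big_mkord.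
apply: eq_bigr => i _; rewrite !nth_drop.
by congr edge_kernel; rewrite ?(addnC i) ?addSn//=; congr (nth _ _ _); lia.
Qed.

Let left_kernelE (t : seq R) :
  left_kernel r (nat_ext s) (nat_ext pivot) (nat_ext slope) t =
  \prod_(0 <= i < r) edge_kernel (nat_ext s i) (nat_ext pivot i) (nat_ext slope i)
     (nth 0 t i.+1.*2) (nth 0 t i.*2) (nth 0 t i.*2.+1).
Proof. by rewrite big_mkord. Qed.

(** If all kernels are nonzero, then the diagonal entry at the root and the minors
    of all edges are positive; positivity of the other diagonal entries follows
    along the edges. *)
Lemma kernel_product_eq0 (t : coordIG R n) : ~ QG (chartIG t) -> kernel_product t = 0.
Proof.
move=> nQ; apply/eqP; apply: contra_notT nQ.
rewrite /kernel_product left_kernelE right_kernelE !mulf_eq0 !negb_or => /and3P[hl hr hR].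
have kneq0 a b c h e x : edge_kernel a b c h e x != 0 -> 0 < h /\ 0 < h * e - x ^+ 2 :> R.
  by rewrite /edge_kernel; case: ifPn => [/andP[]//|_]; rewrite eqxx.
have epos (h e x : R) : 0 < h -> 0 < h * e - x ^+ 2 -> 0 < e.
  by move=> h0 hx; case: (ltP 0 e) => // e0; have := sqr_ge0 x; nra.
have lft i : (i < r)%N -> 0 < nth 0 t i.+1.*2 /\
    0 < nth 0 t i.+1.*2 * nth 0 t i.*2 - nth 0 t i.*2.+1 ^+ 2.
  move=> ir; move: hl; rewrite prodf_seq_neq0 => /allP/(_ i).
  by rewrite mem_index_iota ir/= => /(_ isT)/kneq0.
have rgt i : (r < i < n)%N -> 0 < nth 0 t i.-1.*2 /\
    0 < nth 0 t i.-1.*2 * nth 0 t i.*2 - nth 0 t i.-1.*2.+1 ^+ 2.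
  move=> ir; move: hR; rewrite prodf_seq_neq0 => /allP/(_ i).
  by rewrite mem_index_iota ir/= => /(_ isT)/kneq0.
apply/QG_chart; split=> k kn.
  have [kr|rk|kr] := ltngtP k r.
  - by have [h1 h2] := lft k kr; exact: epos h2.
  - by have [|h1 h2] := rgt k; [rewrite rk|exact: epos h2].
  - by move: hr; rewrite /root_kernel kr; case: ifPn => //; rewrite eqxx.
have [kr|rk] := ltnP k r; first by case: (lft k kr).
by have [|_] := rgt k.+1; [rewrite ltnS rk|rewrite mulrC].
Qed.


Let pairing_chart (t : coordIG R n) : pairing y (chartIG t) =
  pivot r * nth 0 t r.*2 +
  (\sum_(0 <= i < r) nat_ext pivot i * (nth 0 t i.*2 - 2 * nat_ext slope i * nth 0 t i.*2.+1
      + nat_ext slope i ^+ 2 * nth 0 t i.+1.*2) +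
   \sum_(r.+1 <= i < n) nat_ext pivot i * (nth 0 t i.*2 - 2 * nat_ext slope i * nth 0 t i.-1.*2.+1
      + nat_ext slope i ^+ 2 * nth 0 t i.-1.*2)).
Proof.
rewrite (pairing_pivot (@path_dep_par n r)); last 3 first.
- exact/ZG_tree_sym.
- by apply/ZG_tree_sym; exact: chartIG_IG.
- exact: p0.
rewrite chartIG_diag; congr (_ + _).
pose F i := nat_ext pivot i * (nth 0 t i.*2
  - 2 * nat_ext slope i * (if (i < r)%N then nth 0 t i.*2.+1 else nth 0 t i.-1.*2.+1)
  + nat_ext slope i ^+ 2 * (if (i < r)%N then nth 0 t i.+1.*2 else nth 0 t i.-1.*2)).
transitivity (\sum_(c < n | c != r) F c).
  apply: eq_bigr => c cr; rewrite /F !nat_extE !chartIG_diag.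
  have [lt|gt|e] := ltngtP c r; last by rewrite (val_inj e) eqxx in cr.
    by rewrite path_par_lt// (chartIG_next _ (path_par_lt lt)).
  rewrite path_par_gt// (@chartIG_prev _ _ _ (par c) c) ?path_par_gt//.
  by rewrite prednK// (leq_ltn_trans _ gt).
rewrite (sum_root_split r F); congr (_ + _).
  by rewrite big_nat_cond [RHS]big_nat_cond; apply: eq_bigr => i /andP[/andP[_ ir] _]; rewrite /F ir.
rewrite big_nat_cond [RHS]big_nat_cond; apply: eq_bigr => i /andP[/andP[ri _] _].
by rewrite /F ltnNge (ltnW ri).
Qed.

Let prod_expR m p (F G : nat -> R) : (forall i, (m <= i < p)%N -> F i = expR (G i)) ->
  \prod_(m <= i < p) F i = expR (\sum_(m <= i < p) G i).
Proof. by move=> FG; rewrite (eq_big_nat _ _ FG) expR_sum. Qed.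

Let powR_expR (x a : R) : 0 < x -> x `^ a = expR (a * ln x).
Proof. by move=> x0; rewrite /powR gt_eqF. Qed.

(** On the cone both sides are exponentials: the powers match by
    wishart_exponents and the linear parts by pairing_chart. *)
Lemma wishart_densityE (t : coordIG R n) :
  wishart_density s r.+1 y t = kernel_product t.
Proof.
rewrite /wishart_density; have [Q|nQ] := pselect (QG (chartIG t)); last first.
  by rewrite indicE memNset// mul0r kernel_product_eq0.
rewrite indicE mem_set// mul1r; have /QG_chart[E0 D0] := Q.
pose E k := nth 0 t k.*2 : R; pose Dl k := E k.+1 * E k - (nth 0 t k.*2.+1 : R) ^+ 2.
pose l i := ln (Dl i.-1); pose L i := ln (E i.-1); pose sg := at1 s.
have rn := ltn_ord r.
have deltaE : wishart_delta s r.+1 (chartIG t) =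
  expR (\sum_(1 <= i < r.+1) sg i * l i + \sum_(r.+2 <= i < n.+1) sg i * l i.-1
  - (\sum_(2 <= i < r.+1) sg i.-1 * L i + (sg r - sg r.+1 + sg r.+2) * L r.+1
     + \sum_(r.+2 <= i < n) sg i.+1 * L i)).
  rewrite /wishart_delta (prod_expR (G := fun i => sg i * l i)); last first.
    case=> // i ir; rewrite pminor_chart; last lia.
    by rewrite powR_expR//; apply: D0; lia.
  rewrite (prod_expR (G := fun i => sg i * l i.-1)); last first.
    case=> // -[|i] ir; first lia.
    rewrite pminor_chart; last lia.
    by rewrite powR_expR//; apply: D0; lia.
  rewrite (prod_expR (m := 2) (G := fun i => sg i.-1 * L i)); last first.
    case=> // i ir; rewrite dg_chart; last lia.
    by rewrite powR_expR//; apply: E0; lia.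
  rewrite (prod_expR (G := fun i => sg i.+1 * L i)); last first.
    case=> // i ir; rewrite dg_chart; last lia.
    by rewrite powR_expR//; apply: E0; lia.
  by rewrite dg_chart// powR_expR ?E0// -!expRD -expRN -expRD.
have phiE : wishart_phi (chartIG t) = expR (if n == 1%N then - L 1%N else
     \sum_(1 <= i < n) (- (3 / 2)) * l i + \sum_(2 <= i < n) L i).
  rewrite /wishart_phi; case: ifPn => n1.
    by rewrite dg_chart ?expRN ?lnK// ?posrE ?E0//; lia.
  rewrite (prod_expR (G := fun i => (- (3 / 2)) * l i)); last first.
    case=> // i ir; rewrite pminor_chart; last lia.
    by rewrite powR_expR//; apply: D0; lia.
  rewrite (prod_expR (G := L)); last first.
    case=> // i ir; rewrite dg_chart; last lia.
    by rewrite lnK// posrE; apply: E0; lia.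
  by rewrite expRD.
rewrite deltaE phiE -!expRD -addrA wishart_exponents//; last exact: at1_over.
rewrite /kernel_product left_kernelE right_kernelE.
pose GL i := ((sg i.+1 - 3 / 2) * l i.+1 + (1 - sg i.+1) * L i.+2)
  - nat_ext pivot i * (E i - 2 * nat_ext slope i * nth 0 t i.*2.+1 + nat_ext slope i ^+ 2 * E i.+1).
rewrite (prod_expR (G := GL)); last first.
  move=> i /= ir; have h1 : 0 < nth 0 t i.+1.*2 by apply: E0; lia.
  have h2 : 0 < nth 0 t i.+1.*2 * nth 0 t i.*2 - nth 0 t i.*2.+1 ^+ 2 by apply: D0; lia.
  by rewrite /edge_kernel h1 h2/= !powR_expR// -!expRD.
pose GR i := ((sg i.+1 - 3 / 2) * l i + (1 - sg i.+1) * L i)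
  - nat_ext pivot i * (E i - 2 * nat_ext slope i * nth 0 t i.-1.*2.+1 + nat_ext slope i ^+ 2 * E i.-1).
rewrite (prod_expR (G := GR)); last first.
  case=> // i ir; have h1 : 0 < nth 0 t i.*2 by apply: E0; lia.
  have h2 : 0 < Dl i by apply: D0; lia.
  have DE : nth 0 t i.*2 * nth 0 t i.+1.*2 - nth 0 t i.*2.+1 ^+ 2 = Dl i by rewrite /Dl mulrC.
  by rewrite /edge_kernel [i.+1.-1]/= DE h1 h2 !powR_expR// -!expRD.
rewrite /root_kernel E0// powR_expR ?E0// -!expRD; congr expR.
rewrite pairing_chart /GL /GR !sumrB !big_add1/= valK /= /l /L /Dl /E /=; ring.
Qed.

End density_factorization.

(** * The Laplace transform and the moments of the Wishart law *)

Section wishart_law.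
Variables (R : realType) (n : nat) (r : 'I_n) (s : 'I_n -> R).
Local Notation par := (path_par r).
Local Notation dep := (path_dep r).
Local Notation pivot := (@pivot R n r par dep).
Local Notation slope := (@slope R n r par dep).
Local Notation leb := (lebesgue_tuple R n.*2.-1).
Hypotheses (s12 : forall k, k != r -> 1 / 2 < s k) (sr0 : 0 < s r).
Implicit Types (y z : 'M[R]_n).

Let path_par_dep := @path_dep_par n r.

Definition wishart_const : R :=
  \prod_(i < r) edge_mass (nat_ext s i) *
  (Gamma (s r) * \prod_(i < n.-1 - r) edge_mass (nat_ext s (r.+1 + i))).

Let left_ord (i : nat) (ir : (i < r)%N) : exists2 k : 'I_n, k != r & nat_of_ord k = i.
Proof.
by exists (Ordinal (ltn_trans ir (ltn_ord r))) => //; rewrite -(inj_eq val_inj)/= ltn_eqF.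
Qed.

Let right_ord (i : nat) (ir : (i < n.-1 - r)%N) :
  exists2 k : 'I_n, k != r & nat_of_ord k = (r.+1 + i)%N.
Proof.
have h : (r.+1 + i < n)%N by lia.
by exists (Ordinal h) => //; rewrite -(inj_eq val_inj)/=; lia.
Qed.

Lemma wishart_const_gt0 : 0 < wishart_const.
Proof.
rewrite /wishart_const !mulr_gt0 ?Gamma_gt0// prodr_gt0// => i _.
  have [k kr <-] := left_ord (ltn_ord i).
  by rewrite nat_extE edge_mass_gt0// s12.
have [k kr <-] := right_ord (ltn_ord i).
by rewrite nat_extE edge_mass_gt0// s12.
Qed.

(** Integrating the kernels of the edges one by one, only the pivots of y
    remain. *)
Lemma wishart_total_mass y : ZG y -> (forall k, 0 < pivot y k) ->
  (\int[leb]_t (wishart_density s r.+1 y t)%:E =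
   (wishart_const * expR (\sum_k - s k * ln (pivot y k)))%:E)%E.
Proof.
move=> ys p0; have pn0 k : pivot y k != 0 by rewrite gt_eqF.
under eq_integral do rewrite (wishart_densityE s ys pn0).
have gen N (F : seq R -> R) : N = (r + (n.-1 - r)).*2.+1 ->
    (\int[lebesgue_tuple R N]_t (F t)%:E =
     \int[lebesgue_tuple R (r + (n.-1 - r)).*2.+1]_t (F t)%:E)%E by move=> ->.
have rn := ltn_ord r; rewrite gen; last lia.
rewrite integral_path_kernel//; last 2 first.
- move=> i ir; have [k kr <-] := left_ord ir.
  by rewrite !nat_extE; split; [exact: s12|].
- move=> i ir; have [k kr <-] := right_ord ir.
  by rewrite !nat_extE; split; [exact: s12|].
congr (_%:E); rewrite /wishart_const !big_split/=.
have pE k : pivot y k `^ (- s k) = expR (- s k * ln (pivot y k)).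
  by rewrite /powR gt_eqF.
have -> : \prod_(i < r) nat_ext (pivot y) i `^ (- nat_ext s i) =
    expR (\sum_(0 <= i < r) - nat_ext s i * ln (nat_ext (pivot y) i)).
  rewrite big_mkord expR_sum; apply: eq_bigr => i _.
  by have [k kr <-] := left_ord (ltn_ord i); rewrite !nat_extE pE.
have -> : \prod_(i < n.-1 - r) nat_ext (pivot y) (r.+1 + i) `^ (- nat_ext s (r.+1 + i)) =
    expR (\sum_(r.+1 <= i < n) - nat_ext s i * ln (nat_ext (pivot y) i)).
  have -> (F : nat -> R) : \sum_(r.+1 <= i < n) F i = \sum_(i < n.-1 - r) F (r.+1 + i)%N.
    rewrite -{1}[r.+1]add0n big_addn subnS -subn1 subnAC subn1 big_mkord.
    by apply: eq_bigr => i _; rewrite addnC.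
  rewrite expR_sum; apply: eq_bigr => i _.
  by have [k kr <-] := right_ord (ltn_ord i); rewrite !nat_extE pE.
have -> : \sum_k - s k * ln (pivot y k) = - s r * ln (pivot y r) +
    (\sum_(0 <= i < r) - nat_ext s i * ln (nat_ext (pivot y) i) +
     \sum_(r.+1 <= i < n) - nat_ext s i * ln (nat_ext (pivot y) i)).
  rewrite (bigD1 r)//= -sum_root_split; congr (_ + _).
  by apply: eq_bigr => k _; rewrite !nat_extE.
rewrite !expRD -pE; ring.
Qed.

Section fixed_parameter.
Variable y : 'M[R]_n.
Hypotheses (ys : ZG y) (p0 : forall k, 0 < pivot y k).

Let Z := wishart_const * expR (\sum_k - s k * ln (pivot y k)).

Let Z0 : 0 < Z. Proof. by rewrite mulr_gt0 ?expR_gt0 ?wishart_const_gt0. Qed.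

(** The total mass Z is neither 0 nor infinite, so that the law is the normalized
    weight and not the Dirac mass of the degenerate case. *)
Lemma ge0_integral_wishart (f : coordIG R n -> R) : measurable_fun setT f ->
  (forall t, 0 <= f t) ->
  (\int[wishart s r.+1 y]_t (f t)%:E =
   Z^-1%:E * \int[leb]_t (f t * wishart_density s r.+1 y t)%:E)%E.
Proof.
move=> mf f0.
pose g t := Z^-1 * wishart_density s r.+1 y t.
have g0 t : 0 <= g t by rewrite mulr_ge0 ?wishart_density_ge0// invr_ge0 ltW.
have md := @measurable_wishart_density R n s r.+1 y.
have mg : measurable_fun setT g by exact: measurable_funM.
have ZE : wishart_weight s r.+1 y setT = Z%:E by rewrite /wishart_weight wishart_total_mass.
rewrite (@ge0_integral_density _ _ _ leb (wishart s r.+1 y) g mg g0)//.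
- under eq_integral => t _ do rewrite -EFinM /g mulrCA EFinM.
  rewrite ge0_integralZl//.
  + by apply/measurable_EFinP; exact: measurable_funM.
  + by move=> t _; rewrite lee_fin mulr_ge0// wishart_density_ge0.
  + by rewrite lee_fin invr_ge0 ltW.
- move=> A mA; rewrite /wishart/= /mnormalize.
  have Zn : (wishart_weight s r.+1 y setT == 0%E) || (wishart_weight s r.+1 y setT == +oo%E) = false.
    by rewrite ZE orbF eqe gt_eqF.
  rewrite ifF; last exact: Zn.
  set w := (X in fine X); have -> : w = Z%:E by exact: ZE.
  rewrite /= muleC /wishart_weight /g; under [RHS]eq_integral do rewrite EFinM.
  rewrite ge0_integralZl//.
  + by apply/measurable_EFinP; exact: measurable_funTS.
  + by move=> t _; rewrite lee_fin wishart_density_ge0.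
  + by rewrite lee_fin invr_ge0 ltW.
- exact/measurable_EFinP.
Qed.

Lemma measurable_pairing_chart z : measurable_fun setT (fun t : coordIG R n => pairing z (chartIG t)).
Proof.
rewrite /pairing /mxtrace; apply: measurable_sum => i.
rewrite (_ : (fun t => _) = fun t => \sum_j z i j * chartIG t j i).
  by apply: measurable_sum => j; apply: measurable_funM => //; exact: measurable_chartIG.
by apply/funext => t; rewrite mxE.
Qed.

(** The density at y multiplied by exp(- t <z, eta>) is the density at y + t z,
    whose pivots are still positive for t near 0. *)
Lemma wishart_mgf z : ZG z -> \forall t \near (0 : R),
  (\int[wishart s r.+1 y]_x (expR (- (t * pairing z (chartIG x))))%:E =
   (laplace_ratio r par dep y z s t)%:E)%E.
Proof.
move=> zs; have zt : tree_sym r par z by exact/ZG_tree_sym.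
have yt : tree_sym r par y by exact/ZG_tree_sym.
apply: filterS (pivot_near_gt0 path_par_dep (path_par_root r) zt p0) => t pt.
have yzs : ZG (y + t *: z).
  case: ys zs => y1 y2 [z1 z2]; split; first by rewrite linearD linearZ/= y1 z1.
  by move=> i j ij; rewrite !mxE y2// z2// mulr0 addr0.
rewrite ge0_integral_wishart; last 2 first.
- apply: measurableT_comp => //; apply: measurable_funN; apply: measurable_funM => //.
  exact: measurable_pairing_chart.
- by move=> x; exact: expR_ge0.
have -> : (fun x => (expR (- (t * pairing z (chartIG x))) * wishart_density s r.+1 y x)%:E) =
    (fun x => (wishart_density s r.+1 (y + t *: z) x)%:E).
  apply/funext => x; congr (_%:E); rewrite /wishart_density.
  have -> : pairing (y + t *: z) (chartIG x) = pairing y (chartIG x) + t * pairing z (chartIG x).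
    by rewrite /pairing mulmxDl -scalemxAl linearD linearZ.
  by rewrite opprD expRD; ring.
rewrite wishart_total_mass// -EFinM; congr (_%:E).
rewrite /laplace_ratio /Z invfM -expRN mulrACA mulVf ?mul1r ?gt_eqF ?wishart_const_gt0//.
rewrite -expRD; congr expR; rewrite addrC -sumrB; apply: eq_bigr => k _; ring.
Qed.

(** The hat matrix of the mean: wishart_meanE shows that its projection is the
    mean, and hat_part_mx does the rest. *)
Definition mean_mx : 'M[R]_n :=
  part_mx r par (slope y) (fun k => s k / pivot y k) predT.

Let s0 k : 0 < s k.
Proof. by have [->//|/s12 h] := eqVneq k r; rewrite (lt_trans _ h). Qed.

Local Notation P := (wishart s r.+1 y).
Local Notation V := (tree_variance r par dep y ^~ s).

Lemma wishart_moments z : ZG z ->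
  [/\ P.-integrable setT (EFin \o (fun t => pairing z (chartIG t))),
   P.-integrable setT (EFin \o (fun t => pairing z (chartIG t) ^+ 2)),
   (\int[P]_t pairing z (chartIG t) = pairing z mean_mx)%R &
   (\int[P]_t (pairing z (chartIG t) ^+ 2) = V z + pairing z mean_mx ^+ 2)%R].
Proof.
move=> zs; have zt : tree_sym r par z by exact/ZG_tree_sym.
have yt : tree_sym r par y by exact/ZG_tree_sym.
have [i1 i2 e1 e2] := moments_of_mgf (measurable_pairing_chart z) (wishart_mgf zs)
  (jet_laplace_ratio path_par_dep (path_par_root r) zt p0 s0).
by split=> //; rewrite ?e1 ?opprK// e2 mulrC divfK.
Qed.

End fixed_parameter.
End wishart_law.

(** * Subtrees of the path, quadratic forms and principal blocks *)

Section path_subtree.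
Variables (n : nat) (r : 'I_n).
Implicit Types (i j k : 'I_n).
Local Notation sub := (subtree (path_par r)).

Lemma path_subtree_lt j k : (j < r)%N -> sub j k = (k <= j)%N.
Proof.
move=> jr; elim/(root_ind (@path_dep_par n r)) : k => k IH.
have [->|kj] := eqVneq k j; first by rewrite subtree_refl leqnn.
have [kr|kr] := eqVneq k r.
  rewrite kr leqNgt jr; apply/negP => /(subtree_dep (@path_dep_par n r) (path_par_root r)).
  by rewrite /path_dep; lia.
rewrite -subtree_par// IH//; move: kj kr; rewrite -!(inj_eq val_inj)/= val_path_par.
by case: ltnP; case: ltnP; lia.
Qed.

Lemma path_subtree_gt j k : (r < j)%N -> sub j k = (j <= k)%N.
Proof.
move=> jr; elim/(root_ind (@path_dep_par n r)) : k => k IH.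
have [->|kj] := eqVneq k j; first by rewrite subtree_refl leqnn.
have [kr|kr] := eqVneq k r.
  rewrite kr leqNgt jr; apply/negP => /(subtree_dep (@path_dep_par n r) (path_par_root r)).
  by rewrite /path_dep; lia.
rewrite -subtree_par// IH//; move: kj kr; rewrite -!(inj_eq val_inj)/= val_path_par.
by case: ltnP; case: ltnP; lia.
Qed.

End path_subtree.

Section edge_entries.
Variables (R : realType) (n : nat).
Implicit Types (i j k : 'I_n) (z eta A B u : 'M[R]_n).

(** Test matrices of Z_G that read off the entries of a symmetric matrix. *)
Definition sym_delta i j : 'M[R]_n := (1 / 2) *: (delta_mx i j + delta_mx j i).

Lemma ZG_sym_delta i j : edge i j -> ZG (sym_delta i j).
Proof.
move=> ij; split; first by rewrite /sym_delta linearZ/= linearD/= !trmx_delta addrC.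
move=> a b ab; rewrite !mxE.
have -> : (a == i) && (b == j) = false.
  by apply: contraNF ab => /andP[/eqP-> /eqP->].
have -> : (a == j) && (b == i) = false.
  by apply: contraNF ab => /andP[/eqP-> /eqP->]; rewrite /edge andbC.
by rewrite addr0 mulr0.
Qed.

Lemma pairing_sym_delta i j eta : eta^T = eta -> pairing (sym_delta i j) eta = eta i j.
Proof.
move=> es; have eE : eta j i = eta i j by rewrite -[in LHS]es mxE.
have dE a b : \tr (delta_mx a b *m eta) = eta b a.
  rewrite /mxtrace (bigD1 a)//= big1 ?addr0; last first.
    move=> c ca; rewrite mxE big1// => d _; rewrite mxE (negbTE ca) mul0r.
    by [].
  rewrite mxE (bigD1 b)//= mxE !eqxx mul1r big1 ?addr0// => d db.
  by rewrite mxE (negbTE db) andbF mul0r.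
by rewrite /pairing /sym_delta -scalemxAl mulmxDl linearZ/= linearD/= !dE eE; field.
Qed.

Lemma ZG_add z u : ZG z -> ZG u -> ZG (z + u).
Proof.
move=> [z1 z2] [u1 u2]; split; first by rewrite linearD/= z1 u1.
by move=> i j ij; rewrite !mxE z2// u2// addr0.
Qed.

Lemma ZG_scale (a : R) z : ZG z -> ZG (a *: z).
Proof.
move=> [z1 z2]; split; first by rewrite linearZ/= z1.
by move=> i j ij; rewrite !mxE z2// mulr0.
Qed.

Lemma ZG_sum (I : Type) (l : seq I) (P : pred I) (f : I -> 'M[R]_n) :
  (forall i : I, P i -> ZG (f i)) -> ZG (\sum_(i <- l | P i) f i).
Proof.
move=> h; apply: big_ind => //; last exact: ZG_add.
by split=> [|i j _]; rewrite ?trmx0// mxE.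
Qed.

Lemma pairing_piG z A : ZG z -> pairing z (piG A) = pairing z A.
Proof.
move=> [zs z0]; rewrite /pairing /mxtrace; apply: eq_bigr => i _.
rewrite !mxE; apply: eq_bigr => j _; rewrite mxE; case: ifPn => // ji.
by rewrite z0 ?mul0r//; move: ji; rewrite /edge andbC.
Qed.

Lemma piG_ZG A : A^T = A -> ZG (piG A).
Proof.
move=> As; split; last by move=> i j ij; rewrite mxE (negbTE ij).
apply/matrixP => i j; rewrite !mxE -[in LHS]As mxE.
by rewrite /edge andbC.
Qed.

Lemma PP_ZG A u : A^T = A -> ZG u -> ZG (PP A u).
Proof. by move=> As [us _]; apply: piG_ZG; rewrite !trmx_mul As us mulmxA. Qed.

(** The value of P(A) u at z, as pairing_PP shows; in this form it is visibly
    symmetric in z and u. *)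
Definition quad_form A z u : R := \tr (z *m (A *m u *m A)).

Lemma pairing_PP A z u : ZG z -> pairing z (PP A u) = quad_form A z u.
Proof. by move=> zz; rewrite /PP pairing_piG. Qed.

Lemma quad_formC A z u : quad_form A z u = quad_form A u z.
Proof. by rewrite /quad_form !mulmxA -[X in \tr X = _]mulmxA mxtrace_mulC !mulmxA. Qed.

Lemma quad_formD A z u : quad_form A (z + u) (z + u) =
  quad_form A z z + quad_form A u u + 2 * quad_form A u z.
Proof.
rewrite /quad_form !(mulmxDr, mulmxDl) !linearD/=.
have := quad_formC A z u; rewrite /quad_form => ->; ring.
Qed.

Lemma ZG_eq_pairing A B : ZG A -> ZG B -> (forall z, ZG z -> pairing z A = pairing z B) -> A = B.
Proof.
move=> [As A0] [Bs B0] h; apply/matrixP => i j; have [ij|ij] := boolP (edge i j).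
  by have := h _ (ZG_sym_delta ij); rewrite !pairing_sym_delta.
by rewrite A0// B0.
Qed.

End edge_entries.

Section principal_inverse.
Variables (R : realType) (n : nat).
Implicit Types (K Y : 'M[R]_n) (I : {set 'I_n}).

Lemma padmx_psubmx I Y : (forall i j, (i \notin I) || (j \notin I) -> Y i j = 0) ->
  padmx (psubmx I Y) = Y.
Proof.
move=> Y0; apply/matrixP => i j; rewrite mxE.
have [iI|iI] := boolP (i \in I); last first.
  rewrite Y0 ?iI// big1// => a /eqP ai; move: iI.
  by rewrite -ai enum_valP.
have [jI|jI] := boolP (j \in I); last first.
  rewrite Y0 ?jI ?orbT// big1// => a _; rewrite big1// => b /eqP bj; move: jI.
  by rewrite -bj enum_valP.
have pick k (kI : k \in I) (a : 'I_#|I|) : (enum_val a == k) = (a == enum_rank_in kI k).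
  apply/eqP/eqP => [ak|->]; last by rewrite enum_rankK_in.
  by apply: enum_val_inj; rewrite enum_rankK_in.
rewrite (big_pred1 (enum_rank_in iI i)); last by move=> a; rewrite (pick _ iI).
rewrite (big_pred1 (enum_rank_in jI j)); last by move=> a; rewrite (pick _ jI).
by rewrite mxE !enum_rankK_in.
Qed.

(** As Y vanishes outside of the block of I, the block of K *m Y is the product of
    the blocks. *)
Lemma padmx_invmx_psubmx I K Y :
  (forall i j, (i \notin I) || (j \notin I) -> Y i j = 0) ->
  (forall i j, i \in I -> j \in I -> (K *m Y) i j = (i == j)%:R) ->
  padmx (invmx (psubmx I K)) = Y.
Proof.
move=> Y0 KY; rewrite -[RHS](padmx_psubmx Y0); congr padmx.
have E : psubmx I K *m psubmx I Y = 1%:M.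
  apply/matrixP => a b; rewrite !mxE.
  under eq_bigr do rewrite !mxE.
  rewrite -(big_enum_val (fun c => K (enum_val a) c * Y c (enum_val b))).
  have := KY _ _ (enum_valP a) (enum_valP b); rewrite (inj_eq enum_val_inj) => <-.
  rewrite mxE [RHS](bigID (mem I))/= [X in _ = _ + X]big1 ?addr0// => c cI.
  by rewrite Y0 ?cI// mulr0.
have [Ku _] := mulmx1_unit E.
by rewrite -[LHS]mulmx1 -E mulmxA mulVmx// mul1mx.
Qed.

End principal_inverse.

(** * The hat matrix and its principal inverses *)

Section hat_matrix.
Variables (R : realType) (n : nat) (r : 'I_n).
Implicit Types (c i j k : 'I_n) (cc th : 'I_n -> R) (m : 'M[R]_n).
Local Notation par := (path_par r).
Local Notation dep := (path_dep r).
Local Notation sub := (subtree par).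
Local Notation part_mx := (@part_mx R n r par).
Local Notation factor_mx := (@factor_mx R n r par).
Local Notation back_mx := (@back_mx R n r par).
Local Notation elim_mx := (@elim_mx R n r par).

Let dpar := @path_dep_par n r.
Let rpar := path_par_root r.

Lemma part_mx_ext cc cc' th th' : (forall c, c != r -> cc c = cc' c) ->
  (forall k, th k = th' k) -> part_mx cc th predT = part_mx cc' th' predT.
Proof.
move=> ce te; have UE : elim_mx cc = elim_mx cc'.
  apply/matrixP => i j; rewrite !mxE; case: ifPn => // /andP[ir _].
  by rewrite ce.
by apply/matrixP => a b; rewrite !mxE /back_mx UE; apply: eq_bigr => k _; rewrite te.
Qed.

Lemma piG_eq (X m : 'M[R]_n) : X^T = X -> ZG m -> (forall k, X k k = m k k) ->
  (forall c, c != r -> X c (par c) = m c (par c)) -> piG X = m.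
Proof.
move=> Xs [ms m0] hd he; apply/matrixP => i j; rewrite mxE.
have XE a b : X a b = X b a by rewrite -[in LHS]Xs mxE.
have mE a b : m a b = m b a by rewrite -[in LHS]ms mxE.
case: ifPn => [|ij]; last by rewrite m0.
rewrite (edge_tadj r) => /or3P[/eqP <-//|/andP[ir /eqP <-]|/andP[jr /eqP <-]].
  exact: he.
by rewrite XE mE; exact: he.
Qed.

(** The entries on the diagonal and on the edges determine the slopes, by
    part_mx_edge, and then th, by part_mx_diag. *)
Lemma piG_inj_part_mx cc cc' th th' : (forall k, 0 < th k) ->
  piG (part_mx cc th predT) = piG (part_mx cc' th' predT) ->
  part_mx cc th predT = part_mx cc' th' predT.
Proof.
move=> th0 /matrixP e.
have ed k : part_mx cc th predT k k = part_mx cc' th' predT k k.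
  by have := e k k; rewrite [LHS]mxE [RHS]mxE edgexx.
have ee c : c != r -> part_mx cc th predT c (par c) = part_mx cc' th' predT c (par c).
  move=> cr; have := e c (par c); rewrite [LHS]mxE [RHS]mxE (edge_tadj r).
  by rewrite /tadj /child cr eqxx orbT.
have Xp k : part_mx cc th predT k k != 0.
  have qk (A : 'M[R]_n) : (delta_mx 0 k *m A *m (delta_mx 0 k)^T) (0 : 'I_1) (0 : 'I_1) = A k k.
    by rewrite -rowE trmx_delta -colE !mxE.
  have [_ h] := posdef_part_mx dpar cc th0.
  rewrite gt_eqF// -qk; apply: h.
  by apply/eqP => /matrixP/(_ 0 k)/eqP; rewrite !mxE !eqxx oner_eq0.
have ce c : c != r -> cc c = cc' c.
  move=> cr; have := ee c cr; rewrite !(part_mx_edge dpar rpar)// -ed.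
  exact/mulIf/Xp.
apply: part_mx_ext => // k; have := ed k; rewrite (part_mx_diag dpar rpar cc) (part_mx_diag dpar rpar cc').
case: ifPn => kr; last by rewrite !addr0.
by rewrite (ce k kr) (ed (par k)); exact: addIr.
Qed.

Lemma invmx_part_mx cc th : (forall k, th k != 0) ->
  invmx (part_mx cc th predT) = factor_mx cc (fun k => (th k)^-1).
Proof.
move=> th0; have := @factor_mxK R n r par dep dpar cc (fun k => (th k)^-1).
rewrite (@part_mx_ext cc cc (fun k => (th k)^-1^-1) th)//; last by move=> k; rewrite invrK.
move=> /(_ (fun k => eq_ind_r (fun b => ~~ b) (th0 k) (invr_eq0 _))) E.
have [_ Xu] := mulmx1_unit E.
by rewrite -[LHS]mul1mx -E mulmxK.
Qed.

(** The inverse of part_mx is a factor_mx, hence tridiagonal. For uniqueness, the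
    inverse of another candidate factors through its own pivots and slopes, and
    piG_inj_part_mx applies. *)
Lemma hat_part_mx cc th : (forall k, 0 < th k) ->
  hat (piG (part_mx cc th predT)) = part_mx cc th predT.
Proof.
move=> th0; have thn k : th k != 0 by rewrite gt_eqF.
apply: xget_unique.
  split=> //; first exact: posdef_part_mx dpar _ _ th0.
  rewrite invmx_part_mx//; split.
    by apply/ZG_tree_sym; exact: factor_mx_sym dpar _ _.
  by apply: (posdef_factor_mx dpar) => k; rewrite invr_gt0.
move=> X [Xpos Xm [KZ Kpos]].
have Kt : tree_sym r par (invmx X) by exact/ZG_tree_sym.
have p0 := pivot_gt0 dpar rpar Kt Kpos.
have pn0 k : pivot r par dep (invmx X) k != 0 by rewrite gt_eqF.
have KE := factor_pivot dpar Kt pn0.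
have := factor_mxK dpar (slope r par dep (invmx X)) pn0; rewrite -KE => E.
have [Ku _] := mulmx1_unit E.
have XE : X = part_mx (slope r par dep (invmx X)) (fun k => (pivot r par dep (invmx X) k)^-1) predT.
  by rewrite -[LHS]invmxK -[LHS]mulmx1 -E mulmxA mulVmx// mul1mx.
rewrite {1}XE; apply: piG_inj_part_mx => [k|]; first by rewrite invr_gt0.
by rewrite -XE.
Qed.

Lemma part_mxD cc th (J : pred 'I_n) :
  part_mx cc th predT - part_mx cc th J = part_mx cc th (predC J).
Proof.
apply/matrixP => a b; rewrite !mxE (bigID J)/= addrAC subrr add0r.
by [].
Qed.

(** If I is closed under descendants, the elimination of the vertices of I does
    not involve the others, so the inverse of the block of the inverse keeps
    the terms of part_mx indexed by I. *)
Lemma MI_part_mx cc th (I : {set 'I_n}) : (forall k, 0 < th k) ->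
  (forall k j, k \in I -> sub k j -> j \in I) ->
  MI (piG (part_mx cc th predT)) I = part_mx cc th (fun k => k \in I).
Proof.
move=> th0 Icl; have thn k : th k != 0 by rewrite gt_eqF.
rewrite /MI hat_part_mx// invmx_part_mx//; apply: padmx_invmx_psubmx => i j.
  have off a k : a \notin I -> k \in I -> back_mx cc a k = 0.
    by move=> aI kI; rewrite (back_mx_off dpar)//; apply: contra aI; exact: Icl.
  move=> ij; rewrite mxE big1// => k kI.
  by case/orP: ij => h; rewrite (off _ _ h kI) !(mulr0, mul0r).
move=> iI jI; have Uu := elim_mx_unit dpar cc.
have -> : factor_mx cc (fun k => (th k)^-1) *m part_mx cc th (fun k => k \in I) =
    (elim_mx cc)^T *m diag_mx (\row_k (k \in I)%:R) *m (back_mx cc)^T.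
  rewrite part_mxE /factor_mx /back_mx !mulmxA mulmxK//; congr (_ *m _).
  rewrite -mulmxA mulmx_diag; congr (_ *m diag_mx _); apply/rowP => k; rewrite !mxE.
  by case: ifP => _; rewrite ?mulr0 ?mulVf.
have : (back_mx cc *m elim_mx cc) j i = (i == j)%:R by rewrite mulVmx// mxE eq_sym.
move=> <-; rewrite [LHS]mxE [RHS]mxE; apply: eq_bigr => k _.
rewrite mul_mx_diag !mxE; have [kI|kI] := boolP (k \in I); first by rewrite mulr1 mulrC.
rewrite mulr0 mul0r ifF; last first.
  apply: contraNF kI => /andP[kr /eqP pk]; apply: Icl iI _.
  by rewrite -pk -subtree_par ?subtree_refl// eq_sym (par_neq dpar).
have [ki|ki] := eqVneq k i; first by rewrite ki iI in kI.
by rewrite subr0 mulr0.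
Qed.

End hat_matrix.

(** * The variance function *)

Section variance.
Variables (R : realType) (n : nat) (r : 'I_n) (s : 'I_n -> R).
Local Notation par := (path_par r).
Local Notation dep := (path_dep r).
Local Notation sub := (subtree par).
Local Notation pivot := (@pivot R n r par dep).
Local Notation slope := (@slope R n r par dep).
Local Notation part_mx := (@part_mx R n r par).
Local Notation factor_mx := (@factor_mx R n r par).
Local Notation cong_mx := (@cong_mx R n r par).
Hypotheses (s12 : forall k, k != r -> 1 / 2 < s k) (sr0 : 0 < s r).
Implicit Types (c i j k : 'I_n) (m y z u : 'M[R]_n).

Let dpar := @path_dep_par n r.
Let rpar := path_par_root r.

Let s0 k : 0 < s k.
Proof. by have [->//|/s12 h] := eqVneq k r; rewrite (lt_trans _ h). Qed.

Lemma PG_pivot_gt0 y : PG y -> forall k, 0 < pivot y k.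
Proof. by move=> [yZ yp]; apply: (pivot_gt0 dpar rpar) => //; exact/ZG_tree_sym. Qed.

Lemma wishart_meanE y : PG y -> wishart_mean s r.+1 y = piG (mean_mx r s y).
Proof.
move=> yP; have [yZ _] := yP; have p0 := PG_pivot_gt0 yP.
apply/matrixP => i j; rewrite [LHS]mxE [RHS]mxE; have [ij|ij] := boolP (edge i j); last first.
  rewrite (_ : (fun t => _) = cst 0) ?expectation_cst//.
  by apply/funext => t; rewrite mxE (negbTE ij).
have [_ _ e _] := wishart_moments s12 sr0 yZ p0 (ZG_sym_delta R ij).
rewrite pairing_sym_delta in e; last exact: part_mx_sym.
rewrite -[RHS]e unlock /Rintegral; congr fine; apply: eq_integral => t _.
by rewrite pairing_sym_delta//; case: (chartIG_IG t).
Qed.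

Lemma mean_mx_factor cc D : (forall k, 0 < D k) ->
  mean_mx r s (factor_mx cc D) = part_mx cc (fun k => s k / D k) predT.
Proof.
move=> D0; have Dn k : D k != 0 by rewrite gt_eqF.
apply: part_mx_ext => [c cr|k]; first exact: (slope_factor_mx dpar).
by rewrite (pivot_factor_mx dpar).
Qed.

(** The slopes cc and the ratios th = s / D of a parameter of mean m are read off
    m by solving part_mx_edge and part_mx_diag from the root to the leaves; they
    are positive because the 2 x 2 minors of m are. *)
Lemma wishart_mean_surj m : QG m -> exists2 y, PG y & wishart_mean s r.+1 y = m.
Proof.
move=> mQ; have mI : IG m by case: mQ.
have [mp mo] := (QGP mI).1 mQ.
have [ms m0] := mI.
have mE a b : m a b = m b a by rewrite -[in LHS]ms mxE.
pose cc c := m c (par c) / m (par c) (par c).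
pose th k := m k k - (if k != r then cc k ^+ 2 * m (par k) (par k) else 0).
have th0 k : 0 < th k.
  rewrite /th; case: ifPn => kr; last by rewrite subr0.
  have h : m k (par k) ^+ 2 < m k k * m (par k) (par k).
    have [lt|gt|e] := ltngtP k r; last by rewrite (val_inj e) eqxx in kr.
      by apply: mo; rewrite path_par_lt.
    rewrite mE mulrC; apply: mo; rewrite path_par_gt// prednK//.
    exact: leq_ltn_trans gt.
  rewrite /cc subr_gt0 (_ : _ * _ = m k (par k) ^+ 2 / m (par k) (par k)).
    by rewrite ltr_pdivrMr.
  by field; rewrite gt_eqF.
pose D k := s k / th k.
have D0 k : 0 < D k by rewrite divr_gt0.
have yP : PG (factor_mx cc D).
  split; first by apply/ZG_tree_sym; exact: factor_mx_sym dpar _ _.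
  exact: posdef_factor_mx dpar _ _ D0.
exists (factor_mx cc D) => //; rewrite wishart_meanE// mean_mx_factor//.
have -> : part_mx cc (fun k => s k / D k) predT = part_mx cc th predT.
  apply: part_mx_ext => // k; rewrite /D; field.
  by rewrite !gt_eqF.
have Xd k : part_mx cc th predT k k = m k k.
  elim/(root_ind dpar) : k => k IH; rewrite (part_mx_diag dpar rpar) /th.
  by case: ifPn => kr; rewrite ?IH// ?subrK// subr0 addr0.
apply: (@piG_eq _ _ r) => //; first exact: part_mx_sym.
move=> c cr; rewrite (part_mx_edge dpar rpar)// Xd /cc divfK//.
by rewrite gt_eqF.
Qed.

Lemma wishart_psiP m : QG m ->
  PG (wishart_psi s r.+1 m) /\ wishart_mean s r.+1 (wishart_psi s r.+1 m) = m.
Proof.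
move=> mQ; have [y yP ym] := wishart_mean_surj mQ.
have ss : set_surj (@PG R n) [set m] (wishart_mean s r.+1) by move=> _ ->; exists y.
split; last by apply: (surjpK (fun=> 0) ss); rewrite inE.
have := @surjpinv_image_sub _ _ (fun=> 0) _ _ _ ss; apply; exists m => //.
Qed.

Section at_parameter.
Variable y : 'M[R]_n.
Hypothesis yP : PG y.
Let yZ : ZG y. Proof. by case: yP. Qed.
Let p0 := PG_pivot_gt0 yP.
Let th k := s k / pivot y k.
Let th0 k : 0 < th k. Proof. by rewrite divr_gt0. Qed.
Local Notation V := (tree_variance r par dep y ^~ s).
Local Notation P := (wishart s r.+1 y).
Local Notation m := (wishart_mean s r.+1 y).

Let X := mean_mx r s y.

(** Polarization of the variance. *)
Lemma covariance_wishart z u : ZG z -> ZG u ->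
  covariance P (fun t => pairing z (chartIG t)) (fun t => pairing u (chartIG t)) =
  ((V (z + u) - V z - V u) / 2)%:E.
Proof.
move=> zZ uZ; pose W (z : 'M[R]_n) (t : coordIG R n) := pairing z (chartIG t).
have [iz iz2 ez ez2] := wishart_moments s12 sr0 yZ p0 zZ.
have [iu iu2 eu eu2] := wishart_moments s12 sr0 yZ p0 uZ.
have [_ izu2 _ ezu2] := wishart_moments s12 sr0 yZ p0 (ZG_add zZ uZ).
have WD t : W (z + u) t = W z t + W u t by rewrite /W /pairing mulmxDl linearD.
have WM : W z * W u = (fun t => 1 / 2 * (W (z + u) t ^+ 2 - W z t ^+ 2 - W u t ^+ 2)).
  apply/funext => t; have -> : (W z * W u) t = W z t * W u t by [].
  by rewrite WD; field.
have iB (f g : coordIG R n -> R) : P.-integrable setT (EFin \o f) -> P.-integrable setT (EFin \o g) ->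
    P.-integrable setT (EFin \o (fun x => f x - g x)).
  move=> fi gi; have -> : EFin \o (fun x => f x - g x) = ((EFin \o f) \- (EFin \o g))%E.
    by apply/funext => x; rewrite /= EFinB.
  exact: integrableB.
have i1 := iB _ _ izu2 iz2; have i2 := iB _ _ i1 iu2.
have iWM : P.-integrable setT (EFin \o (W z * W u)).
  rewrite WM (_ : EFin \o _ = (fun x => (1 / 2 : R)%R%:E * (EFin \o (fun t => W (z + u) t ^+ 2 - W z t ^+ 2 - W u t ^+ 2)%R) x)%E).
    exact: integrableZl.
  by apply/funext => x; rewrite /= EFinM.
have EE (f : coordIG R n -> R) : P.-integrable setT (EFin \o f) ->
    ('E_P[f] = (\int[P]_t f t)%R%:E)%E.
  by move=> fi; rewrite unlock /Rintegral fineK//; exact: integrable_fin_num.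
rewrite covarianceE; [|exact/Lfun1_integrable|exact/Lfun1_integrable|exact/Lfun1_integrable].
rewrite !EE// -EFinM -EFinB; congr (_%:E).
rewrite [X in X - _](_ : _ = 1 / 2 * (V (z + u) + pairing (z + u) X ^+ 2
   - (V z + pairing z X ^+ 2) - (V u + pairing u X ^+ 2))); last first.
  rewrite -ez2 -eu2 -ezu2 -!RintegralB// -RintegralZl//.
  by apply: eq_Rintegral => t _; rewrite WM.
rewrite ez eu /pairing mulmxDl linearD/= -!/(pairing _ _); by field.
Qed.

Let a (i : nat) : R := (at1 s i)^-1.

(** The announced value of the variance function at the mean of parameter y. *)
Definition variance_mx u : 'M[R]_n :=
  (a 1 + a n - a r.+1) *: PP (hat m) u
  + \sum_(1 <= i < r.+1) (a i.+1 - a i) *: PP (hat m - MI m (seg n 1 i)) u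
  + \sum_(r.+2 <= i < n.+1) (a i.-1 - a i) *: PP (hat m - MI m (seg n i n)) u.

Let mE : m = piG X. Proof. exact: wishart_meanE. Qed.

Let hatE : hat m = X.
Proof. by rewrite mE; exact: hat_part_mx. Qed.

Let MI_left (i : nat) : (1 <= i < r.+1)%N ->
  hat m - MI m (seg n 1 i) = part_mx (slope y) th (fun k => (i <= k)%N).
Proof.
move=> /andP[i1 ir]; rewrite hatE mE MI_part_mx//; last first.
  move=> k j; rewrite !inE => ki; rewrite path_subtree_lt; last lia.
  lia.
rewrite part_mxD; apply/matrixP => p q; rewrite !mxE; apply: eq_bigl => k.
by rewrite /= inE -leqNgt.
Qed.

Let MI_right (i : nat) : (r.+2 <= i < n.+1)%N ->
  hat m - MI m (seg n i n) = part_mx (slope y) th (fun k => (k.+1 < i)%N).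
Proof.
move=> /andP[ri iN]; rewrite hatE mE MI_part_mx//; last first.
  move=> k j; have := ltn_ord j; rewrite !inE => jn ki; rewrite path_subtree_gt; last lia.
  lia.
rewrite part_mxD; apply/matrixP => p q; rewrite !mxE; apply: eq_bigl => k.
by rewrite /= inE ltn_ord andbT -ltnNge.
Qed.


Local Notation w := (cong_mx (slope y)).

(** The sum over pairs (c, k) with k outside of the subtree of c appears twice in
    tree_variance; exchanging the indices in one copy makes the coefficients
    symmetric in j and k. *)
Lemma tree_variance_sum z : tree_sym r par z -> V z =
  \sum_j \sum_k (th j * th k * w z j k ^+ 2) *
    ((if j == k then (s k)^-1 else 0) + (if (j != r) && ~~ sub j k then (s j)^-1 else 0)
     + (if (k != r) && ~~ sub k j then (s k)^-1 else 0)).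
Proof.
move=> zs; pose F j k := if (j != r) && ~~ sub j k then th j / s j * (th k * w z j k ^+ 2) else 0.
have E1 : \sum_(c | c != r) th c / s c * \sum_(k | ~~ sub c k) th k * w z c k ^+ 2 =
    \sum_j \sum_k F j k.
  rewrite big_mkcond; apply: eq_bigr => j _; rewrite /F; case: ifPn => jr.
    by rewrite mulr_sumr big_mkcond; apply: eq_bigr => k _.
  by rewrite big1.
rewrite /tree_variance E1 mulrDl mul1r -[in X in _ + (_ + X)]exchange_big/=.
rewrite -big_split/= -big_split/=; apply: eq_bigr => j _.
have -> : th j ^+ 2 * w z j j ^+ 2 / s j =
    \sum_k if j == k then th j * th k * w z j k ^+ 2 / s k else 0.
  by rewrite -big_mkcond/= (big_pred1 j)// => k; rewrite eq_sym.
rewrite -big_split/= -big_split/=; apply: eq_bigr => k _.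
rewrite /F (cong_mx_sym _ zs k j) !mulrDr addrA.
by congr (_ + _ + _); case: ifP => _; rewrite ?mulr0//; ring.
Qed.

Let telescope (f : nat -> R) (m p : nat) (c : nat) : (m <= p)%N ->
  \sum_(m <= i < p) (f i.+1 - f i) * (i <= c)%:R = f (maxn m (minn p c.+1)) - f m.
Proof.
move=> mp; elim: p mp => [|p IH]; first by rewrite leqn0 => /eqP ->; rewrite big_geq// min0n subrr.
rewrite leq_eqVlt => /orP[/eqP <-|]; first by rewrite big_geq// (maxn_idPl _) ?subrr// geq_minl.
rewrite ltnS => mp; rewrite big_nat_recr//= IH//; have [pc|cp] := leqP p c.
  by rewrite (minn_idPl (leqW pc)) (maxn_idPr mp) minnSS (minn_idPl pc) (maxn_idPr (leqW mp)) mulr1; ring.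
by rewrite mulr0 addr0 (minn_idPr cp) (minn_idPr (leqW cp)).
Qed.

Lemma pairing_variance_mx z u : ZG z -> pairing z (variance_mx u) =
  (a 1 + a n - a r.+1) * quad_form (hat m) z u
  + \sum_(1 <= i < r.+1) (a i.+1 - a i) * quad_form (hat m - MI m (seg n 1 i)) z u
  + \sum_(r.+2 <= i < n.+1) (a i.-1 - a i) * quad_form (hat m - MI m (seg n i n)) z u.
Proof.
move=> zZ; have pZ (c : R) (A : 'M[R]_n) : pairing z (c *: A) = c * pairing z A.
  by rewrite /pairing -scalemxAr linearZ.
have pS (I : Type) (l : seq I) (c : I -> R) (A : I -> 'M[R]_n) :
    pairing z (\sum_(i <- l) c i *: PP (A i) u) = \sum_(i <- l) c i * quad_form (A i) z u.
  rewrite /pairing mulmx_sumr linear_sum/=; apply: eq_bigr => i _.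
  by rewrite -[LHS]/(pairing z _) pZ pairing_PP.
by rewrite -!pS -(pairing_PP _ _ zZ) -pZ /pairing !mulmxDr !linearD.
Qed.

(** The coefficient of th j * th k * w_jk ^+ 2 in the pairing of z with
    variance_mx z. *)
Let coef j k : R := a 1 + a n - a r.+1
  + \sum_(1 <= i < r.+1) (a i.+1 - a i) * ((i <= j) && (i <= k))%N%:R
  + \sum_(r.+2 <= i < n.+1) (a i.-1 - a i) * ((j.+1 < i) && (k.+1 < i))%N%:R.

Let coefE j k : coef j k =
  a (maxn 1 (minn r.+1 (minn j k).+1)) + a (maxn r.+1 (maxn j k).+1) - a r.+1.
Proof.
rewrite /coef; under eq_bigr do rewrite -leq_min.
rewrite telescope// big_add1/=.
have -> : \sum_(r.+1 <= i < n) (a i - a i.+1) * ((j.+1 < i.+1) && (k.+1 < i.+1))%N%:R =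
    \sum_(r.+1 <= i < n) (a i.+1 - a i) * (i <= maxn j k)%N%:R - \sum_(r.+1 <= i < n) (a i.+1 - a i).
  rewrite -sumrB; apply: eq_bigr => i _; rewrite !ltnS -gtn_max ltnNge.
  by case: leqP => _; rewrite /=; ring.
have rn := ltn_ord r; have jn := ltn_ord j; have kn := ltn_ord k.
rewrite telescope// telescope_sumr// (_ : minn n (maxn j k).+1 = (maxn j k).+1); last lia.
ring.
Qed.

(** On the same side of the root, both coefficients are the inverse of s at the
    index that is farther from the root. On opposite sides they differ, but no
    edge joins the two subtrees and the entry of w is zero. *)
Lemma variance_coef z j k : tree_sym r par z ->
  coef j k = (if j == k then (s k)^-1 else 0) + (if (j != r) && ~~ sub j k then (s j)^-1 else 0)
     + (if (k != r) && ~~ sub k j then (s k)^-1 else 0) \/ w z j k = 0.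
Proof.
move=> zs; have aE i : (s i)^-1 = a i.+1 by rewrite /a at1E.
rewrite coefE !aE.
wlog jk : j k / (j <= k)%N.
  move=> H; have [jk|kj] := boolP (j <= k)%N; first exact: H.
  rewrite -ltnNge in kj; have [e|e] := H k j (ltnW kj); last by right; rewrite (cong_mx_sym _ zs).
  left; rewrite (minnC j k) (maxnC j k) e eq_sym; case: eqVneq => [->|_]; ring.
have nr i : (i < r)%N -> i != r by move=> h; rewrite -(inj_eq val_inj)/= ltn_eqF.
have rr i : (r < i)%N -> i != r by move=> h; rewrite -(inj_eq val_inj)/= gtn_eqF.
have [e|njk] := eqVneq j k.
  left; rewrite e !subtree_refl !andbF !addr0.
  have [h|h] := leqP k r.
    have -> : maxn 1 (minn r.+1 (minn k k).+1) = k.+1 by lia.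
    have -> : maxn r.+1 (maxn k k).+1 = r.+1 by lia.
    by ring.
  have -> : maxn 1 (minn r.+1 (minn k k).+1) = r.+1 by lia.
  have -> : maxn r.+1 (maxn k k).+1 = k.+1 by lia.
  by ring.
have {}jk : (j < k)%N by rewrite ltn_neqAle jk andbT.
have [kr|rk] := leqP k r.
  left; have jr : (j < r)%N by exact: leq_trans jk kr.
  rewrite (nr _ jr) path_subtree_lt// -ltnNge jk/=.
  have -> : (k != r) && ~~ sub k j = false.
    have [->|kr'] := eqVneq k r; first by [].
    by rewrite path_subtree_lt ?(ltnW jk)// ltn_neqAle kr andbT.
  have -> : maxn 1 (minn r.+1 (minn j k).+1) = j.+1 by lia.
  have -> : maxn r.+1 (maxn j k).+1 = r.+1 by lia.
  by ring.
have [rj|jr] := leqP r j.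
  left; rewrite (rr _ rk) (@path_subtree_gt _ _ k j rk) -ltnNge jk/=.
  have -> : (j != r) && ~~ sub j k = false.
    have [->|jr'] := eqVneq j r; first by [].
    by rewrite path_subtree_gt ?(ltnW jk)// ltn_neqAle eq_sym jr'.
  have -> : maxn 1 (minn r.+1 (minn j k).+1) = r.+1 by lia.
  have -> : maxn r.+1 (maxn j k).+1 = k.+1 by lia.
  by ring.
right; rewrite (cong_mx_cut dpar rpar _ zs (nr _ jr)); last first.
  by rewrite path_subtree_lt// -ltnNge.
rewrite (back_mx_off dpar) ?mulr0// path_subtree_gt// -ltnNge path_par_lt//.
exact: leq_ltn_trans jr rk.
Qed.

Lemma pairing_variance_diag z : ZG z -> pairing z (variance_mx z) = V z.
Proof.
move=> zZ; have zs : tree_sym r par z by exact/ZG_tree_sym.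
have qE (J : pred 'I_n) : quad_form (part_mx (slope y) th J) z z =
    \sum_j \sum_k (th j * th k * w z j k ^+ 2) * (J j && J k)%:R.
  rewrite /quad_form pairing_quad_part_mx// big_mkcond; apply: eq_bigr => j _.
  case: ifP => _; last by rewrite big1// => k _; rewrite mulr0.
  by rewrite big_mkcond; apply: eq_bigr => k _; case: ifP => _; rewrite ?mulr1 ?mulr0.
have qX : quad_form (hat m) z z = \sum_j \sum_k th j * th k * w z j k ^+ 2.
  by rewrite hatE [X]/(part_mx (slope y) th predT) qE; do 2 (apply: eq_bigr => ? _); rewrite mulr1.
rewrite pairing_variance_mx// tree_variance_sum// qX.
rewrite [X in _ + X + _](_ : _ = \sum_(1 <= i < r.+1) \sum_j \sum_k
   (th j * th k * w z j k ^+ 2) * ((a i.+1 - a i) * ((i <= j) && (i <= k))%N%:R)); last first.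
  apply: eq_big_nat => i ir; rewrite (MI_left ir) qE mulr_sumr.
  by apply: eq_bigr => j _; rewrite mulr_sumr; apply: eq_bigr => k _; rewrite mulrCA.
rewrite [X in _ + _ + X](_ : _ = \sum_(r.+2 <= i < n.+1) \sum_j \sum_k
   (th j * th k * w z j k ^+ 2) * ((a i.-1 - a i) * ((j.+1 < i) && (k.+1 < i))%N%:R)); last first.
  apply: eq_big_nat => i ir; rewrite (MI_right ir) qE mulr_sumr.
  by apply: eq_bigr => j _; rewrite mulr_sumr; apply: eq_bigr => k _; rewrite mulrCA.
rewrite [X in _ + X + _]exchange_big/= [X in _ + _ + X]exchange_big/= mulr_sumr -!big_split/=.
apply: eq_bigr => j _; rewrite [X in _ + X + _]exchange_big/= [X in _ + _ + X]exchange_big/= mulr_sumr -!big_split/=.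
apply: eq_bigr => k _; rewrite -!mulr_sumr [(_ + _ - _) * _]mulrC -!mulrDr -/(coef j k).
by have [->//|->] := variance_coef j k zs; rewrite expr0n/= mulr0 !mul0r.
Qed.

(** An element of I_G is determined by its pairings with Z_G, and the quadratic
    forms agree by pairing_variance_diag; both sides are then polarized. *)
Lemma wishart_covE u : ZG u -> wishart_cov s r.+1 y u = variance_mx u.
Proof.
move=> uZ; have VZ : IG (variance_mx u).
  have hs : (hat m)^T = hat m by rewrite hatE; exact: part_mx_sym.
  apply: ZG_add; first apply: ZG_add.
  - by apply: ZG_scale; exact: PP_ZG.
  - rewrite big_nat_cond; apply: ZG_sum => i /andP[ir _]; apply: ZG_scale; apply: PP_ZG => //.
    by rewrite (MI_left ir); exact: part_mx_sym.
  - rewrite big_nat_cond; apply: ZG_sum => i /andP[ir _]; apply: ZG_scale; apply: PP_ZG => //.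
    by rewrite (MI_right ir); exact: part_mx_sym.
have cE z : ZG z -> (pairing z (variance_mx u))%:E =
    covariance P (fun t => pairing u (chartIG t)) (fun t => pairing z (chartIG t)).
  move=> zZ; rewrite covariance_wishart//; congr (_%:E).
  have uzZ := ZG_add uZ zZ.
  rewrite -!pairing_variance_diag// !pairing_variance_mx//.
  have SD (l : seq nat) (c : nat -> R) (A : nat -> 'M[R]_n) :
      \sum_(i <- l) c i * quad_form (A i) (u + z) (u + z) =
      \sum_(i <- l) c i * quad_form (A i) u u + \sum_(i <- l) c i * quad_form (A i) z z
      + 2 * \sum_(i <- l) c i * quad_form (A i) z u.
    rewrite mulr_sumr -!big_split/=; apply: eq_bigr => i _; rewrite quad_formD; ring.
  by rewrite quad_formD !SD; field.
apply: xget_unique => // A [AI AE]; apply: ZG_eq_pairing => // z zZ.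
by apply/EFin_inj; rewrite AE// cE.
Qed.

End at_parameter.
End variance.

Theorem theorem5 (R : realType) (n M : nat) (s : 'I_n -> R)
    (hn : (1 <= n)%N) (hM : (1 <= M <= n)%N)
    (hs : forall i, (1 <= i <= n)%N -> i != M -> 1 / 2 < at1 s i)
    (hsM : 0 < at1 s M)
    (m : 'M[R]_n) (hm : QG m) (u : 'M[R]_n) (hu : ZG u) :
  variance_function s M m u =
    ((at1 s 1)^-1 + (at1 s n)^-1 - (at1 s M)^-1) *: PP (hat m) u
    + \sum_(1 <= i < M)
        ((at1 s i.+1)^-1 - (at1 s i)^-1) *: PP (hat m - MI m (seg n 1 i)) u
    + \sum_(M.+1 <= i < n.+1)
        ((at1 s i.-1)^-1 - (at1 s i)^-1) *: PP (hat m - MI m (seg n i n)) u.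
Proof.
case: M hM hs hsM => // M hM hs hsM.
pose r := Ordinal hM : 'I_n.
have s12 k : k != r -> 1 / 2 < s k.
  by move=> kr; have := hs k.+1; rewrite at1E; apply; rewrite ?ltn_ord// eqSS.
have sr0 : 0 < s r by rewrite -at1E.
have [yP ym] := wishart_psiP s12 sr0 hm.
rewrite /variance_function (_ : M.+1 = r.+1)// (wishart_covE s12 sr0 yP hu).
by rewrite /variance_mx ym.
Qed.
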